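(* Let $f\in BMO$. Then the following are equivalent. 1. The sequence of matrices $\{T_n(|f|^2)-T_n(f)T_n(\bar f)\}_{n\ge 1}$ converges to $\{O_n\}$ in Type 2 strong cluster sense. 2. The operators $T_{|f|^2}-T_fT_{\bar f}$ and $T_{|\tilde f|^2}-T_{\tilde f}T_{\tilde{\bar f}}$ on $H^2(\mathbb{T})$ are both compact.
   Context: $\mathbb{T}$ is the unit circle and $L^2(\mathbb{T})=L^2(\mathbb{T},\frac{1}{2\pi}d\theta)$. For an integrable function $f$ on $\mathbb{T}$, $f_n$ ($n\in\mathbb{Z}$) denotes its $n$-th Fourier coefficient. $H^2(\mathbb{T})=\{f\in L^2(\mathbb{T}): f_n=0 \text{ for all } n<0\}$, and $P$ is the orthogonal projection of $L^2(\mathbb{T})$ onto $H^2(\mathbb{T})$. For a function $f$ on $\mathbb{T}$, $\bar f$ is its complex conjugate, $\tilde f(z)=f(z^{-1})$, and $\tilde{\bar f}(z)=\bar f(z^{-1})=\overline{\tilde f(z)}$. Toeplitz matrix: $T_n(f)=(f_{i-j})_{0\le i,j<n}$, an $n\times n$ matrix; $T_n(|f|^2)$ is formed from the Fourier coefficients of $|f|^2$. $O_n$ is the $n\times n$ zero matrix. Toeplitz operator: for $f\in L^2(\mathbb{T})$, $T_f(g)=P(fg)$ for $g\in H^2(\mathbb{T})$ in its domain (which contains the bounded analytic functions $H^\infty$, a dense subspace). Hankel operator: for $f\in L^2(\mathbb{T})$, $H_f: H^2(\mathbb{T})\to (H^2(\mathbb{T}))^\perp$, $H_f(g)=(I-P)(fg)$,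 densely defined with domain containing $H^\infty$. One has $T_{fg}-T_fT_g=H_{\bar f}^*H_g$. For $f\in BMO$ the operators $H_f$ and $H_{\bar f}$ are bounded (they extend to bounded operators on $H^2(\mathbb{T})$). For $f\in BMO$ (possibly unbounded), $T_{|f|^2}-T_fT_{\bar f}$ is understood as the bounded operator $H_{\bar f}^*H_{\bar f}$ on $H^2(\mathbb{T})$, i.e. the bounded extension of the operator defined on analytic polynomials; likewise $T_{|\tilde f|^2}-T_{\tilde f}T_{\tilde{\bar f}}=H_{\tilde{\bar f}}^*H_{\tilde{\bar f}}$. $BMO$: a function $f\in L^2(\mathbb{T})$ belongs to $BMO$ if $$\sup_I\left[\frac{1}{|I|}\int_I|f(\theta)-f_I|^2\,d\theta\right]^{1/2}<\infty,$$ where the supremum is over intervals (arcs) $I$ of $\mathbb{T}$, $|I|$ is the length of $I$, and $f_I=\frac{1}{|I|}\int_I f(\theta)\,d\theta$. Type 2 strong cluster sense: a sequence $\{A_n\}$, with each $A_n$ a complex $n\times n$ matrix, converges to $\{O_n\}$ in Type 2 strong cluster sense if for every $\epsilon>0$ there exist positive integers $N_{1,\epsilon}$ and $N_{2,\epsilon}$ (depending on $\epsilon$ but not on $n$) such that for every $n>N_{2,\epsilon}$ one can write $A_n=R_n+N_n$ with $\operatorname{rank}(R_n)\le N_{1,\epsilon}$ and $\|N_n\|<\epsilon$ (operator norm). *)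

(* Defs.v *)
From HB Require Import structures.
From mathcomp Require Import all_boot all_order all_algebra.
From mathcomp Require Import all_classical all_reals all_analysis.
From mathcomp Require Import complex.

Set Implicit Arguments.
Unset Strict Implicit.
Unset Printing Implicit Defensive.

Import Order.TTheory GRing.Theory Num.Theory.
Import numFieldNormedType.Exports.
Local Open Scope classical_set_scope.
Local Open Scope complex_scope.
Local Open Scope ring_scope.

(* MathComp-Analysis, over an arbitrary [R : realType]; complex numbers are
   [R[i]].  A function on the unit circle is a [2 pi]-periodic function of the
   angle, [R -> R[i]] (the periodicity is part of [L2T]).  Elements of [L2T]
   are functions rather than classes, so equalities between them are a.e. *)

Section Circle.
Context {R : realType}.
Implicit Types (f g h k : R -> R[i]) (z : R[i]).

Local Notation mu := (@lebesgue_measure R).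

Definition cmod z : R := ComplexField.Normc.normc z.

Definition cintegral (D : set R) f : R[i] :=
  Rintegral mu D (fun t => complex.Re (f t)) +i*
  Rintegral mu D (fun t => complex.Im (f t)).

Definition circle_mean f : R[i] := ((pi *+ 2)^-1)%:C * cintegral `[0, pi *+ 2] f.

Definition cis (t : R) : R[i] := cos t +i* sin t.

Definition fourier f (n : int) : R[i] :=
  circle_mean (fun t => f t * cis (- (n%:~R * t))).

Definition fconj f : R -> R[i] := fun t => (f t)^*.

(* f~(z) = f(z^-1) at z = e^(it) *)
Definition ftilde f : R -> R[i] := fun t => f (- t).

Definition fsqmod f : R -> R[i] := fun t => (cmod (f t) ^+ 2)%:C.

Definition L2T f : Prop :=
  [/\ forall t, f (t + pi *+ 2) = f t,
      measurable_fun setT (fun t => complex.Re (f t)),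
      measurable_fun setT (fun t => complex.Im (f t)) &
      mu.-integrable `[0, pi *+ 2] (fun t => (cmod (f t) ^+ 2)%:E)].

Definition inner g h : R[i] := circle_mean (fun t => g t * (h t)^*).

Definition L2norm g : R :=
  Num.sqrt ((pi *+ 2)^-1 * Rintegral mu `[0, pi *+ 2] (fun t => cmod (g t) ^+ 2)).

Definition H2 : set (R -> R[i]) :=
  [set g | L2T g /\ forall n : int, n < 0 -> fourier g n = 0].

Definition H2perp : set (R -> R[i]) :=
  [set g | L2T g /\ forall h, H2 h -> inner g h = 0].

(* [h] is (a representative of) the orthogonal projection of [g] onto [H2] *)
Definition H2_projection g h : Prop := H2 h /\ H2perp (g - h).

(* Arcs of the circle are the intervals [a, b] of angles with
   0 < b - a <= 2 pi; they may cross the origin thanks to periodicity. *)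
Definition arc_mean (a b : R) f : R[i] := ((b - a)^-1)%:C * cintegral `[a, b] f.

Definition mean_oscillation (a b : R) f : R :=
  Num.sqrt ((b - a)^-1 *
    Rintegral mu `[a, b] (fun t => cmod (f t - arc_mean a b f) ^+ 2)).

Definition BMO f : Prop :=
  L2T f /\ has_ubound [set mean_oscillation I.1 I.2 f |
                        I in [set I : R * R | 0 < I.2 - I.1 <= pi *+ 2]].

Definition bounded_linear (D E : set (R -> R[i]))
    (K : (R -> R[i]) -> (R -> R[i])) : Prop :=
  [/\ forall g, D g -> E (K g),
      forall (a : R[i]) g h, D g -> D h ->
        K (fun t => a * g t + h t) = (fun t => a * K g t + K h t) %[ae mu] &
      exists M : R, forall g, D g -> L2norm (K g) <= M * L2norm g].

(* The densely defined Hankel operator H_f, as a graph: its domain consists of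
   the g in H2 with f g in L2 (in particular it contains H^oo), and
   H_f g = (I - P)(f g). *)
Definition hankel_graph f g k : Prop :=
  [/\ H2 g, L2T (f * g) &
      exists2 h, H2_projection (f * g) h & k = f * g - h %[ae mu]].

Definition hankel_domain f : set (R -> R[i]) :=
  [set g | H2 g /\ L2T (f * g)].

Definition bounded_hankel f (H : (R -> R[i]) -> (R -> R[i])) : Prop :=
  bounded_linear H2 H2perp H /\
  forall g, hankel_domain f g -> hankel_graph f g (H g).

Definition hankel_adjoint (H Hs : (R -> R[i]) -> (R -> R[i])) : Prop :=
  (forall k, H2perp k -> H2 (Hs k)) /\
  forall g k, H2 g -> H2perp k -> inner (H g) k = inner g (Hs k).

(* [A] is the bounded operator T_(|f|^2) - T_f T_(conj f) on H2, that is
   H_(conj f)^* H_(conj f), where H_(conj f) stands for its bounded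
   extension.  [A] is unique up to a.e. equality of its values. *)
Definition toeplitz_semicommutator f (A : (R -> R[i]) -> (R -> R[i])) : Prop :=
  exists H Hs, [/\ bounded_hankel (fconj f) H, hankel_adjoint H Hs &
                   forall g, H2 g -> A g = Hs (H g)].

Definition compact_on_H2 (A : (R -> R[i]) -> (R -> R[i])) : Prop :=
  forall g : nat -> R -> R[i],
    (forall n, H2 (g n)) -> (exists M : R, forall n, L2norm (g n) <= M) ->
  exists phi : nat -> nat, {homo phi : m n / (m < n)%N} /\
  exists2 h, H2 h & L2norm (A (g (phi n)) - h) @[n --> \oo] --> (0 : R).

Definition toeplitz_mx f (n : nat) : 'M[R[i]]_n :=
  \matrix_(i < n, j < n) fourier f ((i : nat)%:Z - (j : nat)%:Z).

Definition cvnorm n (x : 'cV[R[i]]_n) : R :=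
  Num.sqrt (\sum_(i < n) cmod (x i 0) ^+ 2).

Definition mx_opnorm n (A : 'M[R[i]]_n) : R :=
  sup [set cvnorm (A *m x) | x in [set x : 'cV[R[i]]_n | cvnorm x <= 1]].

Definition type2_strong_cluster_to0 (A : forall n, 'M[R[i]]_n) : Prop :=
  forall eps : R, 0 < eps ->
  exists N1 N2 : nat, [/\ (0 < N1)%N, (0 < N2)%N &
    forall n, (N2 < n)%N ->
    exists Rn Nn : 'M[R[i]]_n,
      [/\ A n = Rn + Nn, (\rank Rn <= N1)%N & mx_opnorm Nn < eps]].

End Circle.

(* Main.v *)
Require Import Defs.
From HB Require Import structures.
From mathcomp Require Import all_boot all_order all_algebra.
From mathcomp Require Import all_classical all_reals all_analysis.
From mathcomp Require Import complex measurable_realfun.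
From mathcomp Require Import ring lra zify.
(** Let [c k] be the Fourier coefficient of index [- k] of [conj f].  On analytic
    polynomials the Hankel operator with symbol [conj f] is the infinite matrix
    with entries [c (j + m + 1)], and the quadratic form of
    [T_(|f|^2) - T_f T_(conj f)] at [x] is the squared norm of the image of [x]
    under that matrix.  Both sides of the equivalence reduce to one condition on
    such a matrix, [vanishing_tail]: its restriction to finite sequences supported
    far from the origin has arbitrarily small norm.

    The matrix [T_n(|f|^2) - T_n(f) T_n(conj f)] is a Gram matrix
    ([semicommutator_mxE]): its quadratic form at [x] is the squared norm of
    [conj f * p], where [p] is the polynomial with coefficients [x], after the
    frequencies 0 to [n - 1] have been removed.  By Parseval the remaining
    frequencies split into the negative ones, which give the Hankel form of [f] at
    [x], and those above [n - 1], which give the Hankel form of [f~] at [x]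
    reversed.  This is Widom's identity ([residue_ge], [residue_le]).

    If both tails vanish, restricting to the coordinates away from both ends
    leaves a matrix of small norm, at the price of a bounded rank
    ([cluster_of_tails]).  Conversely, if a tail does not vanish, vectors supported
    ever farther out can be chosen so that their images are nearly orthogonal;
    this makes the form bounded below on spaces of every dimension
    ([large_subspace]), which must meet the kernel of the low-rank part of a
    clustering matrix ([tail_of_cluster]).

    On the operator side, a vanishing tail makes the Hankel form bounded, so the
    Hankel operator, its adjoint and their product exist, and the product is
    compact because only finitely many coordinates matter up to a small error
    ([compact_semicommutator_of_tail]).  In the other direction, the unit vectors
    that witness a tail that does not vanish tend weakly to zero, which a compact
    operator does not tolerate ([tail_of_compact_semicommutator]).

    The Fourier analysis behind this is that of square-integrable functions:
    Bessel's inequality, uniqueness of Fourier coefficients ([fourier_inj]),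
    completeness ([L2_complete]), and the Riesz-Fischer and Parseval theorems. *)

Set Implicit Arguments.
Unset Strict Implicit.
Unset Printing Implicit Defensive.
Import Order.TTheory GRing.Theory Num.Theory.
Import numFieldNormedType.Exports.
Local Open Scope classical_set_scope.
Local Open Scope ring_scope.

(** * Complex-valued integrals over a period *)

Section Complex.
Context {R : realType}.
Implicit Types (x y z : R[i]) (a b : R).

Lemma complexP x y :
  complex.Re x = complex.Re y -> complex.Im x = complex.Im y -> x = y.
Proof. by case: x => ? ?; case: y => ? ? /= -> ->. Qed.

Lemma ReD x y : complex.Re (x + y) = complex.Re x + complex.Re y.
Proof. by case: x; case: y. Qed.
Lemma ImD x y : complex.Im (x + y) = complex.Im x + complex.Im y.
Proof. by case: x; case: y. Qed.
Lemma ReN x : complex.Re (- x) = - complex.Re x.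
Proof. by case: x. Qed.
Lemma ImN x : complex.Im (- x) = - complex.Im x.
Proof. by case: x. Qed.
Lemma ReM x y : complex.Re (x * y) =
  complex.Re x * complex.Re y - complex.Im x * complex.Im y.
Proof. by case: x; case: y. Qed.
Lemma ImM x y : complex.Im (x * y) =
  complex.Re x * complex.Im y + complex.Im x * complex.Re y.
Proof. by case: x => a b; case: y => c d /=; ring. Qed.
Lemma ReJ x : complex.Re x^* = complex.Re x.
Proof. by case: x. Qed.
Lemma ImJ x : complex.Im x^* = - complex.Im x.
Proof. by case: x. Qed.
Lemma ReC a : complex.Re a%:C%C = a. Proof. by []. Qed.
Lemma ImC a : complex.Im a%:C%C = 0. Proof. by []. Qed.

Definition ReImE := (ReD, ImD, ReN, ImN, ReM, ImM, ReJ, ImJ, ReC, ImC).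

Lemma cmod_ge0 z : 0 <= cmod z.
Proof. by case: z => a b; exact: sqrtr_ge0. Qed.

Lemma cmodE z : cmod z ^+ 2 = complex.Re z ^+ 2 + complex.Im z ^+ 2.
Proof. by case: z => a b /=; rewrite /cmod /= sqr_sqrtr // addr_ge0 ?sqr_ge0. Qed.

Lemma cmodM x y : cmod (x * y) = cmod x * cmod y.
Proof. exact: ComplexField.Normc.normcM. Qed.

Lemma cmodN x : cmod (- x) = cmod x.
Proof. exact: normcN. Qed.

Lemma cmodJ x : cmod x^* = cmod x.
Proof. by case: x => a b; rewrite /cmod /= sqrrN. Qed.

Lemma cmodC a : cmod a%:C%C = `|a|.
Proof. by rewrite /cmod /= expr0n /= addr0 sqrtr_sqr. Qed.

Lemma cmod0 : cmod (0 : R[i]) = 0.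
Proof. exact: ComplexField.Normc.normc0. Qed.

Lemma cmod0_eq0 z : cmod z = 0 -> z = 0.
Proof. exact: ComplexField.Normc.eq0_normc. Qed.

Lemma cmodD x y : cmod (x + y) <= cmod x + cmod y.
Proof. exact: le_normcD. Qed.

Lemma mulJE z : z * z^* = (cmod z ^+ 2)%:C%C.
Proof.
by apply: complexP; rewrite !ReImE ?cmodE; ring.
Qed.

Lemma cmodDsq x y : cmod (x + y) ^+ 2 =
  cmod x ^+ 2 + cmod y ^+ 2 + complex.Re (x * y^*) *+ 2.
Proof. by rewrite !cmodE !ReImE; ring. Qed.

Lemma Re_le_cmod z : `|complex.Re z| <= cmod z.
Proof.
rewrite -(ler_pXn2r (ltn0Sn 1)) ?nnegrE ?cmod_ge0 // -normrX.
by rewrite ger0_norm ?sqr_ge0 // cmodE lerDl sqr_ge0.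
Qed.

Lemma Im_le_cmod z : `|complex.Im z| <= cmod z.
Proof.
rewrite -(ler_pXn2r (ltn0Sn 1)) ?nnegrE ?cmod_ge0 // -normrX.
by rewrite ger0_norm ?sqr_ge0 // cmodE lerDr sqr_ge0.
Qed.

Lemma cmodDsq_le x y : cmod (x + y) ^+ 2 <= (cmod x ^+ 2 + cmod y ^+ 2) *+ 2.
Proof.
rewrite !cmodE !ReImE.
have := sqr_ge0 (complex.Re x - complex.Re y).
have := sqr_ge0 (complex.Im x - complex.Im y); rewrite !sqrrB !sqrrD; lra.
Qed.

Lemma Re_sum I (r : seq I) (P : pred I) (F : I -> R[i]) :
  complex.Re (\sum_(i <- r | P i) F i) = \sum_(i <- r | P i) complex.Re (F i).
Proof. exact: (big_morph (@complex.Re R) ReD). Qed.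

(** The discriminant argument behind every Cauchy-Schwarz inequality below:
    [a], [b], [z] stand for the two squared norms and the inner product. *)
Lemma discriminant_le a b z : 0 <= a -> 0 <= b ->
  (forall w, 0 <= a + complex.Re (w * z) *+ 2 + cmod w ^+ 2 * b) ->
  cmod z ^+ 2 <= a * b.
Proof.
move=> a0 b0 H.
have {}H t : 0 <= a - (t * cmod z ^+ 2) *+ 2 + t ^+ 2 * cmod z ^+ 2 * b.
  have := H ((- t)%:C%C * z^*).
  rewrite cmodM cmodJ cmodC exprMn normrN real_normK ?num_real //.
  suff -> : complex.Re ((- t)%:C%C * z^* * z) = - (t * cmod z ^+ 2) by rewrite mulNrn.
  by rewrite cmodE !ReImE; ring.
have z0 := sqr_ge0 (cmod z).
have [b_eq0|bn0] := eqVneq b 0.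
  have [->|zn0] := eqVneq (cmod z ^+ 2) 0; first by rewrite mulr_ge0.
  have := H ((a + 1) / cmod z ^+ 2).
  rewrite b_eq0 !mulr0 addr0 divfK //; lra.
have b_gt0 : 0 < b by rewrite lt_neqAle eq_sym bn0.
have := H b^-1.
have -> : a - (b^-1 * cmod z ^+ 2) *+ 2 + b^-1 ^+ 2 * cmod z ^+ 2 * b =
  a - cmod z ^+ 2 / b by field.
by rewrite subr_ge0 ler_pdivrMr.
Qed.

End Complex.

Local Notation cRe := complex.Re.
Local Notation cIm := complex.Im.

Section Integral.
Context {R : realType}.
Implicit Types (f g h k : R -> R[i]) (a : R[i]).

Local Notation mu := (@lebesgue_measure R).
Local Notation D := (`[0, pi *+ 2]%classic : set R).

Definition cint g :=
  mu.-integrable D (EFin \o (fun t => cRe (g t))) /\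
  mu.-integrable D (EFin \o (fun t => cIm (g t))).

Let mD : measurable D. Proof. exact: measurable_itv. Qed.

Lemma cintegralD g h : cint g -> cint h ->
  cintegral D (g + h) = cintegral D g + cintegral D h.
Proof.
move=> [g1 g2] [h1 h2]; apply: complexP; rewrite ?(ReD, ImD) /= -RintegralD //;
by apply: eq_Rintegral => t _; rewrite /= ?(ReD, ImD).
Qed.

Lemma cintD g h : cint g -> cint h -> cint (g + h).
Proof.
move=> [g1 g2] [h1 h2]; split.
- by apply: eq_integrable (integrableD _ g1 h1) => // t _ /=; rewrite ReImE.
- by apply: eq_integrable (integrableD _ g2 h2) => // t _ /=; rewrite ReImE.
Qed.

Let intZ (r : R) (u : R -> R) : mu.-integrable D (EFin \o u) ->
  mu.-integrable D (EFin \o (fun t => r * u t)).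
Proof. by move=> iu; apply: eq_integrable (integrableZl _ r iu). Qed.

Let intB (u v : R -> R) : mu.-integrable D (EFin \o u) ->
  mu.-integrable D (EFin \o v) -> mu.-integrable D (EFin \o (fun t => u t - v t)).
Proof. by move=> iu iv; apply: eq_integrable (integrableB _ iu iv). Qed.

Let intD (u v : R -> R) : mu.-integrable D (EFin \o u) ->
  mu.-integrable D (EFin \o v) -> mu.-integrable D (EFin \o (fun t => u t + v t)).
Proof. by move=> iu iv; apply: eq_integrable (integrableD _ iu iv). Qed.

Lemma cintZ a g : cint g -> cint (cst a * g).
Proof.
move=> [g1 g2]; split.
- apply: eq_integrable (intB (intZ (cRe a) g1) (intZ (cIm a) g2)) => // t _ /=.
  by rewrite ReImE.
- apply: eq_integrable (intD (intZ (cRe a) g2) (intZ (cIm a) g1)) => // t _ /=.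
  by rewrite ReImE.
Qed.

Lemma cintegralZ a g : cint g -> cintegral D (cst a * g) = a * cintegral D g.
Proof.
move=> [g1 g2]; apply: complexP.
- rewrite ReM /= -!RintegralZl // -RintegralB //; try exact: intZ.
  by apply: eq_Rintegral => t _; rewrite /= ReM.
- rewrite ImM /= -!RintegralZl // -RintegralD //; try exact: intZ.
  by apply: eq_Rintegral => t _; rewrite /= ImM.
Qed.

Lemma cintegral_conj g : cint g -> cintegral D (fconj g) = (cintegral D g)^*.
Proof.
move=> [g1 g2]; apply: complexP.
- by rewrite ReJ /=; apply: eq_Rintegral => t _; rewrite /fconj ReImE.
- rewrite ImJ /= -[RHS]mulN1r -RintegralZl //.
  by apply: eq_Rintegral => t _; rewrite /fconj ReImE mulN1r.
Qed.

Lemma cint0 : cint 0.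
Proof. by split; exact: integrable0. Qed.

Lemma circle_meanD g h : cint g -> cint h ->
  circle_mean (g + h) = circle_mean g + circle_mean h.
Proof. by move=> ig ih; rewrite /circle_mean cintegralD // mulrDr. Qed.

Lemma circle_meanZ a g : cint g -> circle_mean (cst a * g) = a * circle_mean g.
Proof. by move=> ig; rewrite /circle_mean cintegralZ // mulrCA. Qed.

Lemma circle_mean_conj g : cint g -> circle_mean (fconj g) = (circle_mean g)^*.
Proof.
move=> ig; rewrite /circle_mean cintegral_conj // rmorphM; congr (_ * _).
by apply: complexP; rewrite !ReImE ?oppr0.
Qed.

Lemma circle_mean0 : circle_mean (0 : R -> R[i]) = 0.
Proof.
have -> : (0 : R -> R[i]) = cst 0 * 0 by rewrite mulr0.
by rewrite circle_meanZ ?mul0r //; exact: cint0.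
Qed.

Lemma circle_meanN g : cint g -> circle_mean (- g) = - circle_mean g.
Proof.
move=> ig; have -> : - g = cst (-1) * g by apply/funext => t /=; rewrite mulN1r.
by rewrite circle_meanZ // mulN1r.
Qed.

Lemma cint_sum I (s : seq I) (F : I -> R -> R[i]) :
  (forall i, cint (F i)) -> cint (\sum_(i <- s) F i).
Proof. by move=> iF; elim/big_ind: _ => //; [exact: cint0|exact: cintD]. Qed.

Lemma circle_mean_sum I (s : seq I) (F : I -> R -> R[i]) :
  (forall i, cint (F i)) ->
  circle_mean (\sum_(i <- s) F i) = \sum_(i <- s) circle_mean (F i).
Proof.
move=> iF; elim: s => [|i s IH]; first by rewrite !big_nil circle_mean0.
by rewrite !big_cons circle_meanD ?IH //; exact: cint_sum.
Qed.

End Integral.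

(** * The pre-Hilbert space of square-integrable functions on the circle *)

Section L2.
Context {R : realType}.
Implicit Types (f g h k : R -> R[i]) (a : R[i]).

Local Notation mu := (@lebesgue_measure R).
Local Notation D := (`[0, pi *+ 2]%classic : set R).

Let mD : measurable D. Proof. exact: measurable_itv. Qed.

Definition cmeas g := measurable_fun setT (fun t => cRe (g t)) /\
  measurable_fun setT (fun t => cIm (g t)).

Definition periodic g := forall t : R, g (t + pi *+ 2) = g t.

Lemma cmeasD g h : cmeas g -> cmeas h -> cmeas (g + h).
Proof.
move=> [g1 g2] [h1 h2]; split.
- rewrite (_ : (fun t => _) = (fun t => cRe (g t) + cRe (h t))); last first.
    by apply/funext => t; rewrite /= ReD.
  exact: measurable_funD.
- rewrite (_ : (fun t => _) = (fun t => cIm (g t) + cIm (h t))); last first.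
    by apply/funext => t; rewrite /= ImD.
  exact: measurable_funD.
Qed.

Lemma cmeasM g h : cmeas g -> cmeas h -> cmeas (g * h).
Proof.
move=> [g1 g2] [h1 h2]; split.
- rewrite (_ : (fun t => _) =
    (fun t => cRe (g t) * cRe (h t) - cIm (g t) * cIm (h t))); last first.
    by apply/funext => t; rewrite /= ReM.
  by apply: measurable_funB; apply: measurable_funM.
- rewrite (_ : (fun t => _) =
    (fun t => cRe (g t) * cIm (h t) + cIm (g t) * cRe (h t))); last first.
    by apply/funext => t; rewrite /= ImM.
  by apply: measurable_funD; apply: measurable_funM.
Qed.

Lemma cmeas_conj g : cmeas g -> cmeas (fconj g).
Proof.
move=> [g1 g2]; split.
- by rewrite (_ : (fun t => _) = (fun t => cRe (g t))) //; apply/funext => t;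
    rewrite /fconj ReJ.
- rewrite (_ : (fun t => _) = (fun t => - cIm (g t))); last first.
    by apply/funext => t; rewrite /fconj ImJ.
  exact: measurableT_comp.
Qed.

Lemma cmeas_cst a : cmeas (cst a).
Proof. by split; exact: measurable_cst. Qed.

Lemma cmeas_sqmod g : cmeas g -> measurable_fun setT (fun t => cmod (g t) ^+ 2).
Proof.
move=> [g1 g2].
rewrite (_ : (fun t => _) = (fun t => cRe (g t) ^+ 2 + cIm (g t) ^+ 2)); last first.
  by apply/funext => t; rewrite cmodE.
by apply: measurable_funD; apply: measurable_funX.
Qed.

Lemma L2TP g : L2T g <-> [/\ periodic g, cmeas g &
  mu.-integrable D (EFin \o (fun t => cmod (g t) ^+ 2))].
Proof. by split=> [[p m1 m2 i]|[p [m1 m2] i]]; split. Qed.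

Lemma L2T_periodic g : L2T g -> periodic g. Proof. by case. Qed.
Lemma L2T_cmeas g : L2T g -> cmeas g. Proof. by case. Qed.
Lemma L2T_int g : L2T g -> mu.-integrable D (EFin \o (fun t => cmod (g t) ^+ 2)).
Proof. by case. Qed.

Lemma cint_dom g (u : R -> R) : cmeas g -> mu.-integrable D (EFin \o u) ->
  (forall t, D t -> cmod (g t) <= u t) -> cint g.
Proof.
move=> [g1 g2] iu gu; split; apply: le_integrable iu => //.
- by apply/measurable_EFinP; apply: measurable_funS g1.
- move=> t Dt /=; rewrite lee_fin (le_trans (Re_le_cmod _)) //.
  by rewrite (le_trans (gu _ Dt)) ?ler_norm.
- by apply/measurable_EFinP; apply: measurable_funS g2.
- move=> t Dt /=; rewrite lee_fin (le_trans (Im_le_cmod _)) //.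
  by rewrite (le_trans (gu _ Dt)) ?ler_norm.
Qed.

Let intD (u v : R -> R) : mu.-integrable D (EFin \o u) ->
  mu.-integrable D (EFin \o v) -> mu.-integrable D (EFin \o (fun t => u t + v t)).
Proof. by move=> iu iv; apply: eq_integrable (integrableD _ iu iv). Qed.

Lemma L2T_cintM g h : L2T g -> L2T h -> cint (g * h).
Proof.
move=> /L2TP[_ mg ig] /L2TP[_ mh ih].
apply: (cint_dom (cmeasM mg mh) (intD ig ih)) => t _.
rewrite /= cmodM; have := sqr_ge0 (cmod (g t) - cmod (h t)).
have := mulr_ge0 (cmod_ge0 (g t)) (cmod_ge0 (h t)); rewrite sqrrB; lra.
Qed.

Lemma L2T_conj g : L2T g -> L2T (fconj g).
Proof.
move=> /L2TP[pg mg ig]; apply/L2TP; split; first by move=> t; rewrite /fconj pg.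
- exact: cmeas_conj.
- by apply: eq_integrable ig => // t _ /=; rewrite /fconj cmodJ.
Qed.

Let intZ (r : R) (u : R -> R) : mu.-integrable D (EFin \o u) ->
  mu.-integrable D (EFin \o (fun t => r * u t)).
Proof. by move=> iu; apply: eq_integrable (integrableZl _ r iu). Qed.

Let int_dom (u v : R -> R) : measurable_fun setT u ->
  mu.-integrable D (EFin \o v) ->
  (forall t, `|u t| <= v t) -> mu.-integrable D (EFin \o u).
Proof.
move=> mu' iv uv; apply: le_integrable iv => //.
- by apply/measurable_EFinP; apply: measurable_funS mu'.
- by move=> t Dt /=; rewrite lee_fin (le_trans (uv _)) ?ler_norm.
Qed.

Lemma L2TD g h : L2T g -> L2T h -> L2T (g + h).
Proof.
move=> /L2TP[pg mg ig] /L2TP[ph mh ih]; apply/L2TP; split.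
- by move=> t; rewrite !fctE pg ph.
- exact: cmeasD.
- apply: (int_dom (cmeas_sqmod (cmeasD mg mh)) (intZ 2 (intD ig ih))).
  move=> t; rewrite ger0_norm ?sqr_ge0 // mulr_natl.
  exact: cmodDsq_le.
Qed.

Lemma L2T_bounded (u g : R -> R[i]) (M : R) : periodic u -> cmeas u ->
  (forall t, cmod (u t) <= M) -> L2T g -> L2T (u * g).
Proof.
move=> pu mu' uM /L2TP[pg mg ig]; apply/L2TP; split.
- by move=> t; rewrite !fctE pg pu.
- exact: cmeasM.
- apply: (int_dom (cmeas_sqmod (cmeasM mu' mg)) (intZ (M ^+ 2) ig)).
  move=> t; rewrite ger0_norm ?sqr_ge0 // cmodM exprMn.
  rewrite -[X in _ <= X]/(M ^+ 2 * cmod (g t) ^+ 2).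
  rewrite ler_wpM2r ?sqr_ge0 // ler_pXn2r ?nnegrE ?cmod_ge0 //.
  exact: le_trans (cmod_ge0 _) (uM t).
Qed.

Lemma L2TZ a g : L2T g -> L2T (cst a * g).
Proof. by apply: (@L2T_bounded _ _ (cmod a)) => [t||t]. Qed.

Lemma L2TN g : L2T g -> L2T (- g).
Proof.
move=> ig; have -> : - g = cst (-1) * g by apply/funext => t /=; rewrite mulN1r.
exact: L2TZ.
Qed.

Lemma L2TB g h : L2T g -> L2T h -> L2T (g - h).
Proof. by move=> ? ?; apply: L2TD => //; apply: L2TN. Qed.

Lemma L2T_cst a : L2T (cst a).
Proof.
apply/L2TP; split=> [t||] //.
apply: measurable_bounded_integrable => //.
- by rewrite /= lebesgue_measure_itv /=; case: ifP => _ //; rewrite ltry.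
- exact: (measurable_cst (cmod a ^+ 2)).
- exact: (@bounded_cst _ _ (cmod a ^+ 2) R D).
Qed.

Lemma L2T0 : L2T (0 : R -> R[i]). Proof. exact: (L2T_cst 0). Qed.

Lemma L2T_sum I (s : seq I) (F : I -> R -> R[i]) :
  (forall i, L2T (F i)) -> L2T (\sum_(i <- s) F i).
Proof. by move=> iF; elim/big_ind: _ => //; [exact: L2T0|exact: L2TD]. Qed.

Lemma L2T_cint g : L2T g -> cint g.
Proof. by move=> ig; rewrite -[g]mulr1; apply: L2T_cintM => //; exact: (L2T_cst 1). Qed.

Lemma innerE g h : inner g h = circle_mean (g * fconj h). Proof. by []. Qed.

Lemma cint_inner g h : L2T g -> L2T h -> cint (g * fconj h).
Proof. by move=> ig ih; apply: L2T_cintM => //; exact: L2T_conj. Qed.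

Lemma innerJ g h : L2T g -> L2T h -> inner h g = (inner g h)^*.
Proof.
move=> ig ih; rewrite !innerE -circle_mean_conj; last exact: cint_inner.
congr circle_mean; apply/funext => t.
by rewrite -[LHS]/(h t * (g t)^*) -[RHS]/((g t * (h t)^*)^*) rmorphM /= conjCK mulrC.
Qed.

Lemma innerDl g h k : L2T g -> L2T h -> L2T k ->
  inner (g + h) k = inner g k + inner h k.
Proof.
by move=> ig ih ik; rewrite !innerE mulrDl circle_meanD //; exact: cint_inner.
Qed.

Lemma innerZl a g k : L2T g -> L2T k -> inner (cst a * g) k = a * inner g k.
Proof.
by move=> ig ik; rewrite !innerE -mulrA circle_meanZ //; exact: cint_inner.
Qed.

Lemma innerNl g k : L2T g -> L2T k -> inner (- g) k = - inner g k.
Proof.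
by move=> ig ik; rewrite !innerE mulNr circle_meanN //; exact: cint_inner.
Qed.

Lemma innerBl g h k : L2T g -> L2T h -> L2T k ->
  inner (g - h) k = inner g k - inner h k.
Proof. by move=> ig ih ik; rewrite innerDl ?innerNl //; exact: L2TN. Qed.

Lemma inner_suml I (s : seq I) (F : I -> R -> R[i]) k :
  (forall i, L2T (F i)) -> L2T k ->
  inner (\sum_(i <- s) F i) k = \sum_(i <- s) inner (F i) k.
Proof.
move=> iF ik; rewrite innerE mulr_suml circle_mean_sum // => i.
exact: cint_inner.
Qed.

Lemma innerDr g h k : L2T g -> L2T h -> L2T k ->
  inner k (g + h) = inner k g + inner k h.
Proof.
move=> ig ih ik; rewrite (innerJ (L2TD ig ih) ik) innerDl // rmorphD /=.
by rewrite -!innerJ.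
Qed.

Lemma innerNr g k : L2T g -> L2T k -> inner k (- g) = - inner k g.
Proof.
move=> ig ik; rewrite (innerJ (L2TN ig) ik) innerNl // rmorphN /=.
by rewrite -innerJ.
Qed.

Lemma innerBr g h k : L2T g -> L2T h -> L2T k ->
  inner k (g - h) = inner k g - inner k h.
Proof. by move=> ig ih ik; rewrite innerDr ?innerNr //; exact: L2TN. Qed.

Lemma innerZr a g k : L2T g -> L2T k -> inner k (cst a * g) = a^* * inner k g.
Proof.
move=> ig ik; rewrite (innerJ (L2TZ a ig) ik) innerZl // rmorphM /=.
by rewrite -innerJ.
Qed.

Lemma inner_sumr I (s : seq I) (F : I -> R -> R[i]) k :
  (forall i, L2T (F i)) -> L2T k ->
  inner k (\sum_(i <- s) F i) = \sum_(i <- s) inner k (F i).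
Proof.
move=> iF ik; rewrite (innerJ (L2T_sum s iF) ik) inner_suml // rmorph_sum.
by apply: eq_bigr => i _; rewrite /= -innerJ.
Qed.

Lemma twopi_gt0 : 0 < (pi *+ 2 : R).
Proof. by rewrite pmulrn_lgt0 // pi_gt0. Qed.

Lemma L2norm_ge0 g : 0 <= L2norm g. Proof. exact: sqrtr_ge0. Qed.

Lemma L2normE g : L2norm g ^+ 2 =
  (pi *+ 2)^-1 * Rintegral mu D (fun t => cmod (g t) ^+ 2).
Proof.
rewrite sqr_sqrtr // mulr_ge0 ?invr_ge0 ?(ltW twopi_gt0) //.
by apply: Rintegral_ge0 => t _; exact: sqr_ge0.
Qed.

Lemma inner_norm g : inner g g = (L2norm g ^+ 2)%:C%C.
Proof.
rewrite L2normE innerE /circle_mean (_ : cintegral _ _ =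
  (Rintegral mu D (fun t => cmod (g t) ^+ 2))%:C%C).
  by apply: complexP; rewrite !ReImE /=; ring.
rewrite (_ : g * fconj g = fsqmod g); last by apply/funext => t; exact: mulJE.
apply: complexP => //=.
by rewrite (_ : (fun t => _) = cst 0) ?Rintegral_cst ?mul0r.
Qed.

Lemma L2normDsq g h : L2T g -> L2T h -> L2norm (g + h) ^+ 2 =
  L2norm g ^+ 2 + L2norm h ^+ 2 + cRe (inner g h) *+ 2.
Proof.
move=> ig ih.
have /(congr1 (@complex.Re R)) := inner_norm (g + h).
rewrite innerDl ?innerDr ?inner_norm //; last exact: L2TD.
rewrite (innerJ ig ih) !ReD ReJ [RHS]/= => <-.
by rewrite /= mulr2n; ring.
Qed.

Lemma L2normZ a g : L2T g -> L2norm (cst a * g) = cmod a * L2norm g.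
Proof.
move=> ig; apply/eqP; rewrite -(@eqrXn2 _ 2) ?mulr_ge0 ?L2norm_ge0 ?cmod_ge0 //.
apply/eqP.
have : inner (cst a * g) (cst a * g) = (cmod a ^+ 2)%:C%C * (L2norm g ^+ 2)%:C%C.
  by rewrite (innerZl _ ig (L2TZ a ig)) innerZr // inner_norm mulrA mulJE.
rewrite inner_norm => /(congr1 (@complex.Re R)); rewrite ReM /= => ->.
by rewrite exprMn mul0r subr0.
Qed.

Lemma L2normN g : L2norm (- g) = L2norm g.
Proof.
rewrite /L2norm; congr (Num.sqrt (_ * _)).
by apply: eq_Rintegral => t _ /=; rewrite cmodN.
Qed.

Lemma cauchy_schwarz_sq g h : L2T g -> L2T h ->
  cmod (inner g h) ^+ 2 <= L2norm g ^+ 2 * L2norm h ^+ 2.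
Proof.
move=> ig ih; apply: discriminant_le; rewrite ?sqr_ge0 // => w.
have := sqr_ge0 (L2norm (g + cst w^* * h)).
rewrite L2normDsq ?innerZr //; last exact: L2TZ.
by rewrite L2normZ // cmodJ conjCK exprMn addrAC.
Qed.

Lemma cauchy_schwarz g h : L2T g -> L2T h ->
  cmod (inner g h) <= L2norm g * L2norm h.
Proof.
move=> ig ih.
rewrite -(@ler_pXn2r _ 2) ?nnegrE ?mulr_ge0 ?L2norm_ge0 ?cmod_ge0 //.
by rewrite exprMn; exact: cauchy_schwarz_sq.
Qed.

Lemma L2normD g h : L2T g -> L2T h -> L2norm (g + h) <= L2norm g + L2norm h.
Proof.
move=> ig ih.
rewrite -(@ler_pXn2r _ 2) ?nnegrE ?addr_ge0 ?L2norm_ge0 //.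
rewrite L2normDsq // sqrrD.
have := cauchy_schwarz ig ih.
have := le_trans (ler_norm _) (Re_le_cmod (inner g h)); lra.
Qed.

Lemma L2normB g h : L2T g -> L2T h -> L2norm (g - h) <= L2norm g + L2norm h.
Proof. by move=> ig ih; rewrite -(L2normN h) L2normD //; exact: L2TN. Qed.

Lemma L2norm_le_sq g (M : R) : 0 <= M -> L2norm g ^+ 2 <= M ^+ 2 -> L2norm g <= M.
Proof. by move=> M0; rewrite ler_pXn2r ?nnegrE ?L2norm_ge0. Qed.

End L2.

(** * Trigonometric polynomials and Bessel's inequality *)

Section Exponentials.
Context {R : realType}.
Implicit Types (f g h : R -> R[i]) (m n k : int).

Local Notation mu := (@lebesgue_measure R).
Local Notation D := (`[0, pi *+ 2]%classic : set R).

Lemma cisD (s t : R) : cis (s + t) = cis s * cis t.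
Proof. by apply: complexP; rewrite ?ReM ?ImM /= ?cosD ?sinD; ring. Qed.

Lemma cisJ (t : R) : (cis t)^* = cis (- t).
Proof. by apply: complexP; rewrite ?ReJ ?ImJ /= ?cosN ?sinN. Qed.

Lemma cis0 : cis (0 : R) = 1.
Proof. by apply: complexP; rewrite /= ?cos0 ?sin0. Qed.

Lemma cmod_cis (t : R) : cmod (cis t) = 1.
Proof. by rewrite /cmod /= cos2Dsin2 sqrtr1. Qed.

Definition ex (n : int) : R -> R[i] := fun t => cis (n%:~R * t).

Lemma exD m n : ex (m + n) = ex m * ex n.
Proof. by apply/funext => t; rewrite /ex /= intrD mulrDl cisD. Qed.

Lemma ex0 : ex 0 = cst 1.
Proof. by apply/funext => t; rewrite /ex /= mul0r cis0. Qed.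

Lemma exJ n : fconj (ex n) = ex (- n).
Proof. by apply/funext => t; rewrite /ex /fconj cisJ intrN mulNr. Qed.

Lemma ex_twopi n : ex n (pi *+ 2) = 1.
Proof.
have H1 (p : nat) : ex p%:Z (pi *+ 2) = 1.
  elim: p => [|p IH]; first by rewrite ex0.
  rewrite -[p.+1]addn1 PoszD exD -[LHS]/(ex p (pi *+ 2) * ex 1 (pi *+ 2)) IH mul1r.
  rewrite /ex mul1r; apply: complexP; rewrite /= ?cos2pi ?sin2pi //.
case: n => p; first exact: H1.
rewrite NegzE -exJ /fconj H1; exact: rmorph1.
Qed.

Lemma ex_periodic n : periodic (ex n).
Proof. by move=> t; rewrite /ex mulrDr cisD -/(ex n (pi *+ 2)) ex_twopi mulr1. Qed.

Lemma cmeas_ex n : cmeas (ex n).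
Proof.
have ml : measurable_fun setT (fun t : R => n%:~R * t).
  by apply: measurable_funM; [exact: measurable_cst|exact: measurable_id].
split; rewrite /ex /=.
- by apply: (measurableT_comp _ ml); apply: continuous_measurable_fun;
    exact: continuous_cos.
- by apply: (measurableT_comp _ ml); apply: continuous_measurable_fun;
    exact: continuous_sin.
Qed.

Lemma L2T_exM n g : L2T g -> L2T (ex n * g).
Proof.
apply: (@L2T_bounded _ _ _ 1); first exact: ex_periodic.
- exact: cmeas_ex.
- by move=> t; rewrite cmod_cis.
Qed.

Lemma L2T_ex n : L2T (ex n).
Proof. by rewrite -[ex n]mulr1; apply: L2T_exM; exact: (L2T_cst 1). Qed.

Let int_derive (F f : R -> R) : (forall t : R, is_derive t (1 : R) F (f t)) ->
  continuous f -> Rintegral mu D f = F (pi *+ 2) - F 0.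
Proof.
move=> dF cf.
have cF : continuous F.
  by move=> t; apply/differentiable_continuous/derivable1_diffP; case: (dF t).
rewrite /Rintegral (@continuous_FTC2 _ _ F) //.
- exact: twopi_gt0.
- by apply: continuous_subspaceT.
- by split; [|exact/cvg_at_right_filter/cF|exact/cvg_at_left_filter/cF].
- by move=> t _; rewrite derive1E; apply: derive_val.
Qed.

Let derive_lin (c t : R) : is_derive t (1 : R) (fun t : R => c * t) c.
Proof.
have : is_derive t (1 : R) (c \*: (@idfun R)) (c *: 1) by exact: is_deriveZ.
by rewrite /GRing.scale /= mulr1.
Qed.

Let int_cos n : n != 0 -> Rintegral mu D (fun t => cos (n%:~R * t)) = 0.
Proof.
move=> n0; have nR0 : n%:~R != 0 :> R by rewrite intr_eq0.
have dF (t : R) : is_derive t (1 : R) (fun t : R => (n%:~R)^-1 * sin (n%:~R * t)) (cos (n%:~R * t)).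
  have H := is_derive1_comp (is_derive_sin (n%:~R * t)) (derive_lin n%:~R t).
  have := is_deriveZ (n%:~R)^-1 H.
  rewrite (_ : (n%:~R)^-1 *: _ = cos (n%:~R * t)) //.
  by rewrite -[LHS]/((n%:~R)^-1 * _); field.
have cf : continuous (fun t : R => cos (n%:~R * t)).
  move=> t; apply: continuous_comp; last exact: continuous_cos.
  exact: mulrl_continuous.
rewrite (int_derive dF cf).
have /(congr1 (@complex.Im R)) := ex_twopi n.
  by rewrite /ex [LHS]/= [RHS]/= => ->; rewrite mulr0 mulr0 sin0 mulr0 subr0.
Qed.

Let int_sin n : n != 0 -> Rintegral mu D (fun t => sin (n%:~R * t)) = 0.
Proof.
move=> n0; have nR0 : n%:~R != 0 :> R by rewrite intr_eq0.
have dF (t : R) : is_derive t (1 : R) (fun t : R => - (n%:~R)^-1 * cos (n%:~R * t)) (sin (n%:~R * t)).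
  have H := is_derive1_comp (is_derive_cos (n%:~R * t)) (derive_lin n%:~R t).
  have := is_deriveZ (- (n%:~R)^-1) H.
  rewrite (_ : (- (n%:~R)^-1) *: _ = sin (n%:~R * t)) //.
  by rewrite -[LHS]/((- (n%:~R)^-1) * _); field.
have cf : continuous (fun t : R => sin (n%:~R * t)).
  move=> t; apply: continuous_comp; last exact: continuous_sin.
  exact: mulrl_continuous.
rewrite (int_derive dF cf).
have /(congr1 (@complex.Re R)) := ex_twopi n.
  by rewrite /ex [LHS]/= [RHS]/= => ->; rewrite mulr0 cos0 subrr.
Qed.

Lemma circle_mean_cst (a : R[i]) : circle_mean (cst a : R -> R[i]) = a.
Proof.
have -> : (cst a : R -> R[i]) = cst a * 1 by apply/funext => t /=; rewrite mulr1.
rewrite circle_meanZ; last exact: L2T_cint (L2T_cst 1).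
rewrite /circle_mean -[RHS]mulr1; congr (_ * _).
have muD : fine (mu D) = pi *+ 2.
  by rewrite /= lebesgue_measure_itv /= lte_fin twopi_gt0 /= subr0.
have -> : cintegral D (1 : R -> R[i]) = (pi *+ 2)%:C%C.
  apply: complexP => /=.
  - by rewrite -[LHS]/(Rintegral mu D (fun=> 1)) Rintegral_cst // muD mul1r.
  - by rewrite -[LHS]/(Rintegral mu D (fun=> 0)) Rintegral_cst // mul0r.
apply: complexP; rewrite ?ReM ?ImM /= ?mulr0 ?mul0r ?addr0 ?subr0 //.
by rewrite mulVf // gt_eqF // twopi_gt0.
Qed.

Lemma circle_mean_ex n : circle_mean (ex n : R -> R[i]) = (n == 0)%:R.
Proof.
have [->|n0] := eqVneq n 0; first by rewrite ex0 circle_mean_cst.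
rewrite /circle_mean (_ : cintegral _ _ = 0) ?mulr0 //.
by apply: complexP => /=; rewrite /ex /= ?int_cos ?int_sin.
Qed.

Lemma fourierE f n : fourier f n = inner f (ex n).
Proof.
rewrite innerE exJ /fourier; congr circle_mean; apply/funext => t.
by rewrite -[RHS]/(f t * cis _) intrN mulNr.
Qed.

Lemma fourier_ex m n : fourier (ex m : R -> R[i]) n = (m == n)%:R.
Proof. by rewrite fourierE innerE exJ -exD circle_mean_ex subr_eq0. Qed.

Lemma fourierD f g n : L2T f -> L2T g ->
  fourier (f + g) n = fourier f n + fourier g n.
Proof. by move=> ? ?; rewrite !fourierE innerDl //; exact: L2T_ex. Qed.

Lemma fourierZ (a : R[i]) f n : L2T f -> fourier (cst a * f) n = a * fourier f n.
Proof. by move=> ?; rewrite !fourierE innerZl //; exact: L2T_ex. Qed.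

Lemma fourierB f g n : L2T f -> L2T g ->
  fourier (f - g) n = fourier f n - fourier g n.
Proof. by move=> ? ?; rewrite !fourierE innerBl //; exact: L2T_ex. Qed.

Lemma fourier_conj f n : L2T f -> fourier (fconj f) n = (fourier f (- n))^*.
Proof.
move=> If; rewrite !fourierE -innerJ //; last exact: L2T_ex.
by rewrite !innerE exJ mulrC.
Qed.

Lemma fourier_exM m f n : fourier (ex m * f) n = fourier f (n - m).
Proof.
rewrite !fourierE !innerE !exJ opprB addrC exD; congr circle_mean.
by rewrite mulrAC -mulrA mulrCA mulrA mulrC.
Qed.

Definition tpoly (s : seq int) (x : int -> R[i]) : R -> R[i] :=
  \sum_(k <- s) cst (x k) * ex k.

Lemma L2T_tpoly s x : L2T (tpoly s x).
Proof. by apply: L2T_sum => k; apply: L2TZ; exact: L2T_ex. Qed.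

Lemma inner_tpolyr s x g : L2T g ->
  inner g (tpoly s x) = \sum_(k <- s) (x k)^* * fourier g k.
Proof.
move=> ig; rewrite inner_sumr //; last by move=> k; apply: L2TZ; exact: L2T_ex.
by apply: eq_bigr => k _; rewrite innerZr ?fourierE //; exact: L2T_ex.
Qed.

Lemma fourier_tpoly s x n : uniq s ->
  fourier (tpoly s x) n = if n \in s then x n else 0.
Proof.
move=> us; rewrite fourierE inner_suml; last 2 first.
- by move=> k; apply: L2TZ; exact: L2T_ex.
- exact: L2T_ex.
under eq_bigr => k _.
  rewrite innerZl -?fourierE ?fourier_ex; try exact: L2T_ex.
  rewrite mulr_natr; over.
case: ifPn => ns.
- rewrite (bigD1_seq n) //= eqxx mulr1n big1 ?addr0 // => k /negPf ->.
  by rewrite mulr0n.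
- rewrite big_seq big1 // => k ks; case: eqP => [kn|]; rewrite ?mulr0n //.
  by rewrite -kn ks in ns.
Qed.

Lemma L2norm_tpoly s x : uniq s ->
  L2norm (tpoly s x) ^+ 2 = \sum_(k <- s) cmod (x k) ^+ 2.
Proof.
move=> us; have := inner_norm (tpoly s x).
rewrite inner_tpolyr; last exact: L2T_tpoly.
move=> /(congr1 (@complex.Re R)); rewrite [RHS]/= => <-.
rewrite Re_sum [in RHS]big_seq big_seq; apply: eq_bigr => k ks.
by rewrite fourier_tpoly // ks mulrC mulJE.
Qed.

(** Subtracting a partial Fourier sum is orthogonal projection, so it lowers
    the squared norm by exactly the coefficients that were removed. *)
Lemma bessel_id s g : uniq s -> L2T g ->
  L2norm (g - tpoly s (fourier g)) ^+ 2 =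
  L2norm g ^+ 2 - \sum_(k <- s) cmod (fourier g k) ^+ 2.
Proof.
move=> us ig; have it := L2T_tpoly s (fourier g).
rewrite L2normDsq //; last exact: L2TN.
rewrite L2normN L2norm_tpoly // innerNr // inner_tpolyr // ReN Re_sum.
have -> : \sum_(k <- s) cRe ((fourier g k)^* * fourier g k) =
          \sum_(k <- s) cmod (fourier g k) ^+ 2.
  by apply: eq_bigr => k _; rewrite mulrC mulJE.
by rewrite mulr2n; ring.
Qed.

Lemma bessel s g : uniq s -> L2T g ->
  \sum_(k <- s) cmod (fourier g k) ^+ 2 <= L2norm g ^+ 2.
Proof. by move=> us ig; rewrite -subr_ge0 -bessel_id // sqr_ge0. Qed.

End Exponentials.

(** * Fourier coefficients determine the function *)

Section AlmostEverywhere.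
Context {R : realType}.
Local Notation mu := (@lebesgue_measure R).

Lemma ae_imply (P Q : R -> Prop) : (forall t, P t -> Q t) ->
  {ae mu, forall t, P t} -> {ae mu, forall t, Q t}.
Proof.
by move=> H; apply: filterS; [exact: (ae_filter_ringOfSetsType mu)|exact: H].
Qed.

Lemma ae_imply2 (P Q S : R -> Prop) : (forall t, P t -> Q t -> S t) ->
  {ae mu, forall t, P t} -> {ae mu, forall t, Q t} -> {ae mu, forall t, S t}.
Proof.
by move=> H; apply: filterS2; [exact: (ae_filter_ringOfSetsType mu)|exact: H].
Qed.

Lemma ae_neq (b : R) : {ae mu, forall t : R, t != b}.
Proof.
exists [set b]; split; first exact: measurable_set1.
- exact: lebesgue_measure_set1.
- by move=> t /=; apply: contra_notP => /eqP.
Qed.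

End AlmostEverywhere.

Section Steep.
Context {R : realType}.
Implicit Types u x : R.

Let bernoulli_lower x N : 0 <= x <= 1 -> 1 - N%:R * x <= (1 - x) ^+ N.
Proof.
move=> /andP[x0 x1]; elim: N => [|N IH]; first by rewrite mul0r subr0 expr0.
rewrite exprS; have : 0 <= 1 - x by lra.
move=> /ler_wpM2l/(_ _ _ IH); apply: le_trans.
rewrite -natr1; have : 0 <= N%:R * x ^+ 2 by rewrite mulr_ge0 ?sqr_ge0.
by rewrite expr2; nra.
Qed.

Let bernoulli_upper x N : 0 <= x <= 1 -> (1 - x) ^+ N * (1 + N%:R * x) <= 1.
Proof.
move=> /andP[x0 x1]; elim: N => [|N IH]; first by rewrite expr0 mul0r addr0 mul1r.
apply: le_trans IH; rewrite exprSr -mulrA ler_wpM2l ?exprn_ge0 ?subr_ge0 //.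
rewrite -natr1; have : 0 <= (N%:R + 1) * x ^+ 2 by rewrite mulr_ge0 ?sqr_ge0 ?addr_ge0.
by rewrite expr2; nra.
Qed.

(** The polynomials of the Brosowski-Deutsch proof of the Stone-Weierstrass
    theorem.  Bernoulli's inequality bounds them below by [1 - (2 u) ^ n] and
    above by [(2 u) ^ - n], so on the unit interval they converge to the
    indicator of the points below one half. *)
Definition steep n u : R := (1 - u ^+ n) ^+ (2 ^ n).

Lemma steep_itv n u : 0 <= u <= 1 -> 0 <= steep n u <= 1.
Proof.
move=> /andP[u0 u1].
have un0 : 0 <= u ^+ n by rewrite exprn_ge0.
have un1 : u ^+ n <= 1 by rewrite exprn_ile1.
rewrite /steep exprn_ge0 ?subr_ge0 // exprn_ile1 ?subr_ge0 //; lra.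
Qed.

Let un_itv u n : 0 <= u <= 1 -> 0 <= u ^+ n <= 1.
Proof. by move=> /andP[u0 u1]; rewrite exprn_ge0 // exprn_ile1. Qed.

Lemma steep_cvg1 u : 0 <= u < 2^-1 -> (fun n => steep n u) @ \oo --> (1 : R).
Proof.
move=> /andP[u0 u1].
have uI : 0 <= u <= 1 by rewrite u0 /=; lra.
apply: (@squeeze_cvgr _ _ _ _ (fun n => 1 - (2 * u) ^+ n) (fun=> 1)).
- apply: nearW => n; have [_ ->] := andP (steep_itv n uI); rewrite andbT.
  by rewrite exprMn -natrX; apply: bernoulli_lower; exact: un_itv.
- rewrite -[X in _ --> X]subr0; apply: cvgB; first exact: cvg_cst.
  by apply: cvg_expr; rewrite ger0_norm; lra.
- exact: cvg_cst.
Qed.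

Lemma steep_cvg0 u : 2^-1 < u <= 1 -> (fun n => steep n u) @ \oo --> (0 : R).
Proof.
move=> /andP[u0 u1].
have uI : 0 <= u <= 1 by rewrite u1 andbT; lra.
have u2 : 0 < 2 * u by lra.
apply: (@squeeze_cvgr _ _ _ _ (fun=> 0) (fun n => (2 * u)^-1 ^+ n)).
- apply: nearW => n; have [-> _] := andP (steep_itv n uI); rewrite /=.
  rewrite exprVn -[X in _ <= X]mul1r ler_pdivlMr ?exprn_gt0 //.
  apply: le_trans (bernoulli_upper (2 ^ n) (un_itv n uI)).
  rewrite /steep ler_wpM2l //; first by case/andP: (steep_itv n uI).
  by rewrite exprMn natrX lerDr.
- exact: cvg_cst.
- apply: cvg_expr; rewrite ger0_norm ?invr_ge0 ?(ltW u2) // invf_lt1 //; lra.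
Qed.

End Steep.

Section Uniqueness.
Context {R : realType}.
Implicit Types (f g h : R -> R[i]).

Local Notation mu := (@lebesgue_measure R).
Local Notation D := (`[0, pi *+ 2]%classic : set R).

Let mD : measurable D. Proof. exact: measurable_itv. Qed.

Let ae_lt2pi : {ae mu, forall t : R, D t -> 0 < t < pi *+ 2}.
Proof.
apply: ae_imply2 (ae_neq 0) (ae_neq (pi *+ 2)) => t t0 t2.
by rewrite /= in_itv /= !lt_neqAle t2 eq_sym t0.
Qed.

(** By Lebesgue's differentiation theorem an integrable function is almost
    everywhere the derivative of its primitive. *)
Lemma ae_zero_of_primitive (u : R -> R) : mu.-integrable D (EFin \o u) ->
  (forall b, 0 < b < pi *+ 2 -> Rintegral mu `[0, b] u = 0) ->
  {ae mu, forall t, D t -> u t = 0}.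
Proof.
move=> iu H; pose v := u \_ D.
have iv : mu.-integrable setT (EFin \o v).
  by have := iffLR (@integrable_mkcond _ _ R mu D (EFin \o u) mD) iu; rewrite restrict_EFin.
have ivy y : mu.-integrable `[0, y] (EFin \o v).
  by apply: integrableS iv => //; exact: measurable_itv.
have := @FTC1 R v (BLeft 0) ivy (integrable_locally mD iu).
have := ae_lt2pi; apply: ae_imply2 => t t2pi dF Dt.
have {t2pi}/andP[t0 t2] := t2pi Dt.
have [|_] := dF _; first by rewrite /= lte_fin.
rewrite /v patchE mem_set // => <-.
rewrite derive1E -[RHS](derive_cst (0 : R) t (1 : R)).
apply: near_eq_derive.
have : \forall x \near t, x \in `]0, pi *+ 2[ by apply: near_in_itvoo; rewrite in_itv /= t0.
apply: filterS => x; rewrite in_itv /= => x02.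
transitivity (Rintegral mu `[0, x] u); last exact: H.
apply: eq_Rintegral => y; rewrite inE /= in_itv /= => /andP[y0 yx].
rewrite patchE mem_set //= in_itv /= y0 (le_trans yx) // ltW //.
by case/andP: x02.
Qed.

(** Polynomials in trigonometric polynomials are handled through the
    multipliers that preserve the vanishing of all Fourier coefficients: these
    are visibly closed under sums and products, so nothing is expanded. *)
Let null_coef g := (forall n, cint (g * ex n)) /\
  forall n, circle_mean (g * ex n) = 0.
Let multiplier h := forall g, null_coef g -> null_coef (g * h).

Let multiplierM h k : multiplier h -> multiplier k -> multiplier (h * k).
Proof. by move=> Hh Hk g /Hh/Hk; rewrite mulrA. Qed.

Let multiplierD h k : multiplier h -> multiplier k -> multiplier (h + k).
Proof.
move=> Hh Hk g vg; have [i1 z1] := Hh g vg; have [i2 z2] := Hk g vg.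
split=> n; rewrite mulrDr mulrDl; first exact: cintD.
by rewrite circle_meanD // z1 z2 addr0.
Qed.

Let multiplier_cst (a : R[i]) : multiplier (cst a).
Proof.
move=> g [i z]; split=> n; rewrite (mulrC g) -mulrA; first exact: cintZ.
by rewrite circle_meanZ // z mulr0.
Qed.

Let multiplier_ex n : multiplier (ex n).
Proof. by move=> g [i z]; split=> k; rewrite -mulrA -exD. Qed.

Let multiplierX h n : multiplier h -> multiplier (h ^+ n).
Proof.
move=> Hh; elim: n => [|n IH]; first by rewrite expr0; exact: (multiplier_cst 1).
by rewrite exprS; exact: multiplierM.
Qed.

(** A trigonometric polynomial in [t] that is below one half for [t < b] and
    above it for [t > b]: when [b] and [t] lie strictly between 0 and [2 pi], the
    first sine is positive and the second has the sign of [b - t]. *)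
Let arc (b t : R) : R := 2^-1 - 2^-1 * (sin (t / 2) * sin ((b - t) / 2)).

Let arcE b t : (arc b t)%:C%C =
  (cst (2^-1 + 4^-1 * cos (b / 2))%:C%C + cst ((- 8^-1)%:C%C * cis (- (b / 2))) * ex 1
   + cst ((- 8^-1)%:C%C * cis (b / 2)) * ex (- 1)) t.
Proof.
have -> : arc b t = 2^-1 + 4^-1 * cos (b / 2) - 4^-1 * cos (t - b / 2).
  rewrite /arc {3}[t]splitr mulrBl.
  move: (t / 2) (b / 2) => x y; rewrite sinB cosB cosD sinD.
  have := cos2Dsin2 x; move: (cos x) (sin x) (cos y) (sin y) => c s c' s' H.
  have e : c' = c' * (c ^+ 2 + s ^+ 2) by rewrite H mulr1.
  by rewrite [X in _ = _ + _ * X - _]e; field.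
rewrite -[RHS]/((2^-1 + 4^-1 * cos (b / 2))%:C%C + (- 8^-1)%:C%C * cis (- (b / 2)) *
  cis (1 * t) + (- 8^-1)%:C%C * cis (b / 2) * cis (- 1 * t)).
rewrite -!mulrA -!cisD mul1r mulN1r addrC -addrA.
rewrite [- (b / 2) + t]addrC -[b / 2 - t]opprB.
by apply: complexP; rewrite !(ReD, ImD, ReM, ImM) /= cosN sinN; lra.
Qed.

Let multiplier_steep b n : multiplier (fun t => (steep n (arc b t))%:C%C).
Proof.
pose u : R -> R[i] := (cst (2^-1 + 4^-1 * cos (b / 2))%:C%C
   + cst ((- 8^-1)%:C%C * cis (- (b / 2))) * ex 1
   + cst ((- 8^-1)%:C%C * cis (b / 2)) * ex (- 1)).
have mu' : multiplier u.
  by apply: multiplierD; [apply: multiplierD|]; try apply: multiplierM;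
    solve [exact: multiplier_cst | exact: multiplier_ex].
have powE (h : R -> R[i]) m t : (h ^+ m) t = h t ^+ m.
  by elim: m => [|m IH]; rewrite ?expr0 // !exprS -IH.
rewrite (_ : (fun _ => _) = (1 + cst (- 1) * u ^+ n) ^+ (2 ^ n)); last first.
  apply/funext => t; rewrite powE -[(1 + _) t]/(1 + (- 1) * (u ^+ n) t) powE.
  rewrite -(arcE b t : _ = u t).
  by rewrite /steep rmorphXn rmorphB rmorphXn rmorph1 mulN1r.
apply: multiplierX; apply: multiplierD; first exact: (multiplier_cst 1).
by apply: multiplierM; [exact: multiplier_cst|exact: multiplierX].
Qed.

Let arc_itv b t : 0 <= arc b t <= 1.
Proof.
have H x y : `|x| <= 1 -> `|y| <= 1 -> `|x * y| <= 1 :> R.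
  by move=> ? ?; rewrite normrM mulr_ile1.
have := H _ _ (sin_max (t / 2)) (sin_max ((b - t) / 2)).
by rewrite ler_norml /arc; lra.
Qed.

Let arc_cvg (b t : R) : 0 < b < pi *+ 2 -> 0 < t < pi *+ 2 -> t != b ->
  (fun n => steep n (arc b t)) @ \oo --> ((t < b)%R%:R : R).
Proof.
move=> /andP[b0 b2] /andP[t0 t2] tb.
have st : 0 < sin (t / 2) by apply: sin_gt0_pi; rewrite divr_gt0 //=; lra.
have [arc0 arc1] := andP (arc_itv b t).
have [tltb|blet] := ltP t b.
- apply: steep_cvg1; rewrite arc0 /= /arc.
  have : 0 < sin ((b - t) / 2) by apply: sin_gt0_pi; apply/andP; split; lra.
  by move/(mulr_gt0 st); lra.
- have {}tb : b < t by rewrite lt_neqAle eq_sym tb.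
  apply: steep_cvg0; rewrite arc1 andbT /arc.
  have : 0 < sin ((t - b) / 2) by apply: sin_gt0_pi; apply/andP; split; lra.
  rewrite -[t - b]opprB mulNr sinN oppr_gt0 => sb.
  by have := mulr_gt0 st (_ : 0 < - sin ((b - t) / 2)); rewrite oppr_gt0 => /(_ sb); lra.
Qed.

Let measurable_steep b n : measurable_fun setT (fun t => steep n (arc b t)).
Proof.
have [m _] : cmeas (cst (2^-1 + 4^-1 * cos (b / 2))%:C%C
   + cst ((- 8^-1)%:C%C * cis (- (b / 2))) * ex 1
   + cst ((- 8^-1)%:C%C * cis (b / 2)) * ex (- 1)).
  by apply: cmeasD; [apply: cmeasD|]; try apply: cmeasM;
    solve [exact: cmeas_cst | exact: cmeas_ex].
have {}m : measurable_fun setT (arc b).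
  move: m; rewrite (_ : (fun t => _) = arc b) //.
  by apply/funext => t; rewrite -arcE.
rewrite /steep; apply: measurable_funX; apply: measurable_funB => //.
exact: measurable_funX.
Qed.

Let primitive_zero (w : R -> R) b : 0 < b < pi *+ 2 ->
  measurable_fun setT w -> mu.-integrable D (EFin \o w) ->
  (forall n, Rintegral mu D (fun t => w t * steep n (arc b t)) = 0) ->
  Rintegral mu `[0, b] w = 0.
Proof.
move=> b02 mw iw H.
have mb : measurable_fun setT (fun t : R => (t < b)%R%:R : R).
  rewrite (_ : (fun t => _) = \1_(`]-oo, b[%classic)); last first.
    by apply/funext => t; rewrite indicE mem_setE in_itv.
  exact: measurable_indic.
have [||||| iwb _ lim] := @dominated_convergence _ _ R mu D mD
  (fun n t => (w t * steep n (arc b t))%:E) (fun t => (w t * (t < b)%R%:R)%:E)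
  (fun t => (`|w t|)%:E).
- by move=> n; apply/measurable_EFinP; apply: measurable_funTS; apply: measurable_funM;
    [exact: mw|exact: measurable_steep].
- by apply/measurable_EFinP; apply: measurable_funTS; apply: measurable_funM;
    [exact: mw|exact: mb].
- apply: ae_imply2 (ae_neq b) ae_lt2pi => t tb t2 /t2 {}t2.
  apply: cvg_EFin; first by apply: nearW.
  by apply: cvgM; [exact: cvg_cst|exact: arc_cvg].
- exact: integrable_norm.
- apply: aeW => t n _; rewrite lee_fin normrM ler_piMr //.
  have [s0 s1] := andP (steep_itv n (arc_itv b t)).
  by rewrite ger0_norm.
have eqb : Rintegral mu D (fun t => w t * (t < b)%R%:R) = Rintegral mu `[0, b] w.
  rewrite -[RHS]Rintegral_itv_bndo_bndc; last first.
    apply: integrableS iw => // t /=.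
    rewrite !in_itv /= => /andP[-> tb]; by rewrite (le_trans (ltW tb)) // ltW //; case/andP: b02.
  rewrite (_ : `[0, b[%classic = D `&` `]-oo, b[%classic) ?Rintegral_mkcondr.
    apply: eq_Rintegral => t _; rewrite patchE mem_setE in_itv /=.
    by case: ifP => _; rewrite ?mulr1 ?mulr0.
  apply/seteqP; split=> t /=; rewrite !in_itv /=; last by move=> [/andP[-> _] ->].
  by move=> /andP[-> tb]; rewrite tb (le_trans (ltW tb)) // ltW //; case/andP: b02.
rewrite -eqb /Rintegral; move: lim.
rewrite (_ : [sequence _]_n = cst 0%E); last first.
  apply/funext => n /=; rewrite -[LHS]fineK; first by rewrite -[fine _]/(Rintegral _ _ _) H.
  apply: integrable_fin_num => //.
  apply: le_integrable iw => //.
  - by apply/measurable_EFinP; apply: measurable_funTS; apply: measurable_funM;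
      [exact: mw|exact: measurable_steep].
  - move=> t _ /=; rewrite lee_fin normrM ler_piMr //.
    have [s0 s1] := andP (steep_itv n (arc_itv b t)).
    by rewrite ger0_norm.
by move=> /(cvg_lim _) <- //; rewrite lim_cst.
Qed.

(** Each primitive [b |-> int_0^b g] vanishes, because the indicator of [0, b]
    is a bounded pointwise limit of trigonometric polynomials. *)
Lemma fourier_inj g : L2T g -> (forall n, fourier g n = 0) ->
  {ae mu, forall t, D t -> g t = 0}.
Proof.
move=> ig g0.
have vg : null_coef g.
  split=> n; first by apply: L2T_cintM => //; exact: L2T_ex.
  by have := g0 (- n); rewrite fourierE innerE exJ opprK.
have [iR iI] := L2T_cint ig; have [mR mI] := L2T_cmeas ig.
have H b n : cintegral D (fun t => g t * (steep n (arc b t))%:C%C) = 0.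
  have [_ /(_ 0)] := multiplier_steep b n vg.
  rewrite ex0 mulr1 /circle_mean => /eqP; rewrite mulf_eq0 => /orP[|/eqP //].
  move=> /eqP/(congr1 (@complex.Re R))/eqP; rewrite /= invr_eq0.
  by rewrite gt_eqF // twopi_gt0.
have zR : {ae mu, forall t, D t -> cRe (g t) = 0}.
  apply: ae_zero_of_primitive; first exact: iR.
  move=> b b02; apply: primitive_zero b02 mR _ _; [exact: iR|move=> n].
  apply: (etrans _ (congr1 (@complex.Re R) (H b n))).
  by apply: eq_Rintegral => t _; rewrite ReM /= mulr0 subr0.
have zI : {ae mu, forall t, D t -> cIm (g t) = 0}.
  apply: ae_zero_of_primitive; first exact: iI.
  move=> b b02; apply: primitive_zero b02 mI _ _; [exact: iI|move=> n].
  apply: (etrans _ (congr1 (@complex.Im R) (H b n))).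
  by apply: eq_Rintegral => t _; rewrite ImM /= mulr0 add0r.
apply: ae_imply2 zR zI => t zR zI Dt.
by apply: complexP; rewrite ?zR ?zI.
Qed.

Lemma L2norm_eq0_ae g : L2T g -> {ae mu, forall t, D t -> g t = 0} -> L2norm g = 0.
Proof.
move=> ig g0; apply/eqP; rewrite -sqrf_eq0 L2normE; apply/eqP.
rewrite [X in _ * X](_ : _ = 0) ?mulr0 // /Rintegral.
have mg := cmeas_sqmod (L2T_cmeas ig).
rewrite (@ae_eq_integral _ _ _ mu D (cst 0%E)) ?integral0 //.
- by apply/measurable_EFinP/measurable_funTS.
- by apply: ae_imply g0 => t H Dt; rewrite H // cmod0 expr0n.
Qed.

Lemma fourier_inj_norm g : L2T g -> (forall n, fourier g n = 0) -> L2norm g = 0.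
Proof. by move=> ig g0; apply: L2norm_eq0_ae => //; exact: fourier_inj. Qed.

End Uniqueness.

(** * Completeness: the Riesz-Fischer and Parseval theorems *)

Section Completeness.
Context {R : realType}.
Implicit Types (f g h : R -> R[i]).

Local Notation mu := (@lebesgue_measure R).
Local Notation D := (`[0, pi *+ 2]%classic : set R).

Let mD : measurable D. Proof. exact: measurable_itv. Qed.

Let esq h := (\int[mu]_(t in D) (cmod (h t) ^+ 2)%:E)%E.

Let mesq h : cmeas h -> measurable_fun D (fun t => (cmod (h t) ^+ 2)%:E).
Proof.
by move=> mh; apply/measurable_EFinP; apply: measurable_funTS; exact: cmeas_sqmod.
Qed.

Let esqE h : L2T h -> esq h = (pi *+ 2 * L2norm h ^+ 2)%:E.
Proof.
move=> ih; rewrite L2normE mulVKf ?gt_eqF ?twopi_gt0 //.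
by rewrite /Rintegral fineK //; apply: integrable_fin_num => //; exact: L2T_int.
Qed.

Let L2T_esq h : periodic h -> cmeas h -> (esq h < +oo)%E -> L2T h.
Proof.
move=> ph mh hoo; apply/L2TP; split => //; apply/integrableP; split; first exact: mesq.
apply: le_lt_trans hoo; rewrite le_eqVlt; apply/orP; left; apply/eqP.
by apply: eq_integral => t _ /=; rewrite ger0_norm // sqr_ge0.
Qed.

Let cvg_of_steps (u : nat -> R) (M : R) : 0 <= M ->
  (forall i, `|u i.+1 - u i| <= M / 2 ^+ i) -> cvgn u.
Proof.
move=> M0 uM.
have cs : cvgn (series (telescope u)).
  apply: normed_cvg; apply: (@series_le_cvg _ _ (geometric M 2^-1)).
  - by move=> n /=; exact: normr_ge0.
  - by move=> n /=; rewrite mulr_ge0 // exprn_ge0 // invr_ge0.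
  - by move=> n /=; rewrite exprVn; exact: uM.
  - by apply: is_cvg_geometric_series; rewrite ger0_norm ?invr_ge0 // invf_lt1 // ltr1n.
rewrite (_ : u = cst (u 0%N) + series (telescope u)).
  by apply: is_cvgD => //; exact: is_cvg_cst.
by apply/funext => n; rewrite [LHS]eq_sum_telescope.
Qed.

(** Along a rapidly Cauchy sequence the increments are summable almost
    everywhere, so the sequence converges almost everywhere; Fatou's lemma then
    turns the pointwise limit into a limit in norm. *)
Lemma L2_complete (G : nat -> R -> R[i]) : (forall i, L2T (G i)) ->
  (forall i j, (i <= j)%N -> L2norm (G j - G i) ^+ 2 <= (16 ^+ i)^-1) ->
  exists2 g, L2T g & forall i, L2norm (g - G i) ^+ 2 <= (16 ^+ i)^-1.
Proof.
move=> iG cG.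
(* The weight [4 ^ i] against the hypothesis [16 ^ - i] leaves a convergent
   series, and a finite sum [W t] bounds the increments by [2 ^ - i]. *)
pose w i t := 4 ^+ i * cmod ((G i.+1 - G i) t) ^+ 2.
have w0 i t : 0 <= w i t by rewrite mulr_ge0 ?sqr_ge0 ?exprn_ge0.
have mw i : measurable_fun setT (fun t => (w i t)%:E).
  apply/measurable_EFinP; apply: measurable_funM; first exact: measurable_cst.
  by apply: cmeas_sqmod; exact: L2T_cmeas (L2TB (iG _) (iG _)).
pose W t := (\sum_(0 <= i <oo) (w i t)%:E)%E.
have W0 t : (0 <= W t)%E by apply: nneseries_ge0 => i _ _; rewrite lee_fin.
have mW : measurable_fun setT W.
  by apply: (@ge0_emeasurable_sum _ _ _ _ _ xpredT) => // i t _ _; rewrite lee_fin.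
have iW : (\int[mu]_(t in D) W t < +oo)%E.
  rewrite integral_nneseries //; last 2 first.
  - by move=> i; apply: measurable_funTS; exact: mw.
  - by move=> i t _; rewrite lee_fin.
  apply: (@le_lt_trans _ _ (\sum_(0 <= i <oo) (pi *+ 2 * 2 / (2 ^ (i + 1))%:R)%:E)%E).
    apply: lee_nneseries => i _.
      by move=> _; apply: integral_ge0 => t _; rewrite lee_fin.
    have -> : (\int[mu]_(t in D) (w i t)%:E)%E = ((4 ^+ i)%:E * esq (G i.+1 - G i)%R)%E.
      rewrite -ge0_integralZl_EFin ?exprn_ge0 //.
      - by move=> t _; rewrite lee_fin sqr_ge0.
      - by apply: mesq; exact: L2T_cmeas (L2TB (iG _) (iG _)).
    rewrite esqE; last exact: L2TB.
    rewrite -EFinM lee_fin mulrCA -mulrA ler_wpM2l ?(ltW twopi_gt0) //.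
    apply: (@le_trans _ _ (4 ^+ i * (16 ^+ i)^-1)).
      by rewrite ler_wpM2l ?exprn_ge0 //; exact: cG.
    rewrite addn1 natrX exprS invfM mulrA divff // mul1r.
    have -> : 16 = 4 * 4 :> R by ring.
    rewrite exprMn invfM mulrA divff ?expf_neq0 // mul1r.
    by rewrite lef_pV2 ?posrE ?exprn_gt0 // lerXn2r ?nnegrE // ler_nat.
  by rewrite (cvg_lim _ (@cvg_geometric_eseries_half R (pi *+ 2 * 2) 0)) // ltry.
have Woo : {ae mu, forall t, D t -> (W t < +oo)%E}.
  have iWW : mu.-integrable D W.
    apply/integrableP; split; first by apply: measurable_funTS; exact: mW.
    apply: le_lt_trans iW; rewrite le_eqVlt; apply/orP; left; apply/eqP.
    by apply: eq_integral => t _; rewrite gee0_abs.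
  have := @integrable_ae _ _ R mu D mD W iWW; apply: ae_imply => t H /H.
  by rewrite ge0_fin_numE.
pose E := [set t | (W t < +oo)%E].
have mE : measurable E.
  by rewrite -[E]setTI; exact: emeasurable_fun_infty_o.
(* Replacing the sequence by zero on the null set where [W] is infinite makes
   it converge everywhere, so its limit is measurable; periodicity survives
   because [W] is periodic. *)
pose H i t : R[i] := if (W t < +oo)%E then G i t else 0.
have HE i t : E t -> H i t = G i t by rewrite /E /H /= => ->.
have indE t : \1_E t = (W t < +oo)%E%:R :> R.
  rewrite indicE; suff -> : (t \in E) = (W t < +oo)%E by [].
  by apply/idP/idP; rewrite inE.
have mH i : cmeas (H i).
  have [m1 m2] := L2T_cmeas (iG i); split.
  - rewrite (_ : (fun t => _) = (fun t => \1_E t * cRe (G i t))).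
      by apply: measurable_funM => //; exact: measurable_indic.
    by apply/funext => t; rewrite /H indE; case: ifP => _; rewrite ?mul1r ?mul0r.
  - rewrite (_ : (fun t => _) = (fun t => \1_E t * cIm (G i t))).
      by apply: measurable_funM => //; exact: measurable_indic.
    by apply/funext => t; rewrite /H indE; case: ifP => _; rewrite ?mul1r ?mul0r.
have step t i : cmod (H i.+1 t - H i t) <= Num.sqrt (fine (W t)) / 2 ^+ i.
  rewrite /H; case: ifPn => Wt; last first.
    by rewrite subrr cmod0 mulr_ge0 ?sqrtr_ge0 ?invr_ge0 ?exprn_ge0.
  rewrite -(@ler_pXn2r _ 2) ?nnegrE ?cmod_ge0 ?mulr_ge0 ?sqrtr_ge0 ?invr_ge0 ?exprn_ge0 //.
  rewrite exprMn sqr_sqrtr; last by rewrite fine_ge0.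
  rewrite exprVn -exprM mulnC exprM -natrX ler_pdivlMr ?exprn_gt0 // mulrC.
  rewrite -lee_fin fineK; last by rewrite ge0_fin_numE.
  apply: (@le_trans _ _ (\sum_(0 <= k < i.+1) (w k t)%:E)%E); last first.
    by apply: nneseries_lim_ge => k _ _; rewrite lee_fin.
  rewrite big_nat_recr //= leeDr // sume_ge0 // => k _.
  by rewrite lee_fin.
pose g t : R[i] := (limn (fun i => cRe (H i t)) +i* limn (fun i => cIm (H i t)))%C.
have cR t : (fun i => cRe (H i t)) @ \oo --> cRe (g t).
  apply: (@cvg_of_steps _ (Num.sqrt (fine (W t)))); first exact: sqrtr_ge0.
  by move=> i; apply: le_trans (step t i); rewrite -ReN -ReD; exact: Re_le_cmod.
have cI t : (fun i => cIm (H i t)) @ \oo --> cIm (g t).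
  apply: (@cvg_of_steps _ (Num.sqrt (fine (W t)))); first exact: sqrtr_ge0.
  by move=> i; apply: le_trans (step t i); rewrite -ImN -ImD; exact: Im_le_cmod.
have mg : cmeas g.
  split; [apply: (@measurable_fun_cvg _ _ _ _ (fun i t => cRe (H i t))) |
          apply: (@measurable_fun_cvg _ _ _ _ (fun i t => cIm (H i t)))].
  - by move=> i; case: (mH i).
  - by move=> t _; exact: cR.
  - by move=> i; case: (mH i).
  - by move=> t _; exact: cI.
have pg : periodic g.
  move=> t; have pG i : G i (t + pi *+ 2) = G i t by exact: (L2T_periodic (iG i)).
  have pW : W (t + pi *+ 2) = W t.
    rewrite /W; apply: eq_eseriesr => i _; rewrite /w.
    by rewrite !fctE !pG.
  have pH : (fun i => H i (t + pi *+ 2)) = (fun i => H i t).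
    by apply/funext => i; rewrite /H pG pW.
  rewrite /g; congr (limn _ +i* limn _)%C; apply/funext => i;
    by move/(congr1 (fun F : nat -> R[i] => F i)) : pH => /= ->.
have key i : (esq (g - G i)%R <= (pi *+ 2 * (16 ^+ i)^-1)%:E)%E.
  have -> : esq (g - G i) = esq (g - H i).
    apply: ae_eq_integral => //.
    - by apply: mesq; apply: cmeasD => //; exact: L2T_cmeas (L2TN (iG _)).
    - apply: mesq; apply: cmeasD => //.
      rewrite (_ : - H i = cst (-1) * H i); first by apply: cmeasM; [exact: cmeas_cst|].
      by apply/funext => t /=; rewrite mulN1r.
    - apply: ae_imply Woo => t Et /Et {}Et.
      by rewrite !fctE HE.
  have mHH j : cmeas (H j - H i).
    apply: cmeasD => //.
    rewrite (_ : - H i = cst (-1) * H i); first by apply: cmeasM; [exact: cmeas_cst|].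
    by apply/funext => t /=; rewrite mulN1r.
  have lim t : (cmod ((g - H i) t) ^+ 2)%:E =
      limn_einf (fun j => (cmod ((H j - H i) t) ^+ 2)%:E).
    suff /cvg_limn_einf_sup[-> _] : (fun j => (cmod ((H j - H i) t) ^+ 2)%:E) @ \oo -->
      (cmod ((g - H i) t) ^+ 2)%:E by [].
    apply: cvg_EFin; first exact: nearW.
    rewrite (_ : fine \o _ = fun j => (cRe (H j t) - cRe (H i t)) ^+ 2 +
      (cIm (H j t) - cIm (H i t)) ^+ 2); last first.
      apply/funext => j /=; rewrite cmodE !fctE.
      by rewrite !(ReD, ImD, ReN, ImN).
    rewrite cmodE !fctE !(ReD, ImD, ReN, ImN).
    by apply: cvgD; rewrite expr2; apply: cvgM; apply: cvgB => //; exact: cvg_cst.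
  rewrite /esq; under eq_integral do rewrite lim.
  have := @fatou _ _ R mu D mD (fun j t => (cmod ((H j - H i) t) ^+ 2)%:E)
    (fun j => mesq (mHH j)) (fun j t _ => sqr_ge0 _); move/le_trans; apply.
  rewrite limn_einf_lim; apply: lime_le; first exact: is_cvg_einfs.
  apply: nearW => n; apply: (@le_trans _ _ (esq (H (maxn n i) - H i))).
    by apply: ereal_inf_lbound; exists (maxn n i) => //=; rewrite leq_maxl.
  apply: (@le_trans _ _ (esq (G (maxn n i) - G i))); last first.
    rewrite esqE ?lee_fin; last exact: L2TB.
    by rewrite ler_pM2l ?twopi_gt0 //; apply: cG; rewrite leq_maxr.
  apply: ge0_le_integral => //.
  - by move=> t _; rewrite lee_fin sqr_ge0.
  - exact: mesq.
  - by apply: mesq; exact: L2T_cmeas (L2TB (iG _) (iG _)).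
  - move=> t _; rewrite lee_fin !fctE /H.
    by case: ifP => _ //; rewrite subrr cmod0 expr0n sqr_ge0.
have iB i : L2T (g - G i).
  apply: L2T_esq.
  - by move=> t; rewrite !fctE pg (L2T_periodic (iG i)).
  - by apply: cmeasD => //; exact: L2T_cmeas (L2TN (iG _)).
  - by apply: le_lt_trans (key i) _; rewrite ltry.
exists g.
  by rewrite -[g](subrK (G 0%N)); exact: L2TD.
move=> i; have := key i; rewrite esqE // lee_fin.
by rewrite ler_pM2l // twopi_gt0.
Qed.

End Completeness.

Section RieszFischer.
Context {R : realType}.
Implicit Types (f g h : R -> R[i]) (u : int -> R[i]) (N : nat).

Definition window N : seq int := [seq (k%:Z - N%:Z)%R | k <- iota 0 (N + N).+1].

Lemma window_uniq N : uniq (window N).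
Proof. by rewrite map_inj_uniq ?iota_uniq // => a b /addIr[]. Qed.

Lemma mem_window N (k : int) : (k \in window N) = (`|k|%N <= N)%N.
Proof.
apply/mapP/idP => [[j]|kN]; first by rewrite mem_iota => jN ->; lia.
by exists `|(k + N%:Z)%R|%N; rewrite ?mem_iota; lia.
Qed.

Lemma sum_subset (T : eqType) (s s' : seq T) (F : T -> R) : uniq s -> uniq s' ->
  {subset s <= s'} -> (forall k, 0 <= F k) ->
  \sum_(k <- s) F k <= \sum_(k <- s') F k.
Proof.
move=> us us' ss' F0; rewrite [leRHS](bigID (mem s)) /= -[X in _ <= X + _]big_filter.
have E : perm_eq [seq k <- s' | k \in s] s.
  apply: uniq_perm; rewrite ?filter_uniq // => k; rewrite mem_filter.
  by case: (boolP (k \in s)) => //= ks; rewrite ss'.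
by rewrite (perm_big _ E) lerDl; apply: sumr_ge0 => k _.
Qed.

Lemma L2norm_window u a b : (a <= b)%N ->
  L2norm (tpoly (window b) u - tpoly (window a) u) ^+ 2 =
  \sum_(k <- window b) cmod (u k) ^+ 2 - \sum_(k <- window a) cmod (u k) ^+ 2.
Proof.
move=> ab; have wb := window_uniq b; have wa := window_uniq a.
have fE k : k \in window a -> fourier (tpoly (window b) u) k = u k.
  by rewrite fourier_tpoly // !mem_window => ka; rewrite (leq_trans ka ab).
have := bessel_id wa (L2T_tpoly (window b) u).
rewrite L2norm_tpoly // (_ : tpoly (window a) (fourier _) = tpoly (window a) u).
  move=> ->; congr (_ - _); rewrite [LHS]big_seq [RHS]big_seq.
  by apply: eq_bigr => k ka; rewrite fE.
by rewrite /tpoly [LHS]big_seq [RHS]big_seq; apply: eq_bigr => k ka; rewrite fE.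
Qed.

Lemma geometric16_small (e : R) : 0 < e ->
  exists m, forall i, (m <= i)%N -> (16 ^+ i)^-1 <= e.
Proof.
move=> e0; exists (Num.bound e^-1) => i mi.
rewrite -[e]invrK lef_pV2 ?posrE ?invr_gt0 ?exprn_gt0 //.
apply: (@le_trans _ _ i%:R).
  by rewrite (le_trans (ltW (archi_boundP _))) ?invr_ge0 ?(ltW e0) // ler_nat.
by rewrite -natrX ler_nat ltnW // ltn_expl.
Qed.

Lemma L2norm_ex n : L2norm (ex n : R -> R[i]) = 1.
Proof.
have := inner_norm (ex n : R -> R[i]); rewrite -fourierE fourier_ex eqxx.
move=> /(congr1 (@complex.Re R)) /= H.
by apply/eqP; rewrite -(@eqrXn2 _ 2) ?L2norm_ge0 // -H expr1n.
Qed.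

Lemma cmod_fourier_le f n : L2T f -> cmod (fourier f n) <= L2norm f.
Proof.
move=> If; rewrite fourierE -[leRHS]mulr1 -(L2norm_ex n).
by apply: cauchy_schwarz => //; exact: L2T_ex.
Qed.

(** The squared distance of two partial sums is the sum of the squared
    coefficients in between, so square summability makes the partial sums
    Cauchy in the complete space of square-integrable functions. *)
Lemma riesz_fischer u (B : R) :
  (forall N, \sum_(k <- window N) cmod (u k) ^+ 2 <= B) ->
  exists g, [/\ L2T g, forall n, fourier g n = u n &
    forall e, 0 < e -> exists N, L2norm (g - tpoly (window N) u) ^+ 2 <= e].
Proof.
move=> uB; pose s N := \sum_(k <- window N) cmod (u k) ^+ 2.
have s_nd : nondecreasing_seq s.
  move=> a b ab; apply: sum_subset; rewrite ?window_uniq // => k.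
    by rewrite !mem_window => ka; exact: leq_trans ka ab.
  exact: sqr_ge0.
have s_cvg : cvgn s.
  by apply: nondecreasing_is_cvgn => //; exists B => _ [N _ <-]; exact: uB.
pose l := limn s.
have sl N : s N <= l by exact: nondecreasing_cvgn_le.
(* [i <= Ni i] ensures that every coefficient eventually enters the sums. *)
have /choice[Ni NiP] : forall i : nat, exists N : nat, (i <= N)%N /\ l - s N <= (16 ^+ i)^-1.
  move=> i; have /cvgrPdist_le : s @ \oo --> l by [].
  have e0 : 0 < (16 ^+ i)^-1 :> R by rewrite invr_gt0 exprn_gt0.
  move=> /(_ _ e0)[N _ HN]; exists (maxn i N); rewrite leq_maxl; split => //.
  by apply: le_trans (ler_norm _) _; apply: HN => /=; rewrite leq_maxr.
have norm16 i j : (i <= j)%N -> (16 ^+ j)^-1 <= (16 ^+ i)^-1 :> R.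
  by move=> ij; rewrite lef_pV2 ?posrE ?exprn_gt0 // ler_eXn2l // ltr1n.
have cauchy i j : (i <= j)%N ->
    L2norm (tpoly (window (Ni j)) u - tpoly (window (Ni i)) u) ^+ 2 <= (16 ^+ i)^-1.
  move=> ij; have [iNi li] := NiP i; have [jNj lj] := NiP j.
  have [ab|/ltnW ba] := leqP (Ni i) (Ni j).
    by rewrite L2norm_window //; apply: le_trans li; rewrite lerB // sl.
  rewrite -L2normN opprB L2norm_window //.
  by apply: le_trans (norm16 _ _ ij); apply: le_trans lj; rewrite lerB // sl.
have [g ig gG] := L2_complete (fun i => L2T_tpoly (window (Ni i)) u) cauchy.
exists g; split => // [n|e e0].
- apply/eqP; rewrite -subr_eq0; apply/eqP/cmod0_eq0/eqP.
  rewrite -sqrf_eq0 eq_le sqr_ge0 andbT; apply/ler_addgt0Pr => e e0; rewrite add0r.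
  have [m Hm] := geometric16_small e0.
  have [k16 nN] : (16 ^+ maxn m `|n|%N)^-1 <= e /\ (`|n| <= Ni (maxn m `|n|))%N.
    split; first by apply: Hm; rewrite leq_maxl.
    by case: (NiP (maxn m `|n|%N)) => H _; rewrite (leq_trans _ H) // leq_maxr.
  apply: le_trans k16; apply: le_trans (gG _).
  set i := maxn _ _ in nN *.
  have -> : fourier g n - u n = fourier (g - tpoly (window (Ni i)) u) n.
    rewrite fourierB //; last exact: L2T_tpoly.
    by rewrite fourier_tpoly ?window_uniq // mem_window nN.
  rewrite ler_pXn2r ?nnegrE ?cmod_ge0 ?L2norm_ge0 //.
  by apply: cmod_fourier_le; apply: L2TB => //; exact: L2T_tpoly.
- have [m Hm] := geometric16_small e0.
  by exists (Ni m); apply: le_trans (gG m) (Hm m (leqnn m)).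
Qed.

Lemma L2norm_sub0 g h : L2T g -> L2T h -> (forall n, fourier g n = fourier h n) ->
  L2norm (g - h) = 0.
Proof.
move=> ig ih gh; apply: fourier_inj_norm; first exact: L2TB.
by move=> n; rewrite fourierB // gh subrr.
Qed.

(** The partial sums converge to some function with the coefficients of [g],
    which is [g] itself because coefficients determine the function. *)
Lemma fourier_approx g (e : R) : L2T g -> 0 < e ->
  exists N, L2norm (g - tpoly (window N) (fourier g)) ^+ 2 <= e.
Proof.
move=> ig e0.
have [|h [ih hg happ]] := @riesz_fischer (fourier g) (L2norm g ^+ 2).
  by move=> N; apply: bessel => //; exact: window_uniq.
have [N HN] := happ e e0; exists N; apply: le_trans HN.
rewrite ler_pXn2r ?nnegrE ?L2norm_ge0 //.
have -> : g - tpoly (window N) (fourier g) = (g - h) + (h - tpoly (window N) (fourier g)).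
  by rewrite addrA subrK.
apply: le_trans (L2normD _ _) _.
- exact: L2TB.
- by apply: L2TB => //; exact: L2T_tpoly.
- by rewrite L2norm_sub0 ?add0r // => n; rewrite hg.
Qed.

(** Parseval's identity for all finite sets of frequencies that are large
    enough: the sets to which it is applied grow with the size of a matrix. *)
Lemma parseval_le g (e : R) : L2T g -> 0 < e ->
  exists N, forall s, uniq s -> {subset window N <= s} ->
  L2norm g ^+ 2 <= \sum_(k <- s) cmod (fourier g k) ^+ 2 + e.
Proof.
move=> ig e0; have [N HN] := fourier_approx ig e0.
exists N => s us Ns; rewrite bessel_id ?window_uniq // in HN.
have : \sum_(k <- window N) cmod (fourier g k) ^+ 2 <= \sum_(k <- s) cmod (fourier g k) ^+ 2.
  by apply: sum_subset; rewrite ?window_uniq // => k; exact: sqr_ge0.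
lra.
Qed.

End RieszFischer.

(** * Reflections and translations of the circle *)

Section Reflection.
Context {R : realType}.
Implicit Types (f g h : R -> R[i]).

Local Notation mu := (@lebesgue_measure R).
Local Notation D := (`[0, pi *+ 2]%classic : set R).

Let mD : measurable D. Proof. exact: measurable_itv. Qed.

Let refl (c t : R) : R := c - t.

Let mrefl c : measurable_fun setT (refl c : measurableTypeR R -> measurableTypeR R).
Proof. by apply: measurable_funB; [exact: measurable_cst|exact: measurable_id]. Qed.

(** Reflections serve two purposes: [t |-> 2 pi - t] preserves the period and
    represents [ftilde], and two reflections compose to a translation. *)
Lemma lebesgue_measure_reflection c (A : set R) : measurable A ->
  pushforward mu (refl c : measurableTypeR R -> measurableTypeR R) A = mu A.
Proof.
move=> mA; apply/esym/lebesgue_measure_unique => //= _ [[a b]] _ <-.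
rewrite /pushforward.
have -> : refl c @^-1` `]a, b]%classic = `[c - b, c - a[%classic.
  apply/seteqP; split=> t; rewrite /refl /= !in_itv /=; lra.
rewrite !lebesgue_measure_itv /= !lte_fin.
have -> : (c - b < c - a) = (a < b) by apply/idP/idP; lra.
by case: ifP => _ //; rewrite -!EFinB; congr EFin; lra.
Qed.

Let refl_D : refl (pi *+ 2) @^-1` D = D.
Proof.
by apply/seteqP; split=> t; rewrite /refl /= !in_itv /= => /andP[? ?]; apply/andP; split; lra.
Qed.

Let push_integral (F : R -> \bar R) :
  (\int[mu]_(t in D) F t = \int[pushforward mu (refl (pi *+ 2) : measurableTypeR R -> measurableTypeR R)]_(t in D) F t)%E.
Proof.
by apply: eq_measure_integral => A mA _; apply/esym; exact: lebesgue_measure_reflection.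
Qed.

Let reflK t : refl (pi *+ 2) (refl (pi *+ 2) t) = t.
Proof. by rewrite /refl; lra. Qed.

Let integrable_reflection (u : R -> R) : measurable_fun setT u ->
  mu.-integrable D (EFin \o u) ->
  mu.-integrable D (EFin \o (fun t => u (refl (pi *+ 2) t))).
Proof.
move=> mu' iu.
have m1 : measurable_fun setT (fun t => u (refl (pi *+ 2) t)).
  exact: (measurableT_comp mu' (mrefl _)).
apply/integrableP; split.
  by apply/measurable_EFinP; apply: measurable_funTS; exact: m1.
rewrite push_integral (ge0_integral_pushforward (mrefl _)) //=; last first.
- by apply/measurable_EFinP; apply: measurable_funTS; apply: measurableT_comp; [|exact: m1].
rewrite refl_D; have /integrableP[_] := iu; apply: le_lt_trans.
rewrite le_eqVlt; apply/orP; left; apply/eqP.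
by apply: eq_integral => t _ /=; rewrite reflK.
Qed.

Let Rintegral_reflection (u : R -> R) : measurable_fun setT u ->
  mu.-integrable D (EFin \o u) ->
  Rintegral mu D (fun t => u (refl (pi *+ 2) t)) = Rintegral mu D u.
Proof.
move=> mu' iu.
have m1 : measurable_fun setT (fun t => u (refl (pi *+ 2) t)).
  exact: (measurableT_comp mu' (mrefl _)).
rewrite /Rintegral push_integral (integral_pushforward (mrefl _)) //=; last 2 first.
- by apply/measurable_EFinP; exact: m1.
- rewrite refl_D; apply: eq_integrable iu => // t _ /=; by rewrite reflK.
congr fine; rewrite refl_D; apply: eq_integral => t _ /=; by rewrite reflK.
Qed.

Let ftilde_refl g : periodic g -> ftilde g = fun t => g (refl (pi *+ 2) t).
Proof.
by move=> pg; apply/funext => t; rewrite /ftilde -(pg (- t)) /refl addrC.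
Qed.

Lemma cmeas_ftilde g : cmeas g -> cmeas (ftilde g).
Proof.
have mN : measurable_fun setT (-%R : measurableTypeR R -> measurableTypeR R).
  rewrite (_ : -%R = refl 0); first exact: mrefl.
  by apply/funext => t; rewrite /refl sub0r.
by move=> [m1 m2]; split; [exact: (measurableT_comp m1 mN)|exact: (measurableT_comp m2 mN)].
Qed.

Lemma L2T_ftilde g : L2T g -> L2T (ftilde g).
Proof.
move=> /L2TP[pg mg ig]; apply/L2TP; split.
- by move=> t; rewrite /ftilde -[LHS]pg; congr g; lra.
- exact: cmeas_ftilde.
- by rewrite ftilde_refl //; exact: (integrable_reflection (cmeas_sqmod mg) ig).
Qed.

Lemma circle_mean_ftilde g : periodic g -> cmeas g -> cint g ->
  circle_mean (ftilde g) = circle_mean g.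
Proof.
move=> pg [m1 m2] [i1 i2]; rewrite ftilde_refl //; congr (_ * _).
apply: complexP => /=; [exact: (Rintegral_reflection m1 i1)|
  exact: (Rintegral_reflection m2 i2)].
Qed.

Lemma fourier_ftilde g n : L2T g -> fourier (ftilde g) n = fourier g (- n).
Proof.
move=> ig; rewrite !fourierE !innerE !exJ opprK.
rewrite -[RHS]circle_mean_ftilde.
- congr circle_mean; apply/funext => t.
  rewrite -[LHS]/(g (- t) * ex (- n) t) -[RHS]/(g (- t) * ex n (- t)).
  by rewrite /ex intrN mulNr mulrN.
- by move=> t; rewrite !fctE ex_periodic (L2T_periodic ig).
- by apply: cmeasM; [exact: L2T_cmeas|exact: cmeas_ex].
- by apply: L2T_cintM => //; exact: L2T_ex.
Qed.

Let translation_null c (N : set R) : measurable N -> mu N = 0%E ->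
  measurable ((fun t => t - c) @^-1` N) /\ mu ((fun t => t - c) @^-1` N) = 0%E.
Proof.
move=> mN N0.
have -> : (fun t => t - c) @^-1` N = refl 0 @^-1` (refl (- c) @^-1` N).
  by apply/seteqP; split=> t /=; rewrite /refl (_ : - c - (0 - t) = t - c) //; lra.
have m1 : measurable (refl (- c) @^-1` N).
  by rewrite -[X in measurable X]setTI; exact: mrefl.
split; first by rewrite -[X in measurable X]setTI; exact: mrefl.
have := lebesgue_measure_reflection 0 m1; rewrite /pushforward => ->.
by have := lebesgue_measure_reflection (- c) mN; rewrite /pushforward => ->.
Qed.

(** The exceptional set is covered by the countably many translates, by
    multiples of the period, of a null set. *)
Lemma ae_periodic g : periodic g -> {ae mu, forall t, D t -> g t = 0} ->
  {ae mu, forall t, g t = 0}.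
Proof.
move=> pg [N [mN N0 gN]].
have pgn (n : nat) t : g (t + pi *+ 2 *+ n) = g t.
  by elim: n => [|n IH]; rewrite ?mulr0n ?addr0 // mulrSr addrA pg.
have pgz (k : int) t : g (t - k%:~R * (pi *+ 2)) = g t.
  case: k => n; first by rewrite -[LHS](pgn n) -[X in _ + X]mulr_natl; congr g; lra.
  by rewrite NegzE intrN mulNr opprK mulr_natl pgn.
pose F k := (fun t => t - k%:~R * (pi *+ 2)) @^-1` N.
have nF k : mu.-negligible (F k).
  by have [mF F0] := translation_null (k%:~R * (pi *+ 2)) mN N0; exists (F k); split.
have : mu.-negligible (\bigcup_n (F n%:Z `|` F (- n%:Z))).
  by apply: negligible_bigcup => n; apply: negligibleU.
apply: negligibleS => t /= gt0.
pose k := Num.floor (t / (pi *+ 2)).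
have /andP[k0 k1] := floor_itv (t / (pi *+ 2)).
have tN : F k t.
  apply: gN => /=; rewrite pgz => H; apply/gt0/H.
  rewrite /= in_itv /=; rewrite ler_pdivlMr ?twopi_gt0 // in k0.
  rewrite ltr_pdivrMr ?twopi_gt0 // intrD mulrDl mul1r in k1.
  by rewrite subr_ge0 k0 lerBlDl ltW.
exists `|k|%N => //; have [k_ge0|k_lt0] := lerP 0 k.
- by left; rewrite gez0_abs.
- by right; rewrite ltz0_abs // opprK.
Qed.

(** * Projection onto the Hardy space *)

Lemma H2_ex (n : int) : 0 <= n -> H2 (ex n : R -> R[i]).
Proof.
move=> n0; split; first exact: L2T_ex.
by move=> k k0; rewrite fourier_ex; case: eqP => // nk; move: n0; rewrite nk leNgt k0.
Qed.

Lemma ae_eq_fourier g h : L2T g -> L2T h -> (forall n, fourier g n = fourier h n) ->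
  g = h %[ae mu].
Proof.
move=> ig ih gh; have igh := L2TB ig ih.
have : {ae mu, forall t, (g - h) t = 0}.
  apply: ae_periodic; first exact: L2T_periodic.
  by apply: fourier_inj => // n; rewrite fourierB // gh subrr.
by apply: ae_imply => t /eqP; rewrite subr_eq0 => /eqP.
Qed.

(** The inner product with [g] is continuous and vanishes on the partial
    Fourier sums of [h]. *)
Lemma inner0_fourier g h : L2T g -> L2T h ->
  (forall n, fourier g n = 0 \/ fourier h n = 0) -> inner g h = 0.
Proof.
move=> ig ih gh; apply: cmod0_eq0; apply/eqP.
rewrite -sqrf_eq0 eq_le sqr_ge0 andbT; apply/ler_addgt0Pr => e e0; rewrite add0r.
have d0 : 0 < e / (1 + L2norm g ^+ 2) by rewrite divr_gt0 // ltr_wpDr ?sqr_ge0.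
have [N HN] := fourier_approx ih d0.
have it := L2T_tpoly (window N) (fourier h).
have -> : inner g h = inner g (h - tpoly (window N) (fourier h)).
  rewrite innerBr // inner_tpolyr // big1 ?subr0 // => k _.
  by case: (gh k) => ->; rewrite ?mulr0 ?rmorph0 ?mul0r.
have := cauchy_schwarz_sq ig (L2TB ih it).
move=> /le_trans; apply.
apply: (@le_trans _ _ (L2norm g ^+ 2 * (e / (1 + L2norm g ^+ 2)))).
  by rewrite ler_wpM2l ?sqr_ge0.
rewrite mulrCA ger_pMr // ler_pdivrMr ?ltr_wpDr ?sqr_ge0 // mul1r lerDr //.
Qed.

Lemma H2perpP g : H2perp g <-> L2T g /\ forall n : int, 0 <= n -> fourier g n = 0.
Proof.
split=> [[ig g0]|[ig g0]]; split => //.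
- by move=> n n0; rewrite fourierE g0 //; exact: H2_ex.
- move=> h [ih h0]; apply: inner0_fourier => // n.
  by have [n0|n0] := lerP 0 n; [left; exact: g0|right; exact: h0].
Qed.

Lemma L2T_of_coef (s : pred int) g : L2T g ->
  exists h, L2T h /\ forall n, fourier h n = if s n then fourier g n else 0.
Proof.
move=> ig; have [|h [ih hE _]] :=
    @riesz_fischer R (fun n => if s n then fourier g n else 0) (L2norm g ^+ 2).
  move=> N; apply: le_trans (bessel (window_uniq N) ig); apply: ler_sum => k _.
  by case: ifP => // _; rewrite cmod0 expr0n sqr_ge0.
by exists h.
Qed.

Lemma H2_projection_exists g : L2T g -> exists h, H2_projection g h.
Proof.
move=> ig; have [h [ih hE]] := L2T_of_coef (fun n => 0 <= n) ig.
exists h; split.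
- by split => // n n0; rewrite hE leNgt n0.
- apply/H2perpP; split; first exact: L2TB.
  by move=> n n0; rewrite fourierB // hE n0 subrr.
Qed.

Lemma fourier_H2_projection g h n : L2T g -> H2_projection g h ->
  fourier h n = if 0 <= n then fourier g n else 0.
Proof.
move=> ig [[ih h0] /H2perpP[_ gh]]; case: ifPn => n0.
- by have := gh n n0; rewrite fourierB // => /subr0_eq.
- by rewrite h0 // ltNge.
Qed.

End Reflection.

(** * The Hankel form and the bounded Hankel operator *)

Section FiniteSums.
Context {R : realType}.

Lemma cauchy_schwarz_sum I (s : seq I) (a b : I -> R[i]) :
  cmod (\sum_(i <- s) a i * b i) ^+ 2 <=
  (\sum_(i <- s) cmod (a i) ^+ 2) * (\sum_(i <- s) cmod (b i) ^+ 2).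
Proof.
apply: discriminant_le; try by apply: sumr_ge0 => i _; exact: sqr_ge0.
move=> w.
have -> : \sum_(i <- s) cmod (a i) ^+ 2 + complex.Re (w * \sum_(i <- s) a i * b i) *+ 2
   + cmod w ^+ 2 * \sum_(i <- s) cmod (b i) ^+ 2 =
   \sum_(i <- s) cmod ((a i)^* + w * b i) ^+ 2.
  rewrite mulr_sumr Re_sum -sumrMnl mulr_sumr -!big_split /=.
  apply: eq_bigr => i _; rewrite [RHS]cmodDsq cmodJ cmodM exprMn.
  rewrite -addrA [X in _ + X]addrC addrA; congr (_ + _ *+ 2).
  by rewrite !(ReM, ImM, ReJ, ImJ); ring.
by apply: sumr_ge0 => i _; exact: sqr_ge0.
Qed.

Lemma eq0_of_sq_le (x C : R) : (forall e, 0 < e -> x ^+ 2 <= C * e) -> x = 0.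
Proof.
move=> H; apply/eqP; rewrite -sqrf_eq0 eq_le sqr_ge0 andbT.
apply/ler_addgt0Pr => e e0; rewrite add0r.
have C0 : 0 < `|C| + 1 by rewrite ltr_wpDl.
apply: le_trans (H (e / (`|C| + 1)) _) _; first exact: divr_gt0.
rewrite mulrCA ger_pMr // ler_pdivrMr // mul1r.
by rewrite (le_trans (ler_norm C)) // lerDl.
Qed.

Lemma sum_window_neg (F : int -> R) N : (forall k, 0 <= k -> F k = 0) ->
  \sum_(k <- window N) F k = \sum_(m < N) F (- (m.+1)%:Z).
Proof.
move=> F0; rewrite (bigID (fun k : int => k < 0)) /= [X in _ + X]big1; last first.
  by move=> k; rewrite -leNgt => /F0.
rewrite addr0 -big_filter.
have E : perm_eq [seq k <- window N | k < 0] [seq (- (m.+1)%:Z) | m <- iota 0 N].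
  apply: uniq_perm.
  - by rewrite filter_uniq // window_uniq.
  - by rewrite map_inj_uniq ?iota_uniq // => a b /oppr_inj[].
  - move=> k; rewrite mem_filter mem_window; apply/idP/mapP => [/andP[k0 kN]|[m]].
      by exists `|(k + 1)%R|%N; rewrite ?mem_iota; lia.
    by rewrite mem_iota => mN ->; lia.
by rewrite (perm_big _ E) big_map -(big_mkord xpredT (fun m => F (- (m.+1)%:Z))) /index_iota subn0.
Qed.

Lemma sum_window_nneg (V : nmodType) (F : int -> V) N : (forall k, k < 0 -> F k = 0) ->
  \sum_(k <- window N) F k = \sum_(j < N.+1) F (j : nat)%:Z.
Proof.
move=> F0; rewrite (bigID (fun k : int => 0 <= k)) /= [X in (_ + X)%R]big1; last first.
  by move=> k; rewrite -ltNge => /F0.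
rewrite addr0 -big_filter.
have E : perm_eq [seq k <- window N | 0 <= k] [seq m%:Z | m <- iota 0 N.+1].
  apply: uniq_perm.
  - by rewrite filter_uniq // window_uniq.
  - by rewrite map_inj_uniq ?iota_uniq // => a b [].
  - move=> k; rewrite mem_filter mem_window; apply/idP/mapP => [/andP[k0 kN]|[m]].
      by exists `|k|%N; rewrite ?mem_iota; lia.
    by rewrite mem_iota => mN ->; lia.
by rewrite (perm_big _ E) big_map -(big_mkord xpredT (fun m => F m%:Z)) /index_iota subn0.
Qed.

Lemma bessel_nat (g : R -> R[i]) (k : nat -> int) n : injective k -> L2T g ->
  \sum_(j < n) cmod (fourier g (k j)) ^+ 2 <= L2norm g ^+ 2.
Proof.
move=> ki ig; apply: le_trans (bessel (s := [seq k m | m <- iota 0 n]) _ ig).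
  by rewrite big_map -(big_mkord xpredT (fun j => cmod (fourier g (k j)) ^+ 2)) /index_iota subn0.
by rewrite map_inj_uniq ?iota_uniq.
Qed.

Lemma L2norm_conj (g : R -> R[i]) : L2norm (fconj g) = L2norm g.
Proof.
rewrite /L2norm; congr (Num.sqrt (_ * _)); apply: eq_Rintegral => t _.
by rewrite /fconj cmodJ.
Qed.

End FiniteSums.

Section HankelForm.
Context {R : realType}.
Implicit Types (f g h : R -> R[i]) (c x : nat -> R[i]).

Local Notation mu := (@lebesgue_measure R).

(** The squared norm of the first [K] entries of the image of the finite
    sequence [x] under the Hankel matrix with symbol [c]. *)
Definition hankel_form c (n K : nat) x : R :=
  \sum_(m < K) cmod (\sum_(j < n) c (j + m).+1 * x j) ^+ 2.

(** The coordinate form of compactness of the Hankel operator: its restriction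
    to sequences supported far away has small norm. *)
Definition vanishing_tail c := forall eps : R, 0 < eps ->
  exists M, forall n K x, (forall j, (j < M)%N -> x j = 0) ->
  hankel_form c n K x <= eps * \sum_(j < n) cmod (x j) ^+ 2.

Definition hankel_symbol f (k : nat) : R[i] := fourier (fconj f) (- k%:Z).

Lemma fconjM f g : fconj (f * g) = fconj f * fconj g.
Proof. by apply/funext => t; rewrite /fconj !fctE rmorphM. Qed.

Lemma fconjK f : fconj (fconj f) = f.
Proof. by apply/funext => t; rewrite /fconj conjCK. Qed.

Lemma fourier_conjM f g n : fourier (fconj f * g) n = inner g (ex n * f).
Proof.
rewrite fourierE !innerE fconjM; congr circle_mean.
by ring.
Qed.

Lemma inner_ex_symbol f (j m : nat) : L2T f ->
  inner (ex j%:Z) (ex (- (m.+1)%:Z) * f) = hankel_symbol f (j + m).+1.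
Proof.
move=> If; rewrite -fourier_conjM mulrC fourier_exM; congr fourier; lia.
Qed.

Definition apoly (n : nat) (x : nat -> R[i]) : R -> R[i] :=
  \sum_(j < n) cst (x j) * ex (j : nat)%:Z.

Lemma L2T_apoly n x : L2T (apoly n x).
Proof. by apply: L2T_sum => j; apply: L2TZ; exact: L2T_ex. Qed.

Lemma inner_apoly n x h : L2T h ->
  inner (apoly n x) h = \sum_(j < n) x j * inner (ex (j : nat)%:Z) h.
Proof.
move=> ih; rewrite inner_suml //; last by move=> j; apply: L2TZ; exact: L2T_ex.
by apply: eq_bigr => j _; rewrite innerZl //; exact: L2T_ex.
Qed.

Lemma apoly_tpoly n x : apoly n x =
  tpoly [seq m%:Z | m <- iota 0 n] (fun k => if k is Posz j then x j else 0).
Proof.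
by rewrite /tpoly /apoly big_map -(big_mkord xpredT (fun j => cst (x j) * ex j%:Z)) /index_iota subn0.
Qed.

Lemma uniq_iotaz n : uniq [seq m%:Z | m <- iota 0 n].
Proof. by rewrite map_inj_uniq ?iota_uniq // => a b []. Qed.

Lemma fourier_apoly n x (j : nat) :
  fourier (apoly n x) j%:Z = if (j < n)%N then x j else 0.
Proof.
rewrite apoly_tpoly fourier_tpoly ?uniq_iotaz // mem_map ?mem_iota //.
by move=> a b [].
Qed.

Lemma H2_apoly n x : H2 (apoly n x).
Proof.
split=> [|k k0]; first exact: L2T_apoly.
rewrite apoly_tpoly fourier_tpoly ?uniq_iotaz //; case: ifP => // /mapP[j _ kj].
by rewrite kj in k0.
Qed.

Lemma L2norm_apoly n x : L2norm (apoly n x) ^+ 2 = \sum_(j < n) cmod (x j) ^+ 2.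
Proof.
rewrite apoly_tpoly L2norm_tpoly ?uniq_iotaz // big_map.
by rewrite -(big_mkord xpredT (fun j => cmod (x j) ^+ 2)) /index_iota subn0.
Qed.

Lemma L2T_Mapoly f n x : L2T f -> L2T (f * apoly n x).
Proof.
move=> If; rewrite /apoly mulr_sumr; apply: L2T_sum => j.
have -> : f * (cst (x j) * ex (j : nat)%:Z) = cst (x j) * (ex (j : nat)%:Z * f) by ring.
by apply: L2TZ; exact: L2T_exM.
Qed.

Lemma hankel_form_apoly f n K x : L2T f ->
  \sum_(m < K) cmod (inner (apoly n x) (ex (- (m.+1)%:Z) * f)) ^+ 2 =
  hankel_form (hankel_symbol f) n K x.
Proof.
move=> If; apply: eq_bigr => m _; rewrite inner_apoly; last exact: L2T_exM.
congr (cmod _ ^+ 2); apply: eq_bigr => j _.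
by rewrite inner_ex_symbol // mulrC.
Qed.

Section Bounded.
Variables (f : R -> R[i]) (If : L2T f).
Hypothesis tail : vanishing_tail (hankel_symbol f).

Let F (m : nat) := ex (- (m.+1)%:Z) * f.

Let L2T_apoly' n x : L2T (apoly n x). Proof. exact: L2T_apoly. Qed.

Let IF m : L2T (F m). Proof. exact: L2T_exM. Qed.

Let normF m : L2norm (F m) = L2norm f.
Proof.
rewrite /L2norm; congr (Num.sqrt (_ * _)); apply: eq_Rintegral => t _.
by rewrite /F !fctE cmodM cmod_cis mul1r.
Qed.

Let poly_window g N : H2 g -> tpoly (window N) (fourier g) = apoly N.+1 (fun j => fourier g j%:Z).
Proof.
move=> [ig g0]; rewrite /tpoly sum_window_nneg // => k /g0 ->.
by apply/funext => t; rewrite !fctE mul0r.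
Qed.

(** Splitting off the first [M] coefficients: the head is controlled by those
    coefficients, the tail by the vanishing-tail hypothesis, which passes from
    polynomials to all of [H2] because each entry is continuous in [g]. *)
Lemma hankel_estimate (eps : R) : 0 < eps -> exists M C, 0 <= C /\
  forall g K, H2 g -> \sum_(m < K) cmod (inner g (F m)) ^+ 2 <=
    eps * L2norm g ^+ 2 + C * \sum_(j < M) cmod (fourier g (j : nat)%:Z) ^+ 2.
Proof.
move=> eps0; have e4 : 0 < eps / 4 by rewrite divr_gt0.
have [M HM] := tail e4.
exists M, (2 * (M%:R * L2norm f ^+ 2)); split.
  by rewrite mulr_ge0 // mulr_ge0 // sqr_ge0.
move=> g K [ig g0]; set x := fun j : nat => fourier g j%:Z.
pose r := g - apoly M x.
have ir : L2T r by apply: L2TB => //; exact: L2T_apoly.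
have polyM : apoly M x = tpoly [seq m%:Z | m <- iota 0 M] (fourier g).
  by rewrite /tpoly /apoly big_map -(big_mkord xpredT (fun j => cst (x j) * ex j%:Z)) /index_iota subn0.
have uM : uniq [seq m%:Z | m <- iota 0 M] by rewrite map_inj_uniq ?iota_uniq // => a b [].
have rE k : fourier r k = if k \in [seq m%:Z | m <- iota 0 M] then 0 else fourier g k.
  rewrite /r fourierB //.
  by rewrite polyM fourier_tpoly //; case: ifP; rewrite ?subrr ?subr0.
have r2 : H2 r.
  split => // k k0; rewrite rE; case: ifP => // _; exact: g0.
have nr : L2norm r ^+ 2 <= L2norm g ^+ 2.
  by rewrite /r polyM bessel_id // gerBl sumr_ge0 // => k _; exact: sqr_ge0.
have tailr : \sum_(m < K) cmod (inner r (F m)) ^+ 2 <= 2 * (eps / 4 * L2norm g ^+ 2).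
  apply/ler_addgt0Pr => e e0.
  have d0 : 0 < e / (1 + 2 * (K%:R * L2norm f ^+ 2)).
    by rewrite divr_gt0 // ltr_wpDr // mulr_ge0 // mulr_ge0 // sqr_ge0.
  have [N] := fourier_approx ir d0; rewrite poly_window // => HN.
  have ip := L2T_apoly N.+1 (fun j => fourier r j%:Z).
  have small m : cmod (inner (r - apoly N.+1 (fun j => fourier r j%:Z)) (F m)) ^+ 2 <=
      e / (1 + 2 * (K%:R * L2norm f ^+ 2)) * L2norm f ^+ 2.
    have := cauchy_schwarz_sq (L2TB ir ip) (IF m); rewrite normF.
    by move=> /le_trans; apply; rewrite ler_wpM2r ?sqr_ge0.
  have main : \sum_(m < K) cmod (inner (apoly N.+1 (fun j => fourier r j%:Z)) (F m)) ^+ 2 <=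
      eps / 4 * L2norm g ^+ 2.
    rewrite hankel_form_apoly //; apply: le_trans (HM _ _ _ _) _.
      move=> j jM; rewrite rE ifT //; apply/mapP; exists j => //.
      by rewrite mem_iota.
    rewrite ler_wpM2l ?(ltW e4) //; apply: le_trans nr.
    by apply: (@bessel_nat _ _ Posz _ _ ir) => a b [].
  apply: (@le_trans _ _ (\sum_(m < K)
     (cmod (inner (apoly N.+1 (fun j => fourier r j%:Z)) (F m)) ^+ 2 +
      e / (1 + 2 * (K%:R * L2norm f ^+ 2)) * L2norm f ^+ 2) *+ 2)).
    apply: ler_sum => m _.
    have -> : inner r (F m) = inner (apoly N.+1 (fun j => fourier r j%:Z)) (F m) +
       inner (r - apoly N.+1 (fun j => fourier r j%:Z)) (F m).
      by rewrite innerBl // addrC subrK.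
    by apply: le_trans (cmodDsq_le _ _) _; rewrite lerMn2r lerD2l small.
  rewrite sumrMnl -[leLHS]mulr_natl big_split /= mulrDr; apply: lerD; first by rewrite ler_wpM2l.
  rewrite sumr_const card_ord -[X in 2 * X]mulr_natl; set Q := L2norm f ^+ 2.
  have Q0 : 0 <= 2 * (K%:R * Q) by rewrite mulr_ge0 // mulr_ge0 // sqr_ge0.
  have -> : 2 * (K%:R * (e / (1 + 2 * (K%:R * Q)) * Q)) =
    e * (2 * (K%:R * Q)) / (1 + 2 * (K%:R * Q)).
    by field; rewrite gt_eqF // ltr_wpDr.
  by rewrite ler_pdivrMr ?ltr_wpDr // ler_wpM2l ?(ltW e0) // lerDr.
have head : \sum_(m < K) cmod (inner (apoly M x) (F m)) ^+ 2 <=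
    M%:R * L2norm f ^+ 2 * \sum_(j < M) cmod (x j) ^+ 2.
  apply: (@le_trans _ _ (\sum_(m < K) (\sum_(j < M) cmod (x j) ^+ 2) *
     \sum_(j < M) cmod (inner (ex (j : nat)%:Z) (F m)) ^+ 2)).
    by apply: ler_sum => m _; rewrite inner_apoly //; exact: cauchy_schwarz_sum.
  rewrite -mulr_sumr mulrC ler_wpM2r ?sumr_ge0 // => [j _|]; first exact: sqr_ge0.
  apply: (@le_trans _ _ (\sum_(j < M) L2norm f ^+ 2)); last first.
    by rewrite sumr_const card_ord mulr_natl.
  rewrite exchange_big; apply: ler_sum => j _.
  have ki : injective (fun m => - ((j + m).+1)%:Z) by move=> a b /oppr_inj[] /addnI.
  have := @bessel_nat _ _ _ K ki (L2T_conj If); rewrite L2norm_conj; apply: le_trans.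
  apply: ler_sum => m _; rewrite inner_ex_symbol //; exact: lexx.
have -> : \sum_(m < K) cmod (inner g (F m)) ^+ 2 =
   \sum_(m < K) cmod (inner (apoly M x) (F m) + inner r (F m)) ^+ 2.
  by apply: eq_bigr => m _; rewrite /r innerBl // addrC subrK.
apply: (@le_trans _ _ (\sum_(m < K) (cmod (inner (apoly M x) (F m)) ^+ 2 +
   cmod (inner r (F m)) ^+ 2) *+ 2)).
  by apply: ler_sum => m _; exact: cmodDsq_le.
rewrite sumrMnl big_split /= -[leLHS]mulr_natl mulrDr addrC; apply: lerD.
  apply: le_trans (ler_wpM2l _ tailr) _ => //; rewrite -mulr_natl; lra.
by rewrite -(mulrA 2) ler_wpM2l.
Qed.

End Bounded.
Lemma hankel_formZ c n K (a : R[i]) x :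
  hankel_form c n K (fun j => a * x j) = cmod a ^+ 2 * hankel_form c n K x.
Proof.
rewrite /hankel_form [RHS]mulr_sumr; apply: eq_bigr => m _.
rewrite -exprMn -cmodM [a * _]mulr_sumr; congr (cmod _ ^+ 2).
by apply: eq_bigr => j _; rewrite mulrCA.
Qed.

(** Both arguments by contradiction below start from these witnesses that the
    tail does not vanish: unit vectors, truncated to finite support, supported
    arbitrarily far out. *)
Lemma unit_witness c (eps : R) : 0 < eps ->
  (forall M, ~ forall n K x, (forall j, (j < M)%N -> x j = 0) ->
    hankel_form c n K x <= eps * \sum_(j < n) cmod (x j) ^+ 2) ->
  forall M, exists n K x, [/\ forall j, (j < M)%N -> x j = 0,
    forall j, (n <= j)%N -> x j = 0, \sum_(j < n) cmod (x j) ^+ 2 = 1 &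
    eps < hankel_form c n K x].
Proof.
move=> eps0 noM M.
have /existsNP[n /existsNP[K /existsNP[x /not_implyP[x0 /negP]]]] := noM M.
rewrite -ltNge => big; set S := \sum_(j < n) _ in big.
have S0 : 0 <= S by apply: sumr_ge0 => j _; exact: sqr_ge0.
have Sgt0 : 0 < S.
  rewrite lt_neqAle S0 andbT eq_sym; apply/eqP => Sz.
  have x_eq0 (j : 'I_n) : x j = 0.
    apply: cmod0_eq0; apply/eqP; rewrite -sqrf_eq0; apply/eqP.
    by apply: (psumr_eq0P _ Sz) => // i _; exact: sqr_ge0.
  move: big; rewrite Sz mulr0 /hankel_form big1 ?ltxx // => m _.
  by rewrite big1 ?cmod0 ?expr0n // => j _; rewrite x_eq0 mulr0.
pose a := (Num.sqrt S)^-1; pose u j := if (j < n)%N then x j else 0.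
have a2 : cmod a%:C%C ^+ 2 = S^-1 by rewrite cmodC real_normK ?num_real // exprVn sqr_sqrtr.
have uE (j : 'I_n) : u j = x j by rewrite /u ltn_ord.
exists n, K, (fun j => a%:C%C * u j); split.
- by move=> j jM; rewrite /u x0 // if_same mulr0.
- by move=> j nj; rewrite /u ltnNge nj mulr0.
- under eq_bigr => j _ do rewrite cmodM exprMn uE.
  by rewrite -mulr_sumr a2 mulVf // gt_eqF.
- rewrite hankel_formZ a2 mulrC ltr_pdivlMr //; apply: lt_le_trans big _.
  rewrite le_eqVlt; apply/orP; left; apply/eqP; apply: eq_bigr => m _.
  by congr (cmod _ ^+ 2); apply: eq_bigr => j _; rewrite uE.
Qed.

End HankelForm.

(** * From a vanishing tail to a compact semicommutator *)

Section WeakSubsequence.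
Context {R : realType}.

(** A bounded sequence of coefficient sequences has a coordinatewise convergent
    subsequence: along an ultrafilter every coordinate converges, and finitely
    many coordinates can be matched at a time. *)
Lemma diagonal_subsequence (a : nat -> nat -> R[i]) (B : R) :
  (forall n j, cmod (a n j) <= B) ->
  exists (phi : nat -> nat) (x : nat -> R[i]),
    {homo phi : m n / (m < n)%N} /\
    forall i j, (j <= i)%N -> cmod (a (phi i) j - x j) <= (i.+1%:R)^-1.
Proof.
move=> aB.
have [U [UU subU]] := ultraFilterLemma (F := \oo) _.
have PU := @ultra_proper _ _ UU.
have ul (u : nat -> R) : (forall n, `|u n| <= B) -> exists l : R, u @ U --> l.
  move=> uB; have UB : U (u @^-1` `[- B, B]).
    by apply: filterS (@filterT _ U _) => n _; rewrite /= in_itv /= -ler_norml; exact: uB.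
  have [l [_ cl]] := @segment_compact R (- B) B (u @ U) _ UB.
  exists l => A lA; have [//|UnA] := in_ultra_setVsetC (u @^-1` A) UU.
  have [y [nAy Ay]] := cl (~` A) A UnA lA; by case: nAy.
have /choice[x xP] : forall j, exists z : R[i],
    (fun n => cRe (a n j)) @ U --> cRe z /\ (fun n => cIm (a n j)) @ U --> cIm z.
  move=> j.
  have [l1 H1] := ul (fun n => cRe (a n j)) (fun n => le_trans (Re_le_cmod _) (aB n j)).
  have [l2 H2] := ul (fun n => cIm (a n j)) (fun n => le_trans (Im_le_cmod _) (aB n j)).
  by exists (l1 +i* l2)%C.
have near1 j e : 0 < e -> U [set n | cmod (a n j - x j) <= e].
  move=> e0; have e2 : 0 < e / 2 by rewrite divr_gt0.
  have [/cvgrPdist_le/(_ _ e2) h1 /cvgrPdist_le/(_ _ e2) h2] := xP j.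
  apply: filterS2 h1 h2 => n /= h1 h2.
  rewrite -(@ler_pXn2r _ 2) ?nnegrE ?cmod_ge0 ?(ltW e0) // cmodE !(ReD, ImD, ReN, ImN).
  rewrite -[_ ^+ 2]real_normK ?num_real // -[X in _ + X]real_normK ?num_real //.
  rewrite distrC in h1; rewrite distrC in h2.
  have := normr_ge0 (cRe (a n j) - cRe (x j)).
  have := normr_ge0 (cIm (a n j) - cIm (x j)); nra.
have near_all J e : 0 < e -> U [set n | forall j, (j <= J)%N -> cmod (a n j - x j) <= e].
  move=> e0; elim: J => [|J IH].
    by apply: filterS (near1 0%N e e0) => n h j; rewrite leqn0 => /eqP ->.
  apply: filterS2 (near1 J.+1 e e0) IH => n h1 h2 j.
  by rewrite leq_eqVlt => /orP[/eqP -> //|]; rewrite ltnS; exact: h2.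
have /choice[pick pickP] : forall mi : nat * nat, exists n, (mi.1 < n)%N /\
    forall j, (j <= mi.2)%N -> cmod (a n j - x j) <= (mi.2.+1%:R)^-1.
  move=> [m i] /=.
  have e0 : 0 < (i.+1%:R)^-1 :> R by rewrite invr_gt0.
  have Um : U [set n | (m < n)%N] by apply: subU; exists m.+1.
  by have [n [/= h1 h2]] := filter_ex (filterI (near_all i _ e0) Um); exists n.
pose phi := fix phi (i : nat) := if i is i'.+1 then pick (phi i', i) else pick (0%N, 0%N).
exists phi, x; split.
  apply: homo_ltn => [? ? ?|i]; first exact: ltn_trans.
  by case: (pickP (phi i, i.+1)).
by case=> [|i] j ji; [case: (pickP (0%N, 0%N))|case: (pickP (phi i, i.+1))] => _; apply.
Qed.

End WeakSubsequence.

Section Operators.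
Context {R : realType}.
Implicit Types (g h k : R -> R[i]).
Local Notation mu := (@lebesgue_measure R).

Lemma H2Z (a : R[i]) g : H2 g -> H2 (cst a * g).
Proof.
by move=> [ig g0]; split=> [|n n0]; [exact: L2TZ|rewrite fourierZ // g0 // mulr0].
Qed.

Lemma H2D g h : H2 g -> H2 h -> H2 (g + h).
Proof.
move=> [ig g0] [ih h0]; split=> [|n n0]; first exact: L2TD.
by rewrite fourierD // g0 // h0 // addr0.
Qed.

Lemma H2B g h : H2 g -> H2 h -> H2 (g - h).
Proof.
move=> [ig g0] [ih h0]; split=> [|n n0]; first exact: L2TB.
by rewrite fourierB // g0 // h0 // subrr.
Qed.

Lemma H2_tpoly (s : seq int) x : (forall n : int, n < 0 -> x n = 0) -> H2 (tpoly s x : R -> R[i]).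
Proof.
move=> x0; split=> [|n n0]; first exact: L2T_tpoly.
rewrite fourierE inner_suml ?big1 //; last 2 first.
- by move=> k; apply: L2TZ; exact: L2T_ex.
- exact: L2T_ex.
move=> k _; rewrite innerZl -?fourierE ?fourier_ex; try exact: L2T_ex.
by case: eqP => [->|_]; [rewrite x0 // mul0r|exact: mulr0].
Qed.

Variables (f : R -> R[i]) (If : L2T f).
Hypothesis tail : vanishing_tail (hankel_symbol f).

(** [k] has the negative Fourier coefficients of [conj f * g] and no others; the
    coefficients are written as inner products, which keeps them meaningful when
    [conj f * g] is merely integrable. *)
Let hankel_image g k := L2T k /\
  forall n : int, fourier k n = if n < 0 then inner g (ex n * f) else 0.

(** Parseval's identity turns the bound on finitely many entries into a bound
    on the norm of the image. *)
Let image_norm (eps : R) : 0 < eps -> exists M C, 0 <= C /\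
  forall g k, H2 g -> hankel_image g k -> L2norm k ^+ 2 <=
    eps * L2norm g ^+ 2 + C * \sum_(j < M) cmod (fourier g (j : nat)%:Z) ^+ 2.
Proof.
move=> eps0; have [M [C [C0 H]]] := hankel_estimate If tail eps0.
exists M, C; split => // g k Hg [ik kE]; apply/ler_addgt0Pr => e e0.
have [N HN] := parseval_le ik e0.
apply: le_trans (HN (window N) (window_uniq N) _) _ => //.
rewrite lerD2r; apply: le_trans (H g N Hg).
rewrite sum_window_neg; last by move=> j j0; rewrite kE ltNge j0 cmod0 expr0n.
by apply: ler_sum => m _; rewrite kE.
Qed.

Let image_bounded : exists2 B, 0 <= B &
  forall g k, H2 g -> hankel_image g k -> L2norm k ^+ 2 <= B * L2norm g ^+ 2.
Proof.
have [M [C [C0 H]]] := image_norm (@ltr01 R).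
exists (1 + C); first by rewrite addr_ge0.
move=> g k Hg hk; apply: le_trans (H g k Hg hk) _; rewrite mulrDl lerD2l.
by rewrite ler_wpM2l //; apply: (@bessel_nat _ _ Posz) => [a b []|]; case: Hg.
Qed.

Let image_exists g : exists k, H2 g -> hankel_image g k.
Proof.
have [M [C [C0 H]]] := hankel_estimate If tail (@ltr01 R).
have [Hg|nHg] := pselect (H2 g); last by exists 0.
have [|k [ik kE _]] := @riesz_fischer R (fun n : int => if n < 0 then inner g (ex n * f) else 0)
    (1 * L2norm g ^+ 2 + C * \sum_(j < M) cmod (fourier g (j : nat)%:Z) ^+ 2).
  move=> N; apply: le_trans (H g N Hg).
  rewrite sum_window_neg; last by move=> j j0; rewrite ltNge j0 cmod0 expr0n.
  by apply: ler_sum => m _.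
by exists k.
Qed.

Let imageD g h k l : H2 g -> H2 h -> hankel_image g k -> hankel_image h l ->
  hankel_image (g + h) (k + l).
Proof.
move=> [ig _] [ih _] [ik kE] [il lE]; split; first exact: L2TD.
move=> n; rewrite fourierD // kE lE; case: ifP => _; rewrite ?addr0 //.
by rewrite innerDl //; exact: L2T_exM.
Qed.

Let imageZ (a : R[i]) g k : H2 g -> hankel_image g k ->
  hankel_image (cst a * g) (cst a * k).
Proof.
move=> [ig _] [ik kE]; split; first exact: L2TZ.
move=> n; rewrite fourierZ // kE; case: ifP => _; rewrite ?mulr0 //.
by rewrite innerZl //; exact: L2T_exM.
Qed.

Let imageB g h k l : H2 g -> H2 h -> hankel_image g k -> hankel_image h l ->
  hankel_image (g - h) (k - l).
Proof.
move=> Hg Hh gk hl.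
have N u : - u = cst (-1) * u by apply/funext => t /=; rewrite mulN1r.
by rewrite !N; apply: imageD => //; [exact: H2Z|exact: imageZ].
Qed.

Let image_perp g k : hankel_image g k -> H2perp k.
Proof.
by move=> [ik kE]; apply/H2perpP; split => // n n0; rewrite kE ltNge n0.
Qed.

Let H : {H : (R -> R[i]) -> (R -> R[i]) | forall g, H2 g -> hankel_image g (H g)}.
Proof. by apply: cid; have [H0 H0P] := choice image_exists; exists H0. Qed.

Let Hg := sval H.
Let HgP g : H2 g -> hankel_image g (Hg g). Proof. exact: (svalP H). Qed.

Let bounded_Hg : bounded_hankel (fconj f) Hg.
Proof.
split; [split|].
- by move=> g /HgP; exact: image_perp.
- move=> a g h Gg Gh; have [i1 E1] := HgP (H2D (H2Z a Gg) Gh).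
  have [i2 E2] := imageD (H2Z a Gg) Gh (imageZ a Gg (HgP Gg)) (HgP Gh).
  by apply: ae_eq_fourier => // n; rewrite E1 E2.
- have [B B0 HB] := image_bounded; exists (Num.sqrt B) => g Gg.
  rewrite -(@ler_pXn2r _ 2) ?nnegrE ?mulr_ge0 ?L2norm_ge0 ?sqrtr_ge0 //.
  by rewrite exprMn (sqr_sqrtr B0); apply: HB => //; exact: HgP.
- move=> g [Gg ifg]; split => //; have [h hP] := H2_projection_exists ifg.
  exists h => //; have [i1 E1] := HgP Gg; have [[ih _] _] := hP.
  apply: ae_eq_fourier => //; first exact: L2TB.
  move=> n; rewrite E1 fourierB // (fourier_H2_projection n ifg hP) fourier_conjM.
  by rewrite leNgt; case: ifP => _; rewrite ?subr0 ?subrr.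
Qed.

(** Continuity of the Hankel operator transported to inner products. *)
Let inner_approx g k (e : R) : H2 g -> L2T k -> 0 < e -> exists N,
  forall p q, p = tpoly (window N) (fourier g) -> hankel_image p q ->
  cmod (inner (Hg g) k - inner q k) ^+ 2 <= e /\ L2norm (g - p) ^+ 2 <= e.
Proof.
move=> Gg ik e0; have [B B0 HB] := image_bounded.
have X0 : 0 <= B * L2norm k ^+ 2 by rewrite mulr_ge0 ?sqr_ge0.
have X1 : 0 < 1 + B * L2norm k ^+ 2 by rewrite ltr_wpDr.
have d0 : 0 < e / (1 + B * L2norm k ^+ 2) by rewrite divr_gt0.
have de : e / (1 + B * L2norm k ^+ 2) <= e.
  by rewrite ler_pdivrMr // mulrDr mulr1 lerDl mulr_ge0 // ltW.
have [N HN] := fourier_approx Gg.1 d0; exists N => p q pE pq.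
rewrite -pE in HN; split; last exact: le_trans HN de.
have Gp : H2 p by rewrite pE; apply: H2_tpoly; exact: Gg.2.
have [i1 _] := HgP Gg; have [iq _] := pq.
rewrite -innerBl //; have := cauchy_schwarz_sq (L2TB i1 iq) ik.
move=> /le_trans; apply.
have := HB _ _ (H2B Gg Gp) (imageB Gg Gp (HgP Gg) pq) => H1.
apply: (@le_trans _ _ (B * (e / (1 + B * L2norm k ^+ 2)) * L2norm k ^+ 2)).
  by rewrite ler_wpM2r ?sqr_ge0 // (le_trans H1) // ler_wpM2l.
rewrite mulrAC mulrCA ger_pMr // ler_pdivrMr //.
by rewrite mul1r lerDr.
Qed.

(** The adjoint is determined by its values against the exponentials. *)
Let coefs k (n : int) : R[i] := if 0 <= n then inner k (Hg (ex n)) else 0.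

Let poly_image N (x : int -> R[i]) : (forall n : int, n < 0 -> x n = 0) -> exists2 q,
  hankel_image (tpoly (window N) x) q & forall k, L2T k ->
  inner q k = \sum_(n <- window N) x n * (coefs k n)^*.
Proof.
move=> x0; exists (\sum_(n <- window N) (if 0 <= n then cst (x n) * Hg (ex n) else 0)).
  rewrite /tpoly; elim: (window N) => [|n s IH].
    rewrite !big_nil; split; first exact: L2T0.
    move=> n; rewrite fourierE innerE mul0r circle_mean0.
    by rewrite innerE mul0r circle_mean0; case: ifP.
  have Gs : H2 (\sum_(j <- s) cst (x j) * ex j) by exact: (H2_tpoly s x0).
  rewrite !big_cons; case: ifPn => n0.
    have Gn := H2_ex (R := R) n0; exact: (imageD (H2Z _ Gn) Gs (imageZ _ Gn (HgP Gn)) IH).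
  rewrite -ltNge in n0; rewrite add0r (x0 n n0).
  rewrite (_ : cst 0 * ex n = 0) ?add0r //.
  by apply/funext => t; rewrite !fctE mul0r.
move=> k ik; rewrite inner_suml //; last first.
  move=> n; case: ifPn => n0; last exact: L2T0.
  by apply: L2TZ; case: (HgP (H2_ex (R := R) n0)).
apply: eq_bigr => n _; rewrite /coefs; case: ifPn => n0.
  have [i1 _] := HgP (H2_ex (R := R) n0).
  by rewrite innerZl // -innerJ.
by rewrite innerE mul0r circle_mean0 x0 ?mul0r // ltNge.
Qed.

(** Square summability of the coefficients of the adjoint, obtained by testing
    the bounded Hankel operator on the polynomial with these coefficients. *)
Let coefs_bound : exists2 B, 0 <= B & forall k N, L2T k ->
  \sum_(n <- window N) cmod (coefs k n) ^+ 2 <= B * L2norm k ^+ 2.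
Proof.
have [B B0 HB] := image_bounded; exists B => // k N ik.
have c0 n : n < 0 -> coefs k n = 0 by move=> n0; rewrite /coefs leNgt n0.
have [q hq /(_ k ik) qE] := poly_image N c0.
have nq := HB _ _ (H2_tpoly _ c0) hq; rewrite L2norm_tpoly ?window_uniq // in nq.
set S := \sum_(n <- _) _ in nq *.
have S0 : 0 <= S by apply: sumr_ge0 => n _; exact: sqr_ge0.
have qS : inner q k = S%:C%C.
  rewrite qE /S rmorph_sum; apply: eq_bigr => n _; exact: mulJE.
have := cauchy_schwarz_sq hq.1 ik.
rewrite qS cmodC ger0_norm // => SS.
have [->|Sn0] := eqVneq S 0; first by rewrite mulr_ge0 ?sqr_ge0.
have Sgt0 : 0 < S by rewrite lt_neqAle eq_sym Sn0.
rewrite -(ler_pM2l Sgt0) -[leLHS]expr2; apply: le_trans SS _.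
by rewrite [leRHS]mulrA [S * B]mulrC; apply: ler_wpM2r => //; exact: sqr_ge0.
Qed.

Let adj_exists k : exists v, L2T k -> L2T v /\ forall n, fourier v n = coefs k n.
Proof.
have [ik|nik] := pselect (L2T k); last by exists 0.
have [B B0 HB] := coefs_bound.
have [v [iv vE _]] := @riesz_fischer R (coefs k) _ (fun N => HB k N ik).
by exists v.
Qed.

Let Hs0 : {Hs : (R -> R[i]) -> (R -> R[i]) |
  forall k, L2T k -> L2T (Hs k) /\ forall n, fourier (Hs k) n = coefs k n}.
Proof. by apply: cid; have [H0 H0P] := choice adj_exists; exists H0. Qed.

Let Hs := sval Hs0.
Let HsP k : L2T k -> L2T (Hs k) /\ forall n, fourier (Hs k) n = coefs k n.
Proof. exact: (svalP Hs0). Qed.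

Let adjoint_Hs : hankel_adjoint Hg Hs.
Proof.
have HsH2 k : L2T k -> H2 (Hs k).
  by move=> ik; have [i1 E1] := HsP ik; split => // n n0; rewrite E1 /coefs leNgt n0.
split=> [k [ik _]|g k Gg [ik _]]; first exact: HsH2.
have [iv vE] := HsP ik; have [i1 _] := HgP Gg.
apply/eqP; rewrite -subr_eq0; apply/eqP/cmod0_eq0.
apply: (@eq0_of_sq_le _ _ (2 * (1 + L2norm (Hs k) ^+ 2))) => e e0.
have [N HN] := inner_approx Gg ik e0.
have [q hq /(_ k ik) qE] := poly_image N Gg.2.
have [h1 h2] := HN _ q erefl hq.
set p := tpoly _ _ in h2 hq.
have ip : L2T p by exact: L2T_tpoly.
have qp : inner q k = inner p (Hs k).
  rewrite qE [RHS]innerJ // inner_tpolyr // rmorph_sum; apply: eq_bigr => n _.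
  by rewrite /= rmorphM /= conjCK vE.
have -> : inner (Hg g) k - inner g (Hs k) =
   (inner (Hg g) k - inner q k) + - (inner (g - p) (Hs k)).
  by rewrite (innerBl Gg.1 ip iv) qp; ring.
apply: le_trans (cmodDsq_le _ _) _; rewrite cmodN -[leLHS]mulr_natl -mulrA ler_wpM2l //.
rewrite mulrDl mul1r lerD //.
apply: le_trans (cauchy_schwarz_sq (L2TB Gg.1 ip) iv) _.
by rewrite mulrC ler_wpM2l ?sqr_ge0.
Qed.

(** The adjoint is bounded: the squared norm of the difference [y] of two values
    is an inner product with the image of [y] itself. *)
Let Hs_close g h B : 0 <= B -> (forall g k, H2 g -> hankel_image g k ->
    L2norm k ^+ 2 <= B * L2norm g ^+ 2) -> H2 g -> H2 h ->
  L2norm (Hs (Hg g) - Hs (Hg h)) ^+ 2 <= B * L2norm (Hg g - Hg h) ^+ 2.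
Proof.
move=> B0 HB Gg Gh; have [HsH2 adj] := adjoint_Hs.
have Pg := image_perp (HgP Gg); have Ph := image_perp (HgP Gh).
have Hy := H2B (HsH2 _ Pg) (HsH2 _ Ph).
set y := _ - _ in Hy *; have iy := Hy.1.
have [ig _] := Pg; have [ih _] := Ph; have [i1 _] := HgP Hy.
have : inner y y = inner (Hg y) (Hg g - Hg h).
  rewrite innerBr // !adj // -innerBr //; [by case: (HsH2 _ Pg)|by case: (HsH2 _ Ph)].
rewrite inner_norm => /(congr1 (@cmod R)); rewrite cmodC ger0_norm ?sqr_ge0 // => yy.
have := cauchy_schwarz_sq i1 (L2TB ig ih); rewrite -yy => le1.
have nyB : L2norm (Hg y) ^+ 2 <= B * L2norm y ^+ 2 by apply: HB => //; exact: HgP.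
have [->|yn0] := eqVneq (L2norm y) 0.
  by rewrite [leLHS]expr0n; apply: mulr_ge0 => //; exact: sqr_ge0.
have y2 : 0 < L2norm y ^+ 2 by rewrite lt_neqAle eq_sym expf_neq0 // sqr_ge0.
rewrite -(ler_pM2l y2) -[leLHS]expr2; apply: le_trans le1 _.
rewrite [leRHS]mulrCA [leRHS]mulrA; apply: ler_wpM2r; [exact: sqr_ge0|exact: nyB].
Qed.

(** A bounded sequence has a subsequence whose coefficients converge one by one;
    the estimate [image_norm] leaves a small multiple of the norm plus finitely
    many coefficients, so the images converge in norm. *)
Let compact_HsHg : compact_on_H2 (Hs \o Hg).
Proof.
move=> g Gg [Mb gM].
have [phi [x [phi_lt xP]]] : exists (phi : nat -> nat) (x : nat -> R[i]),
    {homo phi : m n / (m < n)%N} /\ forall i j, (j <= i)%N ->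
    cmod (fourier (g (phi i)) j%:Z - x j) <= (i.+1%:R)^-1.
  apply: (diagonal_subsequence (a := fun n j => fourier (g n) j%:Z) (B := Mb)) => n j.
  by apply: le_trans (gM n); apply: cmod_fourier_le; case: (Gg n).
exists phi; split => //.
pose xz (n : int) : R[i] := if n is Posz j then x j else 0.
have x0 n : n < 0 -> xz n = 0 by case: n.
have [|gx [igx gxE _]] := @riesz_fischer R xz (2 * Mb ^+ 2 + 2).
  move=> N; rewrite sum_window_nneg; last by move=> k /x0 ->; rewrite cmod0 expr0n.
  apply: (@le_trans _ _ (\sum_(j < N.+1) (cmod (fourier (g (phi N)) (j : nat)%:Z) ^+ 2 +
      (N.+1%:R)^-1) *+ 2)).
    apply: ler_sum => j _.
    have -> : xz (j : nat)%:Z = fourier (g (phi N)) (j : nat)%:Z +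
        - (fourier (g (phi N)) (j : nat)%:Z - x j) by rewrite opprB addrC subrK.
    apply: le_trans (cmodDsq_le _ _) _; rewrite lerMn2r lerD2l cmodN /=.
    have h := xP N j (ltn_ord j).
    apply: (@le_trans _ _ ((N.+1%:R)^-1 ^+ 2)).
      by rewrite ler_pXn2r ?nnegrE ?cmod_ge0 ?invr_ge0.
    by rewrite expr2 ler_piMr ?invr_ge0 // invf_le1 // ler1n.
  rewrite sumrMnl big_split /= sumr_const card_ord -[X in _ + X]mulr_natl mulfV //.
  rewrite -[leLHS]mulr_natl mulrDr mulr1 lerD2r ler_wpM2l //.
  apply: (@le_trans _ _ (L2norm (g (phi N)) ^+ 2)).
    by apply: (@bessel_nat _ _ Posz) => [a b []|] //; case: (Gg (phi N)).
  by rewrite ler_pXn2r ?nnegrE ?L2norm_ge0 // (le_trans (L2norm_ge0 (g 0%N))).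
have Gx : H2 gx by split => // n n0; rewrite gxE x0.
have [HsH2 _] := adjoint_Hs; have [B B0 HB] := image_bounded.
exists (Hs (Hg gx)); first by apply: HsH2; exact: image_perp (HgP Gx).
pose Dn := (Mb + L2norm gx) ^+ 2.
have dist n : L2norm (g n - gx) ^+ 2 <= Dn.
  have Mb0 := le_trans (L2norm_ge0 _) (gM 0%N).
  rewrite ler_pXn2r ?nnegrE ?addr_ge0 ?L2norm_ge0 //.
  apply: le_trans (L2normB _ _) _ => //; first by case: (Gg n).
  by rewrite lerD2r.
apply/cvgrPdist_le => e e0.
have D1 : 0 < 1 + Dn by rewrite ltr_wpDr // sqr_ge0.
have B1 : 0 < 1 + B by rewrite ltr_wpDr.
pose eps := e ^+ 2 / (2 * (1 + B) * (1 + Dn)).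
have eps0 : 0 < eps by rewrite divr_gt0 ?exprn_gt0 // !mulr_gt0.
have [M [C [C0 HC]]] := image_norm eps0.
have C1 : 0 < 1 + C by rewrite ltr_wpDr.
pose del := e ^+ 2 / (2 * (1 + B) * (1 + C) * M.+1%:R).
have del0 : 0 < del by rewrite divr_gt0 ?exprn_gt0 // !mulr_gt0.
exists (maxn M (Num.bound del^-1)) => // i /= iM.
rewrite sub0r normrN ger0_norm ?L2norm_ge0 //.
rewrite -(@ler_pXn2r _ 2) ?nnegrE ?L2norm_ge0 ?(ltW e0) //.
apply: le_trans (Hs_close B0 HB (Gg _) Gx) _.
have coef (j : 'I_M) : cmod (fourier (g (phi i) - gx) (j : nat)%:Z) ^+ 2 <= del.
  rewrite fourierB ?gxE //; last by case: (Gg (phi i)).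
  have ji : (j <= i)%N.
    by rewrite (leq_trans (ltnW (ltn_ord j))) // (leq_trans _ iM) // leq_maxl.
  apply: (@le_trans _ _ ((i.+1%:R)^-1 ^+ 2)).
    by rewrite ler_pXn2r ?nnegrE ?cmod_ge0 ?invr_ge0 // xP.
  apply: (@le_trans _ _ (i.+1%:R)^-1).
    by rewrite expr2 ler_piMr ?invr_ge0 // invf_le1 // ler1n.
  rewrite -[del]invrK lef_pV2 ?posrE ?invr_gt0 //.
  rewrite (le_trans (ltW (archi_boundP _))) ?invr_ge0 ?(ltW del0) // ler_nat.
  by rewrite ltnW // ltnS (leq_trans _ iM) // leq_maxr.
have := HC _ _ (H2B (Gg (phi i)) Gx) (imageB (Gg _) Gx (HgP (Gg _)) (HgP Gx)).
set y := L2norm (Hg _ - _) ^+ 2 => yle.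
have {}yle : y <= eps * Dn + C * (M%:R * del).
  apply: le_trans yle _; apply: lerD; first by rewrite ler_wpM2l ?(ltW eps0).
  rewrite ler_wpM2l // (le_trans (ler_sum _ (fun j _ => coef j))) //.
  by rewrite sumr_const card_ord mulr_natl.
apply: (@le_trans _ _ (B * (eps * Dn + C * (M%:R * del)))); first by rewrite ler_wpM2l.
have Dn0 : 0 <= Dn by exact: sqr_ge0.
have fB : B / (1 + B) <= 1 by rewrite ler_pdivrMr // mul1r lerDr.
have fC : C / (1 + C) <= 1 by rewrite ler_pdivrMr // mul1r lerDr.
have fD : Dn / (1 + Dn) <= 1 by rewrite ler_pdivrMr // mul1r lerDr.
have fM : M%:R / M.+1%:R <= 1 :> R by rewrite ler_pdivrMr // mul1r ler_nat.
have q0 (u v : R) : 0 <= u -> 0 < v -> 0 <= u / v by move=> ? ?; rewrite divr_ge0 // ltW.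
have -> : B * (eps * Dn + C * (M%:R * del)) =
   e ^+ 2 / 2 * (B / (1 + B) * (Dn / (1 + Dn))) +
   e ^+ 2 / 2 * (B / (1 + B) * (C / (1 + C) * (M%:R / M.+1%:R))).
  have m0 : 0 < M.+1%:R :> R by [].
  rewrite /eps /del; move: m0 B1 C1 D1; move: (M.+1%:R : R) (1 + B) (1 + C) (1 + Dn).
  by move=> m b c d ? ? ? ?; field; rewrite !gt_eqF.
have e2 : 0 <= e ^+ 2 / 2 by rewrite divr_ge0 ?sqr_ge0.
rewrite [leRHS](_ : e ^+ 2 = e ^+ 2 / 2 * 1 + e ^+ 2 / 2 * 1); last by field.
have qB := q0 _ _ B0 B1; have qC := q0 _ _ C0 C1; have qD := q0 _ _ Dn0 D1.
have qM : 0 <= M%:R / M.+1%:R :> R by apply: q0.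
apply: lerD; apply: ler_wpM2l => //; apply: mulr_ile1 => //.
- by rewrite mulr_ge0.
- exact: mulr_ile1.
Qed.

Lemma compact_semicommutator_of_tail :
  exists2 A, toeplitz_semicommutator f A & compact_on_H2 A.
Proof.
by exists (Hs \o Hg); [exists Hg, Hs; split|exact: compact_HsHg].
Qed.

End Operators.

(** * From a compact semicommutator to a vanishing tail *)

Section TailOfCompact.
Context {R : realType}.
Implicit Types (g h k : R -> R[i]).
Local Notation mu := (@lebesgue_measure R).

Lemma fourier_ae g h n : L2T g -> L2T h -> g = h %[ae mu] -> fourier g n = fourier h n.
Proof.
move=> ig ih gh; apply/eqP; rewrite -subr_eq0 -fourierB //; apply/eqP/cmod0_eq0.
apply/eqP; rewrite eq_le cmod_ge0 andbT.
apply: le_trans (cmod_fourier_le n (L2TB ig ih)) _.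
rewrite L2norm_eq0_ae //; first exact: L2TB.
by apply: ae_imply gh => t gh _; rewrite !fctE gh // subrr.
Qed.

Lemma hankel_graph_fourier f g k (n : int) : n < 0 -> L2T k -> hankel_graph (fconj f) g k ->
  fourier k n = inner g (ex n * f).
Proof.
move=> n0 ik [Gg ifg [h hP kE]]; have [[ih h0] _] := hP.
rewrite (fourier_ae n ik (L2TB ifg ih) kE) fourierB // h0 // subr0.
exact: fourier_conjM.
Qed.

Variables (f : R -> R[i]) (If : L2T f).

(** On a unit vector [g] the quadratic form of the semicommutator dominates the
    Hankel form.  Unit vectors supported ever farther out tend weakly to zero,
    so a compact operator sends them to zero in norm and its quadratic form
    cannot stay away from zero. *)
Lemma tail_of_compact_semicommutator A :
  toeplitz_semicommutator f A -> compact_on_H2 A -> vanishing_tail (hankel_symbol f).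
Proof.
move=> [H [Hs [[[HP _ _] Hgraph] [HsH2 adj] AE]]] cA.
apply: contrapT => /existsNP[eps /not_implyP[eps0 /forallNP noM]].
have ex_g (M : nat) : exists g, [/\ H2 g, L2norm g = 1,
    forall j : nat, (j < M)%N -> fourier g j%:Z = 0, L2T (fconj f * g) &
    exists K, eps < \sum_(m < K) cmod (inner g (ex (- (m.+1)%:Z) * f)) ^+ 2].
  have [n [K [x [x0 _ x1 big]]]] := unit_witness eps0 noM M.
  exists (apoly n x); split.
  - exact: H2_apoly.
  - by apply/eqP; rewrite -(@eqrXn2 _ 2) ?L2norm_ge0 // expr1n L2norm_apoly x1.
  - by move=> j jM; rewrite fourier_apoly; case: ifP => // _; exact: x0.
  - by apply: L2T_Mapoly; exact: L2T_conj.
  - by exists K; rewrite hankel_form_apoly.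
have /choice[g gP] := ex_g.
have Gg n : H2 (g n) by case: (gP n).
have form n : eps <= cmod (inner (A (g n)) (g n)).
  have [_ _ _ ifg [K HK]] := gP n.
  have P := HP _ (Gg n); have [ik _] := P; have HsG := HsH2 _ P.
  rewrite AE // innerJ ?cmodJ; [|by case: (Gg n)|by case: HsG].
  rewrite -adj // inner_norm cmodC ger0_norm ?sqr_ge0 //.
  apply: le_trans (ltW HK) _.
  have ki : injective (fun m => - (m.+1)%:Z) by move=> a b /oppr_inj[].
  apply: le_trans (@bessel_nat _ _ _ K ki ik).
  apply: ler_sum => m _; rewrite (@hankel_graph_fourier f (g n)) //.
  by apply: Hgraph; split.
have [|phi [phi_lt [h [ih h0] /cvgrPdist_lt cvgA]]] := cA g Gg.
  by exists 1 => n; case: (gP n) => _ ->.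
have e3 : 0 < eps / 3 by rewrite divr_gt0.
have [N1 _ HN1] := cvgA _ e3.
have [N2 HN2] := fourier_approx ih (exprn_gt0 2 e3).
set p := tpoly _ _ in HN2; have ip : L2T p by exact: L2T_tpoly.
pose n := maxn N1 N2.+1; have [_ gn g0 _ _] := gP (phi n).
have ign : L2T (g (phi n)) by case: (Gg (phi n)).
have phi_ge i : (i <= phi i)%N.
  by elim: i => // i IH; exact: leq_ltn_trans IH (phi_lt _ _ (ltnSn i)).
have Ag : H2 (A (g (phi n))) by rewrite AE //; apply: HsH2; exact: HP.
have iA : L2T (A (g (phi n))) by case: Ag.
have t1 : cmod (inner (A (g (phi n)) - h) (g (phi n))) < eps / 3.
  apply: le_lt_trans (cauchy_schwarz (L2TB iA ih) ign) _.
  have := HN1 n; rewrite /= leq_maxl sub0r normrN ger0_norm ?L2norm_ge0 // gn mulr1.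
  exact.
have t2 : cmod (inner (h - p) (g (phi n))) <= eps / 3.
  apply: le_trans (cauchy_schwarz (L2TB ih ip) ign) _; rewrite gn mulr1.
  by apply: L2norm_le_sq => //; exact: ltW.
have t3 : inner p (g (phi n)) = 0.
  apply: inner0_fourier => // k.
  have [k0|k0] := ltP k 0; first by right; exact: (Gg (phi n)).2.
  have [kN|kN] := leqP `|k|%N N2; [right|left].
    rewrite -[k]gez0_abs //; apply: g0; apply: leq_trans (phi_ge n).
    by rewrite (leq_ltn_trans kN) // leq_maxr.
  by rewrite fourier_tpoly ?window_uniq // mem_window leqNgt kN.
have := form (phi n); rewrite leNgt => /negP; apply.
have -> : inner (A (g (phi n))) (g (phi n)) =
   inner (A (g (phi n)) - h) (g (phi n)) + inner (h - p) (g (phi n)).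
  by rewrite !innerBl // t3 subr0 subrK.
apply: le_lt_trans (cmodD _ _) _; lra.
Qed.

End TailOfCompact.

(** * The Toeplitz matrices as Gram matrices *)

Section Gram.
Context {R : realType}.
Implicit Types (g h k : R -> R[i]) (x y : nat -> R[i]) (n K : nat).
Local Notation mu := (@lebesgue_measure R).

Variables (f : R -> R[i]) (If : L2T f).

Definition iotaz n : seq int := [seq m%:Z | m <- iota 0 n].

(** [g] minus its orthogonal projection onto the span of [ex 0], ..., [ex n.-1]. *)
Definition truncated n g : R -> R[i] := g - tpoly (iotaz n) (fourier g).

Definition residue n x : R -> R[i] := truncated n (fconj f * apoly n x).

Definition semicommutator_mx n : 'M[R[i]]_n :=
  toeplitz_mx (fsqmod f) n - toeplitz_mx f n *m toeplitz_mx (fconj f) n.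

Lemma L2T_truncated n g : L2T g -> L2T (truncated n g).
Proof. by move=> ig; apply: L2TB => //; exact: L2T_tpoly. Qed.

Lemma sum_iotaz (V : nmodType) (F : int -> V) n :
  \sum_(k <- iotaz n) F k = \sum_(j < n) F (j : nat)%:Z.
Proof.
by rewrite big_map -(big_mkord xpredT (fun j => F j%:Z)) /index_iota subn0.
Qed.

Lemma inner_truncated n g h : L2T g -> L2T h ->
  inner (truncated n g) (truncated n h) =
  inner g h - \sum_(k < n) fourier g (k : nat)%:Z * (fourier h (k : nat)%:Z)^*.
Proof.
move=> ig ih; have ith := L2T_tpoly (iotaz n) (fourier h).
rewrite {2}/truncated innerBr //; last exact: L2T_truncated.
have -> : inner (truncated n g) (tpoly (iotaz n) (fourier h)) = 0.
  apply: inner0_fourier => //; first exact: L2T_truncated.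
  move=> k; rewrite fourierB //; last exact: L2T_tpoly.
  rewrite !fourier_tpoly ?uniq_iotaz //; case: ifP => _; last by right.
  by left; rewrite subrr.
rewrite subr0 innerBl //; last exact: L2T_tpoly.
congr (_ - _); rewrite (innerJ ih); last exact: L2T_tpoly.
rewrite inner_tpolyr // rmorph_sum sum_iotaz; apply: eq_bigr => k _.
by rewrite rmorphM /= conjCK.
Qed.

Lemma L2T_conjMex (j : int) : L2T (fconj f * ex j).
Proof. by rewrite mulrC; apply: L2T_exM; exact: L2T_conj. Qed.

(** The product of the two Toeplitz matrices collects exactly the coefficients
    of index 0 to [n.-1] of the functions [fconj f * ex j]; removing them leaves
    the Gram matrix of the truncated functions. *)
Lemma semicommutator_mxE n (i j : 'I_n) : semicommutator_mx n i j =
  inner (truncated n (fconj f * ex (j : nat)%:Z)) (truncated n (fconj f * ex (i : nat)%:Z)).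
Proof.
rewrite inner_truncated; try exact: L2T_conjMex.
rewrite !mxE; congr (_ - _).
  rewrite fourierE !innerE fconjM fconjK; congr circle_mean.
  rewrite !exJ opprB addrC exD (_ : fsqmod f = f * fconj f); first by ring.
  by apply/funext => t; rewrite /fsqmod -mulJE.
apply: eq_bigr => k _; rewrite !mxE.
have fE (m : int) : fourier (fconj f * ex m) (k : nat)%:Z = fourier (fconj f) ((k : nat)%:Z - m).
  by rewrite mulrC fourier_exM.
rewrite !fE mulrC; congr (_ * _).
by rewrite fourier_conj // conjCK opprB.
Qed.

Lemma fourier_conjMapoly n x (k : int) : fourier (fconj f * apoly n x) k =
  \sum_(j < n) x j * fourier (fconj f) (k - (j : nat)%:Z).
Proof.
have -> : fconj f * apoly n x = \sum_(j < n) cst (x j) * (fconj f * ex (j : nat)%:Z).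
  by rewrite /apoly mulr_sumr; apply: eq_bigr => j _; rewrite mulrCA.
rewrite fourierE inner_suml; last exact: L2T_ex.
  apply: eq_bigr => j _; rewrite innerZl -?fourierE; [|exact: L2T_conjMex|exact: L2T_ex].
  by rewrite [fconj f * _]mulrC fourier_exM.
by move=> j; apply: L2TZ; exact: L2T_conjMex.
Qed.

Lemma residue_sum n x : residue n x =
  \sum_(j < n) cst (x j) * truncated n (fconj f * ex (j : nat)%:Z).
Proof.
rewrite /residue /truncated.
under [RHS]eq_bigr => j _ do rewrite mulrBr.
rewrite sumrB; congr (_ - _).
  by rewrite /apoly mulr_sumr; apply: eq_bigr => j _; rewrite mulrCA.
rewrite /tpoly; under [RHS]eq_bigr => j _ do rewrite mulr_sumr.
rewrite exchange_big /=; apply: eq_bigr => k _; rewrite fourier_conjMapoly.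
apply/funext => t; rewrite !fctE /= mulr_suml fct_sumE.
apply: eq_bigr => j _.
by rewrite [fconj f * ex (j : nat)%:Z]mulrC fourier_exM !fctE mulrA.
Qed.

Lemma semicommutator_mx_form n x y :
  \sum_(i < n) (y i)^* * (semicommutator_mx n *m (\col_j x j)) i 0 =
  inner (residue n x) (residue n y).
Proof.
have it (j : 'I_n) : L2T (truncated n (fconj f * ex (j : nat)%:Z)).
  by apply: L2T_truncated; exact: L2T_conjMex.
rewrite !residue_sum inner_suml; [|by move=> j; apply: L2TZ|by apply: L2T_sum => j; apply: L2TZ].
under [RHS]eq_bigr => j _.
  rewrite inner_sumr; [|by move=> i; apply: L2TZ|by apply: L2TZ].
  over.
rewrite exchange_big /=; apply: eq_bigr => i _; rewrite mxE mulr_sumr.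
apply: eq_bigr => j _; rewrite innerZr ?innerZl //; last exact: L2TZ.
by rewrite semicommutator_mxE mxE; congr (_ * _); rewrite mulrC.
Qed.

Definition reversed n x (j : nat) : R[i] := x (n - j.+1)%N.

(** The frequencies removed by [truncated n], followed by the [K] nearest ones
    below and the [K] nearest ones above. *)
Let outer n K : seq int := iotaz n ++
  ([seq - (m.+1)%:Z | m <- iota 0 K] ++ [seq (n + m)%:Z | m <- iota 0 K]).

Let outer_uniq n K : uniq (outer n K).
Proof.
rewrite !cat_uniq !map_inj_uniq ?iota_uniq /=.
- rewrite andbT; apply/andP; split; apply/hasPn => k.
    rewrite mem_cat => /orP[] /mapP[m _ ->]; apply/mapP => -[j]; rewrite mem_iota => jn; lia.
  by move=> /mapP[m _ ->]; apply/mapP => -[j _]; lia.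
- by move=> a b [/addnI].
- by move=> a b /oppr_inj[].
- by move=> a b [].
Qed.

Let window_outer n K : {subset window K <= outer n K.+1}.
Proof.
move=> k; rewrite mem_window => kK; rewrite !mem_cat.
have [k0|k0] := ltP k 0.
  apply/orP; right; apply/orP; left; apply/mapP; exists `|(k + 1)%R|%N; last lia.
  rewrite mem_iota; lia.
have [kn|kn] := ltP k n%:Z.
  by apply/orP; left; apply/mapP; exists `|k|%N; rewrite ?mem_iota; lia.
apply/orP; right; apply/orP; right; apply/mapP; exists `|(k - n%:Z)%R|%N; last lia.
rewrite mem_iota; lia.
Qed.

Let sum_map_iota (F : int -> R) (h : nat -> int) K :
  \sum_(k <- [seq h m | m <- iota 0 K]) F k = \sum_(m < K) F (h m).
Proof.
by rewrite big_map -(big_mkord xpredT (fun j => F (h j))) /index_iota subn0.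
Qed.

(** Widom's identity: of the frequencies that survive truncation, the negative
    ones form the Hankel form of [f], and those above [n.-1], counted from the
    top, the Hankel form of [ftilde f] at the reversed vector. *)
Let sum_outer n K x (g := fconj f * apoly n x) :
  \sum_(k <- outer n K) cmod (fourier g k) ^+ 2 =
  \sum_(k <- iotaz n) cmod (fourier g k) ^+ 2 +
  (hankel_form (hankel_symbol f) n K x +
   hankel_form (hankel_symbol (ftilde f)) n K (reversed n x)).
Proof.
rewrite !big_cat; congr (_ + (_ + _)); rewrite sum_map_iota.
  rewrite -hankel_form_apoly //; apply: eq_bigr => m _.
  by rewrite /g fourier_conjM.
apply: eq_bigr => m _; congr (cmod _ ^+ 2).
rewrite /g fourier_conjMapoly (reindex_inj rev_ord_inj) /=; apply: eq_bigr => j _.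
rewrite mulrC; congr (_ * _); rewrite /hankel_symbol.
rewrite -[fconj (ftilde f)]/(ftilde (fconj f)) fourier_ftilde; last exact: L2T_conj.
congr fourier; have := ltn_ord j; lia.
Qed.

Lemma residue_ge n K x :
  hankel_form (hankel_symbol f) n K x +
  hankel_form (hankel_symbol (ftilde f)) n K (reversed n x) <= L2norm (residue n x) ^+ 2.
Proof.
have ig := L2T_Mapoly n x (L2T_conj If).
rewrite bessel_id ?uniq_iotaz // lerBrDl -sum_outer.
by apply: bessel => //; exact: outer_uniq.
Qed.

Lemma residue_le n x (e : R) : 0 < e -> exists K, L2norm (residue n x) ^+ 2 <=
  hankel_form (hankel_symbol f) n K x +
  hankel_form (hankel_symbol (ftilde f)) n K (reversed n x) + e.
Proof.
move=> e0; have ig := L2T_Mapoly n x (L2T_conj If).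
have [N HN] := parseval_le ig e0; exists N.+1.
have H := HN (outer n N.+1) (outer_uniq _ _) (@window_outer n N).
have HB : L2norm (residue n x) ^+ 2 = _ := bessel_id (uniq_iotaz n) ig.
by rewrite HB lerBlDl !addrA; rewrite sum_outer !addrA in H.
Qed.

End Gram.

(** * Clustering of the matrices in terms of their quadratic forms *)

Section OperatorNorm.
Context {R : realType}.

Lemma cvnorm_ge0 n (x : 'cV[R[i]]_n) : 0 <= cvnorm x. Proof. exact: sqrtr_ge0. Qed.

Lemma cvnorm_sq n (x : 'cV[R[i]]_n) : cvnorm x ^+ 2 = \sum_(i < n) cmod (x i 0) ^+ 2.
Proof. by rewrite sqr_sqrtr // sumr_ge0 // => i _; exact: sqr_ge0. Qed.

Lemma cvnormZ n (a : R[i]) (x : 'cV[R[i]]_n) : cvnorm (a *: x) = cmod a * cvnorm x.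
Proof.
apply/eqP; rewrite -(@eqrXn2 _ 2) ?mulr_ge0 ?cvnorm_ge0 ?cmod_ge0 //.
rewrite exprMn !cvnorm_sq mulr_sumr; apply/eqP; apply: eq_bigr => i _.
by rewrite mxE cmodM exprMn.
Qed.

Lemma cvnorm_eq0 n (x : 'cV[R[i]]_n) : (cvnorm x == 0) = (x == 0).
Proof.
apply/idP/eqP => [/eqP x0|->].
  have /eqP := cvnorm_sq x; rewrite x0 expr0n /= eq_sym => /eqP Sz.
  apply/matrixP => i j; rewrite ord1 mxE; apply: cmod0_eq0; apply/eqP.
  by rewrite -sqrf_eq0; apply/eqP; apply: (psumr_eq0P _ Sz) => // k _; exact: sqr_ge0.
rewrite -sqrf_eq0 cvnorm_sq big1 // => i _; by rewrite mxE cmod0 expr0n.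
Qed.

Let frobenius n (A : 'M[R[i]]_n) : R := \sum_(i < n) \sum_(j < n) cmod (A i j) ^+ 2.

Let frobenius_ge0 n (A : 'M[R[i]]_n) : 0 <= frobenius A.
Proof. by apply: sumr_ge0 => i _; apply: sumr_ge0 => j _; exact: sqr_ge0. Qed.

Let frobenius_bound n (A : 'M[R[i]]_n) (x : 'cV[R[i]]_n) :
  cvnorm (A *m x) ^+ 2 <= frobenius A * cvnorm x ^+ 2.
Proof.
rewrite !cvnorm_sq mulr_suml; apply: ler_sum => i _; rewrite mxE.
exact: cauchy_schwarz_sum.
Qed.

Lemma mx_opnorm_le n (A : 'M[R[i]]_n) (B : R) : 0 <= B ->
  (forall x, cvnorm (A *m x) <= B * cvnorm x) -> mx_opnorm A <= B.
Proof.
move=> B0 AB; apply: ge_sup; first by exists (cvnorm (A *m 0)), 0 => //=; rewrite (_ : cvnorm 0 = 0) //; apply/eqP; rewrite cvnorm_eq0.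
by move=> _ [x /= x1 <-]; apply: le_trans (AB x) _; rewrite ler_piMr.
Qed.

Lemma cvnorm_mul_le n (A : 'M[R[i]]_n) (x : 'cV[R[i]]_n) :
  cvnorm (A *m x) <= mx_opnorm A * cvnorm x.
Proof.
have [/eqP|xn0] := eqVneq (cvnorm x) 0.
  rewrite cvnorm_eq0 => /eqP ->; rewrite mulmx0.
  by rewrite (_ : cvnorm 0 = 0) ?mulr0 //; apply/eqP; rewrite cvnorm_eq0.
have x_gt0 : 0 < cvnorm x by rewrite lt_neqAle eq_sym xn0 cvnorm_ge0.
have inv0 : 0 <= (cvnorm x)^-1 by rewrite invr_ge0 ltW.
rewrite -ler_pdivrMr // mulrC.
rewrite -[(cvnorm x)^-1]ger0_norm // -cmodC -cvnormZ scalemxAr.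
apply: ub_le_sup; last first.
  exists ((cvnorm x)^-1%:C%C *: x) => //=.
  by rewrite cvnormZ cmodC ger0_norm // mulVf.
exists (Num.sqrt (frobenius A)) => _ [y /= y1 <-].
rewrite -(@ler_pXn2r _ 2) ?nnegrE ?cvnorm_ge0 ?sqrtr_ge0 //.
rewrite (sqr_sqrtr (frobenius_ge0 A)); apply: le_trans (frobenius_bound A y) _.
rewrite ler_piMr // expr_le1 // cvnorm_ge0 //.
Qed.

Lemma kernel_vector m n p (A : 'M[R[i]]_(m, n)) (X : 'M[R[i]]_(n, p)) :
  (\rank A < p)%N -> exists2 a : 'cV[R[i]]_p, a != 0 & A *m (X *m a) = 0.
Proof.
move=> Ap; pose K := kermx (A *m X)^T.
have Kn0 : K != 0.
  rewrite -mxrank_eq0 mxrank_ker mxrank_tr subn_eq0 -ltnNge.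
  exact: leq_ltn_trans (mxrankM_maxl A X) Ap.
have [i Ki] : exists i, row i K != 0.
  apply: contrapT => /forallNP H; move: Kn0; apply/negP; rewrite negbK; apply/eqP.
  by apply/row_matrixP => i; rewrite row0; apply/eqP; apply: contrapT => /negP; exact: H.
exists (row i K)^T; first by rewrite trmx_eq0.
apply: trmx_inj; rewrite mulmxA trmx_mul trmxK trmx0.
by have := mulmx_ker (A *m X)^T => /(congr1 (row i)); rewrite row_mul row0.
Qed.

End OperatorNorm.

Section Cluster.
Context {R : realType}.
Variables (f : R -> R[i]) (If : L2T f).
Implicit Types (x y : nat -> R[i]).

Let S n := semicommutator_mx f n.

(** On the kernel of the low-rank part the matrix agrees with the part of small
    norm, and any family of more vectors than the rank spans a kernel vector. *)
Lemma cluster_kernel : type2_strong_cluster_to0 S ->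
  forall eps : R, 0 < eps -> exists r n0, forall n s (X : 'M[R[i]]_(n, s)),
  (n0 < n)%N -> (r < s)%N -> exists2 a : 'cV[R[i]]_s, a != 0 &
  forall x, (forall j : 'I_n, x j = (X *m a) j 0) ->
  L2norm (residue f n x) ^+ 2 <= eps * \sum_(j < n) cmod (x j) ^+ 2.
Proof.
move=> cl eps eps0; have [N1 [N2 [_ _ H]]] := cl eps eps0.
exists N1, N2 => n s X n2 s1; have [Rn [Nn [DE rk nrm]]] := H n n2.
have [a a0 Ra] := kernel_vector X (leq_ltn_trans rk s1).
exists a => // x xE; set v := X *m a in Ra xE.
have colx : \col_j x j = v by apply/matrixP => j k; rewrite ord1 mxE.
have Sv : S n *m v = Nn *m v by rewrite DE mulmxDl Ra add0r.
have := semicommutator_mx_form If n x x; rewrite inner_norm colx Sv => form.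
have vn : \sum_(j < n) cmod (x j) ^+ 2 = cvnorm v ^+ 2.
  by rewrite cvnorm_sq; apply: eq_bigr => j _; rewrite xE.
have := cauchy_schwarz_sum (index_enum 'I_n) (fun i => (x i)^*) (fun i => (Nn *m v) i 0).
rewrite form cmodC ger0_norm ?sqr_ge0 //.
under eq_bigr => i _ do rewrite cmodJ.
rewrite vn -cvnorm_sq -exprMn ler_pXn2r ?nnegrE ?sqr_ge0 ?mulr_ge0 ?cvnorm_ge0 // => le1.
apply: le_trans le1 _; rewrite expr2 mulrA mulrC ler_wpM2r ?cvnorm_ge0 //.
apply: le_trans (cvnorm_mul_le Nn v) _; rewrite ler_wpM2r ?cvnorm_ge0 //.
exact: ltW.
Qed.

Let kept M n (j : nat) := (M <= j)%N && (j + M < n)%N.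

Let card_dropped (M n : nat) : (#|[pred j : 'I_n | ~~ kept M n j]| <= M + M)%N.
Proof.
rewrite cardE -(size_map val).
have -> : (M + M)%N = size (iota 0 M ++ iota (n - M) M) by rewrite size_cat !size_iota.
apply: uniq_leq_size; first by rewrite map_inj_uniq ?enum_uniq //; exact: val_inj.
move=> _ /mapP[j +] ->; rewrite mem_enum inE /kept mem_cat !mem_iota.
have := ltn_ord j; rewrite /=; lia.
Qed.

Let Q M n : 'M[R[i]]_n := \matrix_(i, j) ((i == j) && kept M n i)%:R.

Let rank_compl (M n : nat) : (\rank (1%:M - Q M n)%R <= M + M)%N.
Proof.
have -> : 1%:M - Q M n = \sum_(i < n | ~~ kept M n i) delta_mx i i.
  apply/matrixP => i j; rewrite !mxE summxE.
  under eq_bigr => k _ do rewrite mxE.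
  have [<-|ij] := eqVneq i j.
    have [ki|ki] := boolP (kept M n i).
      rewrite subrr big1 // => k kk; case: eqVneq => //= ik.
      by rewrite -ik ki in kk.
    rewrite subr0 (bigD1 i) //= eqxx /= big1 ?addr0 // => k /andP[_ /negPf].
    by rewrite eq_sym => ->.
  rewrite subr0 big1 // => k _.
  by case: eqVneq => //= ik; rewrite -ik eq_sym (negPf ij).
apply: leq_trans (card_dropped M n); rewrite -sum1_card.
elim/big_ind2 : _ => [|A1 n1 A2 n2 h1 h2|i _]; first by rewrite mxrank0.
- by apply: leq_trans (mxrank_add _ _) _; exact: leq_add.
- by rewrite mxrank_delta.
Qed.

(** Compressing to the coordinates kept away from both ends changes the rank by
    a bounded amount; there both Hankel forms are small, and Cauchy-Schwarz for
    the Gram matrix turns a small quadratic form into a small norm. *)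
Lemma cluster_of_tails : vanishing_tail (hankel_symbol f) ->
  vanishing_tail (hankel_symbol (ftilde f)) -> type2_strong_cluster_to0 S.
Proof.
move=> t1 t2 eps eps0; have e4 : 0 < eps / 4 by rewrite divr_gt0.
have [M1 H1] := t1 _ e4; have [M2 H2] := t2 _ e4; pose M := maxn M1 M2.
exists (M + M + (M + M)).+1, 1%N; split => // n _.
pose q := Q M n.
exists (S n - q *m S n *m q), (q *m S n *m q); split; first by rewrite subrK.
  have -> : S n - q *m S n *m q = (1%:M - q) *m S n + q *m S n *m (1%:M - q).
    by move: (S n) => T; rewrite mulmxBl mulmxBr mul1mx mulmx1 addrA subrK.
  apply: leqW; apply: leq_trans (mxrank_add _ _) _; apply: leq_add.
    by apply: leq_trans (mxrankM_maxl _ _) _; exact: rank_compl.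
  by apply: leq_trans (mxrankM_maxr _ _) _; exact: rank_compl.
have small x : (forall j, ~~ kept M n j -> x j = 0) ->
    L2norm (residue f n x) ^+ 2 <= eps / 2 * \sum_(j < n) cmod (x j) ^+ 2.
  move=> x0; apply/ler_addgt0Pr => e e0.
  have [K] := residue_le If n x e0; move/le_trans; apply; rewrite lerD2r.
  have -> : eps / 2 = eps / 4 + eps / 4 by field.
  rewrite mulrDl; apply: lerD.
    apply: H1 => j jM; apply: x0; rewrite /kept negb_and -ltnNge.
    by rewrite (leq_trans jM) ?leq_maxl.
  have <- : \sum_(j < n) cmod (reversed n x j) ^+ 2 = \sum_(j < n) cmod (x j) ^+ 2.
    by rewrite [RHS](reindex_inj rev_ord_inj).
  apply: H2 => j jM; apply: x0; rewrite /kept negb_and; lia.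
apply: le_lt_trans (_ : eps / 2 < eps); last lra.
apply: mx_opnorm_le => [|v]; first by rewrite divr_ge0 // ltW.
pose ext (u : 'cV[R[i]]_n) (j : nat) : R[i] :=
  if insub j is Some i then (kept M n j)%:R * u (i : 'I_n) 0 else 0.
have extE u (j : 'I_n) : ext u j = (q *m u) j 0.
  rewrite /ext valK mxE (bigD1 j) //= mxE eqxx /= big1 ?addr0 // => k kj.
  by rewrite mxE eq_sym (negPf kj) mul0r.
have ext0 u j : ~~ kept M n j -> ext u j = 0.
  by move=> /negPf kj; rewrite /ext; case: insubP => // i _ ij; rewrite kj mul0r.
have qq : q *m q = q.
  apply/matrixP => i j; rewrite !mxE (bigD1 i) //= !mxE eqxx /= big1 ?addr0.
    by case: kept; rewrite ?mul1r ?mul0r ?andbF.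
  by move=> k ki; rewrite !mxE eq_sym (negPf ki) mul0r.
have ext_norm u : \sum_(j < n) cmod (ext u j) ^+ 2 = cvnorm (q *m u) ^+ 2.
  by rewrite cvnorm_sq; apply: eq_bigr => j _; rewrite extE.
have q_le u : cvnorm (q *m u) <= cvnorm u.
  rewrite -(@ler_pXn2r _ 2) ?nnegrE ?cvnorm_ge0 // -ext_norm cvnorm_sq.
  apply: ler_sum => j _; rewrite /ext valK; case: kept; first by rewrite mul1r.
  by rewrite mul0r cmod0 expr0n; exact: sqr_ge0.
set w := q *m S n *m q *m v.
have wq : q *m w = w by rewrite /w !mulmxA qq.
have := semicommutator_mx_form If n (ext v) (ext w).
have -> : \col_j ext v j = q *m v.
  by apply/matrixP => j k; rewrite ord1 mxE extE.
have -> : \sum_(i < n) (ext w i)^* * (semicommutator_mx f n *m (q *m v)) i 0 =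
    (cvnorm w ^+ 2)%:C%C.
  rewrite cvnorm_sq rmorph_sum; apply: eq_bigr => i _ /=.
  rewrite extE wq; have -> : w i 0 = (kept M n i)%:R * (S n *m (q *m v)) i 0.
    by rewrite /w -!mulmxA -extE /ext valK.
  rewrite -[semicommutator_mx f n]/(S n) -mulJE mulrC.
  by case: kept; rewrite ?mul1r // !mul0r rmorph0 mulr0.
move=> form.
have nw := small _ (ext0 w); have nv := small _ (ext0 v).
rewrite !ext_norm wq in nw nv.
have iP x : L2T (residue f n x) by apply: L2T_truncated; apply: L2T_Mapoly; exact: L2T_conj.
have := cauchy_schwarz_sq (iP (ext v)) (iP (ext w)).
rewrite -form cmodC real_normK ?num_real // => cs.
have h0 : 0 <= eps / 2 by rewrite divr_ge0 // ltW.
have [w0|wn0] := eqVneq (cvnorm w) 0; first by rewrite w0 mulr_ge0 ?cvnorm_ge0.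
have w2 : 0 < cvnorm w ^+ 2 by rewrite exprn_gt0 // lt_neqAle eq_sym wn0 cvnorm_ge0.
rewrite -(@ler_pXn2r _ 2) ?nnegrE ?(mulr_ge0 h0) ?cvnorm_ge0 //.
rewrite -(ler_pM2r w2) -[leLHS]expr2; apply: le_trans cs _.
apply: le_trans (ler_pM (sqr_ge0 _) (sqr_ge0 _) nv nw) _.
rewrite exprMn [leLHS]mulrA ler_wpM2r ?sqr_ge0 // mulrAC -expr2 ler_wpM2l ?sqr_ge0 //.
by rewrite ler_pXn2r ?nnegrE ?cvnorm_ge0.
Qed.

End Cluster.

(** * Many independent directions from a tail that does not vanish *)

Section Greedy.
Context {R : realType}.
Implicit Types (x y a : nat -> R[i]) (n K s : nat).

(** Perturbation of a squared modulus at a small relative cost [th]. *)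
Lemma cmodD_lower (th : R) (u v : R[i]) : 0 < th ->
  (1 - th) * cmod u ^+ 2 - th^-1 * cmod v ^+ 2 <= cmod (u + v) ^+ 2.
Proof.
move=> th0; rewrite -subr_ge0 !cmodE !(ReD, ImD).
move: (cRe u) (cIm u) (cRe v) (cIm v) => u1 u2 v1 v2.
have -> : (u1 + v1) ^+ 2 + (u2 + v2) ^+ 2 -
  ((1 - th) * (u1 ^+ 2 + u2 ^+ 2) - th^-1 * (v1 ^+ 2 + v2 ^+ 2)) =
  th * ((u1 + v1 / th) ^+ 2 + (u2 + v2 / th) ^+ 2) + (v1 ^+ 2 + v2 ^+ 2).
  by field; rewrite gt_eqF.
by rewrite addr_ge0 ?mulr_ge0 ?addr_ge0 ?sqr_ge0 // ltW.
Qed.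

Lemma bounded_nondecreasing_tail (u : nat -> R) (B d : R) :
  {homo u : m n / (m <= n)%N >-> m <= n} -> (forall n, u n <= B) -> 0 < d ->
  exists N, forall n, (N <= n)%N -> u n <= u N + d.
Proof.
move=> und uB d0.
have ucvg : cvgn u by apply: nondecreasing_is_cvgn => //; exists B => _ [n _ <-].
have /cvgrPdist_le/(_ _ d0)[N _ HN] : u @ \oo --> limn u by [].
exists N => n Nn; have := HN N (leqnn N).
have := nondecreasing_cvgn_le und ucvg n => un /(le_trans (ler_norm _)); lra.
Qed.

Variables (c : nat -> R[i]) (C : R).
Hypothesis cC : forall N, \sum_(k < N) cmod (c k) ^+ 2 <= C.

Let entry n m x : R[i] := \sum_(j < n) c (j + m).+1 * x j.

Let formE n K x : hankel_form c n K x = \sum_(m < K) cmod (entry n m x) ^+ 2.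
Proof. by []. Qed.

Let sum_iota (F : nat -> R) n : \sum_(k <- iota 0 n) F k = \sum_(k < n) F k.
Proof. by rewrite -(big_mkord xpredT F) /index_iota subn0. Qed.

Let sum_mono (F : nat -> R) n n' : (forall k, 0 <= F k) -> (n <= n')%N ->
  \sum_(k < n) F k <= \sum_(k < n') F k.
Proof.
move=> F0 nn; rewrite -!sum_iota; apply: sum_subset; rewrite ?iota_uniq // => k.
by rewrite !mem_iota; lia.
Qed.

Let form_mono n x K K' : (K <= K')%N -> hankel_form c n K x <= hankel_form c n K' x.
Proof.
by apply: (sum_mono (F := fun m => cmod (entry n m x) ^+ 2)) => m; exact: sqr_ge0.
Qed.

Let sum_c_shift N m : \sum_(j < N) cmod (c (j + m).+1) ^+ 2 <= C.
Proof.
apply: le_trans (cC (N + m).+1).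
rewrite -(sum_iota (fun j => cmod (c (j + m).+1) ^+ 2)) -(sum_iota (fun k => cmod (c k) ^+ 2)).
rewrite -(big_map (fun j => (j + m).+1) xpredT (fun k => cmod (c k) ^+ 2)).
apply: sum_subset; rewrite ?iota_uniq //.
- by rewrite map_inj_uniq ?iota_uniq // => i j [/addIn].
- by move=> _ /mapP[j + ->]; rewrite !mem_iota; lia.
- by move=> k; exact: sqr_ge0.
Qed.

Let form_bounded n x K : hankel_form c n K x <= n%:R * C * \sum_(j < n) cmod (x j) ^+ 2.
Proof.
apply: (@le_trans _ _ (\sum_(m < K) (\sum_(j < n) cmod (c (j + m).+1) ^+ 2) *
   \sum_(j < n) cmod (x j) ^+ 2)).
  by apply: ler_sum => m _; exact: cauchy_schwarz_sum.
rewrite -mulr_suml ler_wpM2r //; first by apply: sumr_ge0 => j _; exact: sqr_ge0.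
rewrite exchange_big mulr_natl (_ : C *+ n = \sum_(j < n) C); last by rewrite sumr_const card_ord.
apply: ler_sum => j _.
apply: le_trans (sum_c_shift K j); rewrite le_eqVlt; apply/orP; left; apply/eqP.
by apply: eq_bigr => m _; rewrite addnC.
Qed.

Let entry_small (d : R) : 0 < d -> exists M, forall n x m,
  (forall j, (j < M)%N -> x j = 0) ->
  cmod (entry n m x) ^+ 2 <= d * \sum_(j < n) cmod (x j) ^+ 2.
Proof.
move=> d0; pose u N := \sum_(k < N) cmod (c k) ^+ 2.
have und : {homo u : m n / (m <= n)%N >-> m <= n}.
  by move=> m n; apply: (sum_mono (F := fun k => cmod (c k) ^+ 2)) => k; exact: sqr_ge0.
have [M HM] := bounded_nondecreasing_tail und cC d0.
exists M => n x m x0.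
have -> : entry n m x = \sum_(j < n) (if (M <= j)%N then c (j + m).+1 else 0) * x j.
  apply: eq_bigr => j _; case: leqP => // jM; by rewrite x0 // !mulr0.
apply: le_trans (cauchy_schwarz_sum _ _ _) _.
rewrite ler_wpM2r //; first by apply: sumr_ge0 => j _; exact: sqr_ge0.
have {}HM : u (M + n + m).+1 <= u M + d by apply: HM; lia.
rewrite -(lerD2l (u M)); apply: le_trans HM.
rewrite /u -!(sum_iota (fun k => cmod (c k) ^+ 2)).
pose far := [seq (j + m).+1 | j <- [seq j <- iota 0 n | M <= j]%N].
have -> : \sum_(j < n) cmod (if (M <= j)%N then c (j + m).+1 else 0) ^+ 2 =
    \sum_(k <- far) cmod (c k) ^+ 2.
  rewrite /far big_map big_filter -(sum_iota (fun j => cmod (if (M <= j)%N then c (j + m).+1 else 0) ^+ 2)).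
  rewrite [RHS]big_mkcond; apply: eq_bigr => j _; case: ifP => // _.
  by rewrite cmod0 expr0n.
rewrite -big_cat; apply: sum_subset; rewrite ?iota_uniq //.
- rewrite cat_uniq iota_uniq map_inj_uniq ?filter_uniq ?iota_uniq ?andbT //.
    apply/hasPn => _ /mapP[j + ->]; rewrite mem_filter !mem_iota; lia.
  by move=> i j [/addIn].
- move=> k; rewrite mem_cat => /orP[|/mapP[j + ->]]; rewrite ?mem_filter !mem_iota; lia.
- by move=> k; exact: sqr_ge0.
Qed.

Let sum_support (V : nmodType) (F : nat -> V) n n' : (n <= n')%N ->
  (forall j, (n <= j)%N -> F j = 0) -> \sum_(j < n') F j = \sum_(j < n) F j.
Proof.
move=> nn F0; rewrite (big_ord_widen n' F nn) [RHS]big_mkcond.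
by apply: eq_bigr => j _; case: ltnP => // /F0.
Qed.

Let entry_support n n' m x : (n <= n')%N -> (forall j, (n <= j)%N -> x j = 0) ->
  entry n' m x = entry n m x.
Proof.
move=> nn x0; apply: (sum_support (F := fun j => c (j + m).+1 * x j)) => // j nj.
by rewrite x0 // mulr0.
Qed.

Definition combination s (x : nat -> nat -> R[i]) a (j : nat) : R[i] :=
  \sum_(l < s) a l * x l j.

Let entry_combination n m s (x : nat -> nat -> R[i]) a :
  entry n m (combination s x a) = \sum_(l < s) a l * entry n m (x l).
Proof.
rewrite /entry /combination; under eq_bigr => j _ do rewrite mulr_sumr.
rewrite exchange_big; apply: eq_bigr => l _; rewrite mulr_sumr.
by apply: eq_bigr => j _; rewrite mulrCA.
Qed.

Let split_sum (F : nat -> R) K K' : (K <= K')%N ->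
  \sum_(m < K') F m = \sum_(m < K) F m + \sum_(m < K') (if (K <= m)%N then F m else 0).
Proof.
move=> KK; rewrite (big_ord_widen K' F KK) [X in X + _]big_mkcond -big_split.
by apply: eq_bigr => m _ /=; case: leqP; rewrite ?add0r ?addr0.
Qed.

(** If the tail does not vanish, the form is bounded below on subspaces of every
    dimension.  The next vector is chosen so far out that it barely meets the
    rows where the previous ones live, while those rows were cut off late enough
    to leave the previous vectors almost nothing beyond: the blocks are nearly
    orthogonal. *)
Lemma large_subspace (eps : R) : 0 < eps ->
  (forall M, ~ forall n K x, (forall j, (j < M)%N -> x j = 0) ->
    hankel_form c n K x <= eps * \sum_(j < n) cmod (x j) ^+ 2) ->
  forall s eta, 0 < eta < eps -> exists (x : nat -> nat -> R[i]) n K,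
  [/\ forall l j, (l < s)%N -> (n <= j)%N -> x l j = 0,
      forall a, \sum_(j < n) cmod (combination s x a j) ^+ 2 = \sum_(l < s) cmod (a l) ^+ 2 &
      forall a, eta * \sum_(l < s) cmod (a l) ^+ 2 <= hankel_form c n K (combination s x a)].
Proof.
move=> eps0 noM; elim=> [|s IH] eta /andP[eta0 eta_eps].
  exists (fun _ _ => 0), 0%N, 0%N; split => // a; first by rewrite !big_ord0.
  by rewrite /hankel_form !big_ord0 mulr0.
have [x [n [K [x_n x_norm x_form]]]] := IH ((eta + eps) / 2) ltac:(apply/andP; split; lra).
(* [th] is the relative cost of [cmodD_lower] and [d] the size allowed to the
   off-diagonal blocks; each of the losses they cause is at most [gam / 4]. *)
pose gam := (eps - eta) / 2; pose th := gam / (4 * eps); pose d := th * gam / 4.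
have gam0 : 0 < gam by rewrite divr_gt0 // subr_gt0.
have th0 : 0 < th by rewrite divr_gt0 // mulr_gt0.
have th_eps : th * eps = gam / 4 by rewrite /th; field; rewrite gt_eqF.
have th1 : th <= 1 by rewrite /th ler_pdivrMr ?mulr_gt0 // mul1r /gam; lra.
have d0 : 0 < d by rewrite /d divr_gt0 // mulr_gt0.
have d_th : th^-1 * d = gam / 4 by rewrite /d; field; rewrite gt_eqF.
have d_gam : d <= gam / 4.
  rewrite /d ler_pM2r ?invr_gt0 // ler_piMl //; exact: ltW.
pose u k := \sum_(l < s) hankel_form c n k (x l).
have und : {homo u : m n / (m <= n)%N >-> m <= n}.
  by move=> k k' kk; apply: ler_sum => l _; exact: form_mono.
have uB k : u k <= \sum_(l < s) n%:R * C * \sum_(j < n) cmod (x l j) ^+ 2.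
  by apply: ler_sum => l _; exact: form_bounded.
have [K1' HK1'] := bounded_nondecreasing_tail und uB d0.
pose K1 := maxn K K1'.
have dK : 0 < d / K1.+1%:R by rewrite divr_gt0.
have [M0 HM0] := entry_small dK.
have [n' [K' [z [z0 zn z1 zform]]]] := unit_witness eps0 noM (maxn n M0).
pose K2 := maxn K1 K'; pose N := maxn n n'.
have K12 : (K1 <= K2)%N by exact: leq_maxl.
pose x' l := if (l < s)%N then x l else z.
have combE a j : combination s.+1 x' a j = combination s x a j + a s * z j.
  rewrite /combination big_ord_recr /= /x' ltnn; congr (_ + _).
  by apply: eq_bigr => l _; rewrite ltn_ord.
have comb0 a j : (n <= j)%N -> combination s x a j = 0.
  by move=> nj; rewrite /combination big1 // => l _; rewrite x_n // mulr0.
have z_near j : (j < n)%N -> z j = 0 by move=> jn; apply: z0; rewrite leq_max jn.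
exists x', N, K2; split.
- move=> l j ls Nj; rewrite /x'; case: ifP => [ls'|_].
    by apply: x_n => //; apply: leq_trans Nj; exact: leq_maxl.
  by apply: zn; apply: leq_trans Nj; exact: leq_maxr.
- move=> a; rewrite big_ord_recr /= -x_norm.
  have -> : cmod (a s) ^+ 2 = \sum_(j < N) cmod (a s * z j) ^+ 2.
    under eq_bigr => j _ do rewrite cmodM exprMn.
    rewrite -mulr_sumr (sum_support (F := fun j => cmod (z j) ^+ 2) (leq_maxr n n')).
      by rewrite z1 mulr1.
    by move=> j /zn ->; rewrite cmod0 expr0n.
  rewrite -(sum_support (F := fun j => cmod (combination s x a j) ^+ 2) (leq_maxl n n')); last first.
    by move=> j /comb0 ->; rewrite cmod0 expr0n.
  rewrite -big_split; apply: eq_bigr => j _; rewrite combE.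
  have [jn|nj] := ltnP j n.
    by rewrite z_near // !mulr0 cmod0 expr0n /= !addr0.
  by rewrite comb0 // cmod0 expr0n /= !add0r.
move=> a; rewrite big_ord_recr /=; set A := \sum_(l < s) _; set t := cmod (a s) ^+ 2.
have A0 : 0 <= A by apply: sumr_ge0 => l _; exact: sqr_ge0.
have t0 : 0 <= t by exact: sqr_ge0.
pose p m := entry n m (combination s x a); pose q m := a s * entry n' m z.
have entryE m : entry N m (combination s.+1 x' a) = p m + q m.
  have -> : entry N m (combination s.+1 x' a) =
     entry N m (combination s x a) + a s * entry N m z.
    rewrite /entry mulr_sumr -big_split; apply: eq_bigr => j _ /=.
    by rewrite combE mulrDr; congr (_ + _); rewrite mulrCA.
  rewrite (entry_support m (leq_maxl n n') (comb0 a)).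
  by rewrite (entry_support m (leq_maxr n n') zn).
have p_head : (eta + eps) / 2 * A <= \sum_(m < K1) cmod (p m) ^+ 2.
  by apply: le_trans (x_form a) _; apply: form_mono; exact: leq_maxl.
have q_head : \sum_(m < K1) cmod (q m) ^+ 2 <= d * t.
  apply: (@le_trans _ _ (\sum_(m < K1) (d / K1.+1%:R * t))).
    apply: ler_sum => m _; rewrite cmodM exprMn -/t mulrC ler_wpM2r //.
    apply: le_trans (HM0 n' z m _) _; last by rewrite z1 mulr1.
    by move=> j jM; apply: z0; rewrite leq_max jM orbT.
  rewrite sumr_const card_ord -[leLHS]mulr_natl mulrA ler_wpM2r //.
  by rewrite mulrCA ger_pMr // ler_pdivrMr // mul1r ler_nat.
have q_all : eps * t <= \sum_(m < K2) cmod (q m) ^+ 2.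
  under eq_bigr => m _ do rewrite cmodM exprMn -/t.
  rewrite -mulr_sumr mulrC ler_wpM2l //; apply: le_trans (ltW zform) _.
  by apply: form_mono; exact: leq_maxr.
have p_tail : \sum_(m < K2) (if (K1 <= m)%N then cmod (p m) ^+ 2 else 0) <= d * A.
  have uK : \sum_(l < s) \sum_(m < K2) (if (K1 <= m)%N then cmod (entry n m (x l)) ^+ 2 else 0) <= d.
    have : u K2 - u K1 <= d.
      rewrite lerBlDl; apply: le_trans (HK1' K2 _) _.
        by apply: leq_trans K12; exact: leq_maxr.
      by rewrite lerD2r; apply: und; exact: leq_maxr.
    apply: le_trans; rewrite -sumrB; apply: ler_sum => l _.
    by rewrite !formE (split_sum (fun m => cmod (entry n m (x l)) ^+ 2) K12) addrAC subrr add0r.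
  rewrite mulrC; apply: le_trans (ler_wpM2l A0 uK).
  rewrite exchange_big mulr_sumr; apply: ler_sum => m _; case: ifP => _.
    by rewrite /p entry_combination; exact: cauchy_schwarz_sum.
  by rewrite big1 ?mulr0.
have -> : hankel_form c N K2 (combination s.+1 x' a) = \sum_(m < K2) cmod (p m + q m) ^+ 2.
  by apply: eq_bigr => m _; rewrite -entryE.
rewrite (split_sum (fun m => cmod (p m + q m) ^+ 2) K12).
have head : (1 - th) * ((eta + eps) / 2 * A) - th^-1 * (d * t) <=
    \sum_(m < K1) cmod (p m + q m) ^+ 2.
  apply: (@le_trans _ _ (\sum_(m < K1) ((1 - th) * cmod (p m) ^+ 2 - th^-1 * cmod (q m) ^+ 2))).
    rewrite sumrB -!mulr_sumr; apply: lerB; first by rewrite ler_wpM2l // subr_ge0.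
    by rewrite ler_wpM2l // invr_ge0 ltW.
  by apply: ler_sum => m _; exact: cmodD_lower.
have tailb : (1 - th) * (eps * t - d * t) - th^-1 * (d * A) <=
    \sum_(m < K2) (if (K1 <= m)%N then cmod (p m + q m) ^+ 2 else 0).
  have q_tail : eps * t - d * t <= \sum_(m < K2) (if (K1 <= m)%N then cmod (q m) ^+ 2 else 0).
    by have := split_sum (fun m => cmod (q m) ^+ 2) K12; lra.
  apply: (@le_trans _ _ (\sum_(m < K2) (if (K1 <= m)%N then
     (1 - th) * cmod (q m) ^+ 2 - th^-1 * cmod (p m) ^+ 2 else 0))).
    have -> : \sum_(m < K2) (if (K1 <= m)%N then
       (1 - th) * cmod (q m) ^+ 2 - th^-1 * cmod (p m) ^+ 2 else 0) =
       (1 - th) * (\sum_(m < K2) (if (K1 <= m)%N then cmod (q m) ^+ 2 else 0)) -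
       th^-1 * (\sum_(m < K2) (if (K1 <= m)%N then cmod (p m) ^+ 2 else 0)).
      rewrite !mulr_sumr -sumrB; apply: eq_bigr => m _.
      by case: ifP => _ //; rewrite !mulr0 subrr.
    apply: lerB; first by rewrite ler_wpM2l // subr_ge0.
    by rewrite ler_wpM2l // invr_ge0 ltW.
  apply: ler_sum => m _; case: ifP => // _; rewrite [p m + _]addrC; exact: cmodD_lower.
apply: le_trans (lerD head tailb).
have cA : eta <= (1 - th) * ((eta + eps) / 2) - th^-1 * d.
  rewrite d_th mulrBl mul1r; have : th * ((eta + eps) / 2) <= th * eps by rewrite ler_wpM2l ?(ltW th0) //; lra.
  by rewrite th_eps /gam; lra.
have ct : eta <= (1 - th) * (eps - d) - th^-1 * d.
  rewrite d_th mulrBl mul1r mulrBr th_eps; have : 0 <= th * d by rewrite mulr_ge0 ?ltW.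
  by move: d_gam; rewrite /gam; lra.
have := ler_wpM2r A0 cA; have := ler_wpM2r t0 ct.
rewrite mulrDr; lra.
Qed.

End Greedy.

(** * The equivalence *)

Section Equivalence.
Context {R : realType}.
Implicit Types (f : R -> R[i]).

Lemma hankel_form_ext c n K (x y : nat -> R[i]) : (forall j, (j < n)%N -> x j = y j) ->
  hankel_form c n K x = hankel_form c n K y.
Proof.
move=> xy; apply: eq_bigr => m _; congr (cmod _ ^+ 2).
by apply: eq_bigr => j _; rewrite xy.
Qed.

Lemma hankel_form_support c n n' K (x : nat -> R[i]) : (n <= n')%N ->
  (forall j, (n <= j)%N -> x j = 0) -> hankel_form c n' K x = hankel_form c n K x.
Proof.
move=> nn x0; apply: eq_bigr => m _; congr (cmod _ ^+ 2).
rewrite (big_ord_widen n' (fun j => c (j + m).+1 * x j) nn) [RHS]big_mkcond.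
by apply: eq_bigr => j _; case: ltnP => // nj; rewrite x0 // mulr0.
Qed.

Lemma symbol_bounded f N : L2T f ->
  \sum_(k < N) cmod (hankel_symbol f k) ^+ 2 <= L2norm f ^+ 2.
Proof.
move=> If; rewrite -(L2norm_conj f).
by apply: (@bessel_nat _ _ (fun k => - k%:Z)) => [a b /oppr_inj[]|]; last exact: L2T_conj.
Qed.

(** A subspace of dimension larger than the rank on which the form is large would
    contain a vector killed by the low-rank part, on which the form is small.
    The map [rho n] is the identity or the reversal of the first [n] entries,
    according to which of the two Hankel forms is being bounded. *)
Lemma tail_of_cluster f g (rho : nat -> (nat -> R[i]) -> (nat -> R[i])) :
  L2T f -> L2T g ->
  (forall n s x a j, (j < n)%N -> rho n (combination s x a) j =
    combination s (fun l => rho n (x l)) a j) ->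
  (forall n x, \sum_(j < n) cmod (rho n x j) ^+ 2 = \sum_(j < n) cmod (x j) ^+ 2) ->
  (forall n K x, hankel_form (hankel_symbol g) n K x <= L2norm (residue f n (rho n x)) ^+ 2) ->
  type2_strong_cluster_to0 (semicommutator_mx f) -> vanishing_tail (hankel_symbol g).
Proof.
move=> If ig rho_lin rho_norm rho_form cl.
apply: contrapT => /existsNP[eps /not_implyP[eps0 /forallNP noM]].
have e4 : 0 < eps / 4 by rewrite divr_gt0.
have [r [n0 ker]] := cluster_kernel If cl e4.
have [|x [n1 [K [x_n x_norm x_form]]]] :=
  large_subspace (fun N => symbol_bounded N ig) eps0 noM r.+1 (eta := eps / 2).
  by apply/andP; split; lra.
pose n := maxn n1 n0.+1; have n1n : (n1 <= n)%N by exact: leq_maxl.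
pose X : 'M[R[i]]_(n, r.+1) := \matrix_(i, l) rho n (x l) i.
have [|a a0 small] := ker n r.+1 X _ (ltnSn r); first exact: leq_maxr.
pose a' (l : nat) : R[i] := if insub l is Some i then a (i : 'I_r.+1) 0 else 0.
have a'E (l : 'I_r.+1) : a' l = a l 0 by rewrite /a' valK.
pose y := combination r.+1 x a'.
have y0 j : (n1 <= j)%N -> y j = 0.
  by move=> nj; rewrite /y /combination big1 // => l _; rewrite x_n // mulr0.
have := small (rho n y) _.
have norm_y : \sum_(j < n) cmod (y j) ^+ 2 = \sum_(l < r.+1) cmod (a' l) ^+ 2.
  rewrite -x_norm (big_ord_widen n (fun j => cmod (y j) ^+ 2) n1n) [RHS]big_mkcond.
  by apply: eq_bigr => j _; case: ltnP => // nj; rewrite y0 // cmod0 expr0n.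
rewrite rho_norm norm_y; set S := \sum_(l < r.+1) _.
have S0 : 0 < S.
  rewrite lt_neqAle sumr_ge0 ?andbT; last by move=> l _; exact: sqr_ge0.
  rewrite eq_sym; apply: contra_neq a0 => Sz; apply/matrixP => l k.
  rewrite ord1 mxE -a'E; apply: cmod0_eq0; apply/eqP; rewrite -sqrf_eq0; apply/eqP.
  by apply: (psumr_eq0P _ Sz) => // i _; exact: sqr_ge0.
have lower : eps / 2 * S <= L2norm (residue f n (rho n y)) ^+ 2.
  apply: le_trans (rho_form n K y).
  by rewrite (hankel_form_support _ _ n1n y0); exact: x_form.
move=> H; have {}H := le_trans lower (H _).
suff : eps / 2 * S <= eps / 4 * S by rewrite ler_pM2r //; lra.
apply: H => j; rewrite rho_lin // mxE; apply: eq_bigr => l _.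
by rewrite mxE a'E mulrC.
Qed.

Lemma cluster_iff f : L2T f -> type2_strong_cluster_to0 (semicommutator_mx f) <->
  vanishing_tail (hankel_symbol f) /\ vanishing_tail (hankel_symbol (ftilde f)).
Proof.
move=> If; have It := L2T_ftilde If; split=> [cl|[t1 t2]]; last exact: cluster_of_tails.
have form_ge0 (c x : nat -> R[i]) n K : 0 <= hankel_form c n K x.
  by apply: sumr_ge0 => m _; exact: sqr_ge0.
split.
- apply: (@tail_of_cluster f f (fun n x => x)) => // n K x.
  by apply: le_trans (residue_ge If n K x); rewrite lerDl.
- apply: (@tail_of_cluster f (ftilde f) (@reversed R)) => // [n x|n K x].
    by rewrite [RHS](reindex_inj rev_ord_inj).
  apply: le_trans (residue_ge If n K _).
  rewrite (@hankel_form_ext _ n K x (reversed n (reversed n x))) ?lerDr //.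
  by move=> j jn; rewrite /reversed; congr x; lia.
Qed.

Lemma compact_semicommutator_iff f : L2T f ->
  (exists2 A, toeplitz_semicommutator f A & compact_on_H2 A) <->
  vanishing_tail (hankel_symbol f).
Proof.
move=> If; split=> [[A sA cA]|]; last exact: compact_semicommutator_of_tail.
exact: tail_of_compact_semicommutator sA cA.
Qed.

End Equivalence.

Theorem theorem1p1 (R : realType) (f : R -> R[i]) (hf : BMO f) :
  type2_strong_cluster_to0
    (fun n : nat => toeplitz_mx (fsqmod f) n
                    - toeplitz_mx f n *m toeplitz_mx (fconj f) n)
  <->
  (exists2 A, toeplitz_semicommutator f A & compact_on_H2 A) /\
  (exists2 B, toeplitz_semicommutator (ftilde f) B & compact_on_H2 B).
Proof.
have [If _] := hf.
rewrite (compact_semicommutator_iff If) (compact_semicommutator_iff (L2T_ftilde If)).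
exact: cluster_iff.
Qed.
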